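(* Let $n\ge 2$ and let $\Omega$ be an open bounded smooth subset of $\mathbb{R}^n$. If $u$ is harmonic in $\Omega$ and continuous on $\overline{\Omega}$, then $u$ belongs to $H^{1/2}(\Omega)$. If $u$ is harmonic in $\Omega$ and belongs to $C^{0,\alpha}(\overline{\Omega})$ for some $0<\alpha<1$, then $u$ belongs to $H^{\sigma+1/2}(\Omega)$ for all $0<\sigma<\alpha$.
   Context: ''Smooth'' means that the boundary of $\Omega$ is of class $C^\infty$. $C^{0,\alpha}$ denotes the space of H\''older continuous functions with exponent $\alpha$. $H^s$ denotes the usual $L^2$-based Sobolev space of (possibly fractional) order $s$. *)

(* Defs.v *)
From HB Require Import structures.
From mathcomp Require Import all_boot all_order all_algebra.
From mathcomp Require Import all_classical all_reals all_analysis.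

Set Implicit Arguments.
Unset Strict Implicit.
Unset Printing Implicit Defensive.

Import Order.TTheory GRing.Theory Num.Theory.
Import numFieldNormedType.Exports.

Local Open Scope classical_set_scope.
Local Open Scope ring_scope.

(* The sigma-algebra on 'rV[R]_n is generated by the coordinate maps; it is
   the Borel sigma-algebra of R^n. *)
Definition rV_display : measure_display. Proof. by constructor. Qed.

Section rV_measurable.
Variables (R : realType) (n : nat).

Definition rV_coord (i : 'I_n) (x : 'rV[R]_n) : measurableTypeR R := x 0 i.

Let rV_set0 : g_sigma_preimage rV_coord set0.
Proof. exact: sigma_algebra0. Qed.

Let rV_setC A : g_sigma_preimage rV_coord A -> g_sigma_preimage rV_coord (~` A).
Proof. exact: sigma_algebraC. Qed.

Let rV_bigcup (F : (set 'rV[R]_n)^nat) :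
  (forall i, g_sigma_preimage rV_coord (F i)) ->
  g_sigma_preimage rV_coord (\bigcup_i (F i)).
Proof. exact: sigma_algebra_bigcup. Qed.

HB.instance Definition _ := @isMeasurable.Build rV_display
  'rV[R]_n (g_sigma_preimage rV_coord) rV_set0 rV_setC rV_bigcup.

Lemma measurable_rV_coord (i : 'I_n) : measurable_fun setT (rV_coord i).
Proof.
move=> _ Y mY; rewrite setTI; apply: sub_sigma_algebra => /=.
rewrite -bigcup_seq/=; exists i => /=; first by rewrite mem_index_enum.
by exists Y => //; rewrite setTI.
Qed.

Lemma measurable_fun_rV d (T : measurableType d) (f : T -> 'rV[R]_n) :
  (forall i, measurable_fun setT (rV_coord i \o f)) -> measurable_fun setT f.
Proof.
move=> mf _ A mA.
suff : g_sigma_preimage (fun i => rV_coord i \o f) `<=` measurable.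
  by rewrite g_sigma_preimage_comp; apply; exists A.
apply: smallest_sub; first exact: sigma_algebra_measurable.
rewrite -bigcup_seq => _ [i /= _] [B mB <-].
exact: mf.
Qed.

End rV_measurable.

Section lebesgue_rV.
Variable R : realType.

Definition rV_cons n (p : measurableTypeR R * 'rV[R]_n) : 'rV[R]_n.+1 :=
  row_mx (const_mx p.1 : 'rV_1) p.2.

Definition rV_uncons n (x : 'rV[R]_n.+1) : measurableTypeR R * 'rV[R]_n :=
  (x 0 0, rsubmx (x : 'rV_(1 + n))).

Lemma rV_consK n : cancel (@rV_cons n) (@rV_uncons n).
Proof.
move=> [a v]; rewrite /rV_uncons /rV_cons row_mxKr; congr pair.
rewrite mxE; case: split_ordP; first by move=> j _; rewrite mxE.
by move=> j /(congr1 (@nat_of_ord _)).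
Qed.

Lemma measurable_rV_cons n : measurable_fun setT (@rV_cons n).
Proof.
apply: measurable_fun_rV => i; rewrite /comp /rV_coord /rV_cons.
under eq_fun do rewrite mxE.
case: split_ordP => j _; first by under eq_fun do rewrite mxE; exact: measurable_fst.
exact: (measurableT_comp (measurable_rV_coord j)).
Qed.

Lemma measurable_rV_uncons n : measurable_fun setT (@rV_uncons n).
Proof.
apply: measurable_fun_pair => /=; first exact: (measurable_rV_coord ord0).
apply: measurable_fun_rV => i; rewrite /comp /rV_coord.
under eq_fun do rewrite mxE.
exact: (measurable_rV_coord (rshift 1 i)).
Qed.

HB.instance Definition _ n :=
  isMeasurableFun.Build _ _ _ _ (@rV_cons n) (@measurable_rV_cons n).

Section step.
Variables (n : nat) (mu : {sigma_finite_measure set 'rV[R]_n -> \bar R}).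

Let nu : set 'rV[R]_n.+1 -> \bar R :=
  pushforward (@lebesgue_measure R \x mu)%E (@rV_cons n).

Let nu0 : nu set0 = 0%E. Proof. exact: measure0. Qed.

Let nu_ge0 A : (0 <= nu A)%E. Proof. exact: measure_ge0. Qed.

Let nu_sigma_additive : semi_sigma_additive nu.
Proof. exact: measure_semi_sigma_additive. Qed.

HB.instance Definition _ := isMeasure.Build _ _ _ nu
  nu0 nu_ge0 nu_sigma_additive.

Let nu_sigma_finite : sigma_finite setT nu.
Proof.
have /sigma_finiteP[F [FT ndF Foo]] := sigma_finiteT (@lebesgue_measure R).
have /sigma_finiteP[G [GT ndG Goo]] := sigma_finiteT mu.
exists (fun k => @rV_uncons n @^-1` (F k `*` G k)).
  rewrite -preimage_bigcup (_ : \bigcup_k _ = setT) ?preimage_setT//.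
  apply/seteqP; split => // -[a v] _.
  have [k _ Fka] : (\bigcup_k F k) a by rewrite -FT.
  have [l _ Glv] : (\bigcup_k G k) v by rewrite -GT.
  exists (maxn k l) => //; split => /=.
    by move: a Fka; exact/subsetPset/ndF/leq_maxl.
  by move: v Glv; exact/subsetPset/ndG/leq_maxr.
move=> k; have [mF Fk] := Foo k; have [mG Gk] := Goo k.
have mFG : measurable (F k `*` G k) by exact: measurableX.
split; first by rewrite -[X in measurable X]setTI; exact: measurable_rV_uncons.
rewrite /nu /pushforward -comp_preimage.
rewrite (_ : _ \o _ = id) ?preimage_id; last exact/funext/rV_consK.
by rewrite product_measure1E// lte_mul_pinfty// ge0_fin_numE.
Qed.

HB.instance Definition _ := Measure_isSigmaFinite.Build _ _ _ nu
  nu_sigma_finite.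

Definition lebesgue_rV_step :
  {sigma_finite_measure set 'rV[R]_n.+1 -> \bar R} := nu.

End step.

(* n-dimensional Lebesgue measure: R^n.+1 is identified with R * R^n, and R^0
   carries a unit mass. *)
Fixpoint lebesgue_rV (n : nat) :
    {sigma_finite_measure set 'rV[R]_n -> \bar R} :=
  match n with
  | 0%N => dirac (0 : 'rV[R]_0)
  | k.+1 => lebesgue_rV_step (lebesgue_rV k)
  end.

End lebesgue_rV.

Section calculus.
Variables (R : realType) (n : nat).
Implicit Types (U : set 'rV[R]_n) (f g phi : 'rV[R]_n -> R).

(* The norm `|x| of 'rV[R]_n is the sup norm; it induces the same topology. *)
Definition euclidean_norm (x : 'rV[R]_n) : R :=
  Num.sqrt (\sum_(i < n) x 0 i ^+ 2).

Definition partial (i : 'I_n) f : 'rV[R]_n -> R :=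
  fun x => 'D_(delta_mx 0 i) f x.

Definition partials (w : seq 'I_n) f : 'rV[R]_n -> R := foldr partial f w.

(* All iterated partial derivatives of order at most k exist and are
   continuous on U, which is meant to be open. *)
Definition classC (k : nat) U f : Prop :=
  forall w : seq 'I_n, (size w <= k)%N -> forall x, U x ->
    {for x, continuous (partials w f)} /\
    ((size w < k)%N ->
      forall i, derivable (partials w f) x (delta_mx 0 i)).

Definition smooth U f : Prop := forall k, classC k U f.

Definition harmonic_in U f : Prop :=
  classC 2 U f /\
  forall x, U x -> \sum_(i < n) partial i (partial i f) x = 0.

Definition holder (alpha : R) (A : set 'rV[R]_n) f : Prop :=
  exists C : R, forall x y, A x -> A y ->
    `|f x - f y| <= C * euclidean_norm (x - y) `^ alpha.

Definition test_function U phi : Prop :=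
  [/\ smooth setT phi,
      compact (closure [set x | phi x != 0]) &
      closure [set x | phi x != 0] `<=` U].

Definition multi_order (a : {ffun 'I_n -> nat}) : nat := (\sum_(i < n) a i)%N.

Definition multi_partial (a : {ffun 'I_n -> nat}) f : 'rV[R]_n -> R :=
  foldr (fun i => iter (a i) (partial i)) f (enum 'I_n).

Definition square_integrable U f : Prop :=
  f \_ U \in Lfun (lebesgue_rV R n) 2%:E.

(* Meant for f and g locally integrable on U. *)
Definition weak_derivative U (a : {ffun 'I_n -> nat}) f g : Prop :=
  forall phi, test_function U phi ->
    (\int[lebesgue_rV R n]_(x in U) (f x * multi_partial a phi x)%:E =
     ((-1) ^+ multi_order a)%:E *
       \int[lebesgue_rV R n]_(x in U) (g x * phi x)%:E)%E.

(* Square of the Gagliardo seminorm of order theta, for 0 < theta < 1. The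
   integrand is 0 on the diagonal, which is a null set. *)
Definition gagliardo (theta : R) U f : \bar R :=
  (\int[lebesgue_rV R n \x lebesgue_rV R n]_(p in U `*` U)
    ((f p.1 - f p.2) ^+ 2 /
       euclidean_norm (p.1 - p.2) `^ (n%:R + 2 * theta))%:E)%E.

(* H^s(U) for s >= 0, in the sense of Sobolev-Slobodeckij: with k the integral
   part of s, all weak derivatives of order at most k are in L^2(U), and those
   of order k have a finite Gagliardo seminorm of order s - k when s <> k. *)
Definition sobolev (s : R) U f : Prop :=
  let k := Num.truncn s in
  square_integrable U f /\
  forall a : {ffun 'I_n -> nat}, (multi_order a <= k)%N ->
    exists g, [/\ square_integrable U g,
                  weak_derivative U a f g &
                  multi_order a = k -> k%:R < s ->
                    (gagliardo (s - k%:R) U g < +oo)%E].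

End calculus.

(* The boundary of Omega is locally the graph of a smooth function of all the
   coordinates but one, with Omega lying on one side of it (above it if b is
   false, below it if b is true). *)
Definition smooth_boundary (R : realType) (n : nat)
    (Omega : set 'rV[R]_n) : Prop :=
  forall x0, (closure Omega `\` interior Omega) x0 ->
    exists (i : 'I_n) (b : bool) (gamma : 'rV[R]_n.-1 -> R),
      smooth setT gamma /\
      \forall x \near x0,
        Omega x <-> (-1) ^+ b * gamma (col' i x) < (-1) ^+ b * x 0 i.

(* Main.v *)
(* All estimates are made in the sup norm. Near a boundary point let rho be the
   height above the graph that describes the boundary; near an interior point
   any affine coordinate that is positive on a small ball will do.

   For 0 < theta < 1 the Gagliardo seminorm of order theta is controlled locally
   by the integral of rho^(2 - 2 theta) |grad f|^2: go from x to x + h by first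
   moving up by a multiple of |h|, then along the coordinate axes, then down
   again, the vertical legs being cut into dyadic steps.

   If u is harmonic and bounded, rho |grad u|^2 is integrable: the Laplacian of
   u^2 is 2 |grad u|^2, and the Laplacian of a cutoff times (rho - eps)^+ is
   bounded in L^1 uniformly in eps. Second differences and the translation
   invariance of Lebesgue measure replace the integration by parts. This is
   theta = 1/2.

   If u is moreover Hoelder continuous of exponent alpha, the maximum principle
   gives |grad u| <= C rho^(alpha - 1) and |D^2 u| <= C rho^(alpha - 2), and
   rho^(2 alpha - 2 sigma - 1) is integrable; this is applied to u itself when
   sigma < 1/2 and to its first derivatives when sigma > 1/2. *)
From HB Require Import structures.
From mathcomp Require Import all_boot all_order all_algebra.
From mathcomp Require Import all_classical all_reals all_analysis.
From mathcomp Require Import measurable_realfun ring lra.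
Require Import Defs.

Set Implicit Arguments.
Unset Strict Implicit.
Unset Printing Implicit Defensive.

Import Order.TTheory GRing.Theory Num.Theory.
Import numFieldNormedType.Exports.

Local Open Scope classical_set_scope.
Local Open Scope ring_scope.

(** * Lebesgue measure on R^n *)

(** [harmonic_in] only provides C^2, so the first derivatives of u are not known to be twice
    differentiable. Harmonicity is therefore recast through second differences ([dharmonic]):
    increments u(. + t e_j) - u inherit it, and the barrier argument applied to them bounds the
    second derivatives of u.

    The weight exponent 2 - 2 theta comes from exchanging the order of integration: at height rho
    only increments h with |h| of order at most rho are charged, and the integral of |h|^(2 - n - 2
    theta) over such h is of order rho^(2 - 2 theta); this uses theta < 1. The vertical legs descend
    to the starting height; their k-th dyadic piece costs 2^(-2 theta k), which beats the weights
    2^(theta k) spent on squaring the sum; this uses theta > 0.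

    In the energy bound, eps keeps the support of the cutoff away from the boundary, where second
    differences of u^2 are under control. The kink at rho = eps has second differences of order t,
    but only on a slab of thickness of order t, hence of order t^2 in L^1 whatever eps is. *)

Lemma lebesgue_integral_shift (R : realType) (a : R) (f : measurableTypeR R -> \bar R) :
  measurable_fun setT f -> (forall x, 0 <= f x)%E ->
  (\int[@lebesgue_measure R]_x f (x + a)%R = \int[@lebesgue_measure R]_x f x)%E.
Proof.
move=> mf f0.
pose phi := fun x : measurableTypeR R => x + a : measurableTypeR R.
have mphi : measurable_fun setT phi.
  by apply: measurable_funD; [exact: measurable_id|exact: measurable_cst].
transitivity (\int[pushforward (@lebesgue_measure R) phi]_x f x)%E.
  by rewrite (ge0_integral_pushforward mphi).
pose F : {mfun measurableTypeR R >-> measurableTypeR R} :=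
  HB.pack phi (isMeasurableFun.Build _ _ _ _ phi mphi).
apply: (@eq_measure_integral _ _ _ _ (@lebesgue_measure R)
  (pushforward (@lebesgue_measure R) F)) => A mA _.
apply/esym.
(* Half-open intervals determine Lebesgue measure, and translation preserves their length. *)
apply: (@lebesgue_measure_unique R (pushforward (@lebesgue_measure R) F)) => //.
move=> _ [[b c] bc <-] /=.
have E : phi @^-1` `]b, c]%classic = `]b - a, c - a]%classic.
  by apply/seteqP; split => x /=; rewrite /phi !in_itv/= ltrBlDr lerBrDr.
transitivity (lebesgue_measure (phi @^-1` `]b, c]%classic)); last by [].
rewrite E.
rewrite !lebesgue_measure_itv/= !lte_fin ltrD2r.
by case: ifP => // _; rewrite -!EFinB; congr EFin; ring.
Qed.

Section tonelli.
Variables (R : realType) (n : nat).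

Lemma integral_rVS (f : 'rV[R]_n.+1 -> \bar R) :
  measurable_fun setT f -> (forall x, 0 <= f x)%E ->
  (\int[lebesgue_rV R n.+1]_x f x =
   \int[@lebesgue_measure R]_a \int[lebesgue_rV R n]_v f (rV_cons (a, v)))%E.
Proof.
move=> mf f0.
transitivity (\int[(@lebesgue_measure R \x lebesgue_rV R n)%E]_p
    (f \o @rV_cons R n) p)%E.
  apply: (ge0_integral_pushforward (@measurable_rV_cons R n)) => //.
rewrite fubini_tonelli1//=.
by apply: measurableT_comp => //; exact: measurable_rV_cons.
Qed.

End tonelli.

Section cons.
Variables (R : realType) (n : nat).
Lemma rV_consE0 (p : measurableTypeR R * 'rV[R]_n) : rV_cons p 0 0 = p.1.
Proof. by have /(congr1 fst) := rV_consK p. Qed.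
Lemma rV_consE (p : measurableTypeR R * 'rV[R]_n) i : rV_cons p 0 (lift ord0 i) = p.2 0 i.
Proof.
have /(congr1 snd) /= <- := rV_consK p.
by rewrite [RHS]mxE; congr (_ _ _); apply: val_inj.
Qed.
Lemma rV_consD (p q : measurableTypeR R * 'rV[R]_n) :
  rV_cons p + rV_cons q = rV_cons (p.1 + q.1, p.2 + q.2).
Proof.
apply/rowP => i; rewrite mxE.
by case: (unliftP ord0 i) => [j ->|->]; rewrite ?rV_consE0 ?rV_consE //= mxE.
Qed.
Lemma rV_unconsK : cancel (@rV_uncons R n) (@rV_cons R n).
Proof.
move=> x; apply/rowP => i.
case: (unliftP ord0 i) => [j ->|->]; rewrite ?rV_consE0 ?rV_consE //=.
by rewrite [LHS]mxE; congr (_ _ _); apply: val_inj.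
Qed.
End cons.

Section measurability.
Variables (R : realType).

Lemma measurable_rVD d (T : measurableType d) n (f g : T -> 'rV[R]_n) :
  measurable_fun setT f -> measurable_fun setT g ->
  measurable_fun setT (fun x => f x + g x).
Proof.
move=> mf mg; apply: measurable_fun_rV => i.
rewrite (_ : _ \o _ = fun x => rV_coord i (f x) + rV_coord i (g x)); last first.
  by apply/funext => x; rewrite /rV_coord /= mxE.
by apply: measurable_funD; (apply: measurableT_comp; [exact: measurable_rV_coord|]).
Qed.

Lemma measurable_rVZ d (T : measurableType d) n (f : T -> R) (g : T -> 'rV[R]_n) :
  measurable_fun setT f -> measurable_fun setT g ->
  measurable_fun setT (fun x => f x *: g x).
Proof.
move=> mf mg; apply: measurable_fun_rV => i.
rewrite (_ : _ \o _ = fun x => f x * rV_coord i (g x)); last first.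
  by apply/funext => x; rewrite /rV_coord /= mxE.
by apply: measurable_funM => //; apply: measurableT_comp; [exact: measurable_rV_coord|].
Qed.

Lemma rV_shift n (h : 'rV[R]_n) : measurable_fun setT (fun x : 'rV[R]_n => x + h).
Proof. by apply: measurable_rVD; [exact: measurable_id|exact: measurable_cst]. Qed.

(** Induction on the dimension by Tonelli, one coordinate at a time. This invariance later moves
    differences from one factor of an integral to the other. *)
Lemma integral_rV_shift n (h : 'rV[R]_n) (f : 'rV[R]_n -> \bar R) :
  measurable_fun setT f -> (forall x, 0 <= f x)%E ->
  (\int[lebesgue_rV R n]_x f (x + h)%R = \int[lebesgue_rV R n]_x f x)%E.
Proof.
elim: n => [|n IH] in h f *.
  move=> mf f0; apply: eq_integral => x _; congr f; apply/rowP => -[]//.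
move=> mf f0.
have mfh k : measurable_fun setT (fun x : 'rV[R]_n.+1 => f (x + k)).
  by apply: measurableT_comp => //; exact: rV_shift.
rewrite (integral_rVS (mfh h) (fun x => f0 (x + h))) (integral_rVS mf f0).
pose p := rV_uncons h; have -> : h = rV_cons p by rewrite rV_unconsK.
transitivity (\int[@lebesgue_measure R]_a \int[lebesgue_rV R n]_v f (rV_cons (a + p.1, v)%R))%E.
  apply: eq_integral => a _.
  rewrite -(IH p.2 (fun v => f (rV_cons (a + p.1, v)%R))).
  - by apply: eq_integral => v _; rewrite rV_consD.
  - apply: measurableT_comp => //.
    by apply: measurableT_comp; [exact: measurable_rV_cons|exact: pair1_measurable].
  - by move=> ?.
rewrite (lebesgue_integral_shift _ (f := fun a => \int[lebesgue_rV R n]_v f (rV_cons (a, v)))%E) //.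
  apply: (@measurable_fun_fubini_tonelli_F _ _ _ _ _ _ (f \o @rV_cons R n)).
    by apply: measurableT_comp => //; exact: measurable_rV_cons.
  by move=> ?; exact: f0.
by move=> a; apply: integral_ge0.
Qed.

Lemma measurable_cube n (c : 'rV[R]_n) (r : R) :
  measurable [set x : 'rV[R]_n | forall i, `|x 0 i - c 0 i| <= r].
Proof.
rewrite (_ : [set _ | _] = \bigcap_(i in [set: 'I_n]) [set x : 'rV[R]_n| `|x 0 i - c 0 i| <= r]); last first.
  by apply/seteqP; split => x /= H i *; apply: H.
apply: fin_bigcap_measurable => // i _.
rewrite -[X in measurable X]setTI.
have : measurable_fun setT (fun x : 'rV[R]_n => `|x 0 i - c 0 i|).
  apply: measurableT_comp => //.
  by apply: measurable_funB; [exact: (measurable_rV_coord i)|exact: measurable_cst].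
move=> /(_ measurableT `]-oo, r]%classic).
rewrite (_ : _ @^-1` _ = [set x : 'rV[R]_n | `|x 0 i - c 0 i| <= r]); first exact.
by apply/seteqP; split => x /=; rewrite in_itv.
Qed.

Lemma lebesgue_rV_cube n (c : 'rV[R]_n) (r : R) : 0 <= r ->
  lebesgue_rV R n [set x | forall i, `|x 0 i - c 0 i| <= r] = (((2 * r) ^+ n)%:E).
Proof.
move=> r0; elim: n => [|n IH] in c *.
  by rewrite expr0 /= /dirac indicE mem_set//= => -[].
transitivity (\int[lebesgue_rV R n.+1]_x
    (\1_[set x : 'rV[R]_n.+1 | forall i, `|x 0 i - c 0 i| <= r] x)%:E)%E.
  by rewrite integral_indic ?setIT//; exact: measurable_cube.
rewrite integral_rVS //; last first.
  by apply/measurable_EFinP; apply: measurable_indic; exact: measurable_cube.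
pose I := `[c 0 0 - r, c 0 0 + r]%classic : set (measurableTypeR R).
pose c' := (rV_uncons c).2.
transitivity (\int[@lebesgue_measure R]_a ((\1_I a)%:E *
   \int[lebesgue_rV R n]_v
     (\1_[set x : 'rV[R]_n | forall i, `|x 0 i - c' 0 i| <= r] v)%:E))%E.
  apply: eq_integral => a _; rewrite -ge0_integralZl//; last first.
    by apply/measurable_EFinP; apply: measurable_indic; exact: measurable_cube.
  apply: eq_integral => v _; rewrite -EFinM; congr EFin.
  rewrite !indicE -natrM mulnb; congr (_ : nat)%:R; congr nat_of_bool.
  apply/idP/andP.
    move=> /set_mem/= H; split; apply/mem_set.
      have := H ord0; rewrite rV_consE0/= ler_distl /I /= in_itv/=.
      by move=> /andP[] *; apply/andP; split; lra.
    move=> i /=; have := H (lift ord0 i); rewrite rV_consE/= /c'.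
    by rewrite -[c in X in X -> _]rV_unconsK rV_consE.
  move=> [/set_mem + /set_mem/= H]; rewrite /I /= in_itv/= => H0.
  apply/mem_set => /= i.
  case: (unliftP ord0 i) => [j ->|->].
    by rewrite rV_consE -[c]rV_unconsK rV_consE.
  by rewrite rV_consE0/= ler_distl; move: H0 => /andP[] *; apply/andP; split; lra.
have -> : (\int[lebesgue_rV R n]_v
     (\1_[set x : 'rV[R]_n | forall i, `|x 0 i - c' 0 i| <= r] v)%:E =
     ((2 * r) ^+ n)%:E)%E.
  rewrite integral_indic//; last exact: measurable_cube.
  by rewrite setIT; exact: IH.
have mI : measurable I by exact: measurable_itv.
rewrite ge0_integralZr//; last 2 first.
- by apply/measurable_EFinP; exact: measurable_indic.
- by rewrite lee_fin exprn_ge0// mulr_ge0.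
rewrite integral_indic// setIT.
have := lebesgue_measure_itv `[c 0 0 - r, c 0 0 + r].
move=> E; transitivity (lebesgue_measure I * ((2 * r) ^+ n)%:E)%E => //.
rewrite {}E /= lte_fin.
case: ifPn => [_|]; first by rewrite -EFinB -EFinM exprS; congr EFin; ring.
rewrite -leNgt => H; have -> : r = 0 by lra.
by rewrite mulr0 [in RHS]expr0n mul0e.
Qed.

Lemma cube_ball n (c : 'rV[R]_n) (r : R) : 0 <= r ->
  [set x : 'rV[R]_n | forall i, `|x 0 i - c 0 i| <= r] = [set x | `|x - c| <= r].
Proof.
move=> r0; apply/seteqP; split => x /=.
  move=> H; rewrite [leLHS]/Num.norm /= mx_normrE; apply/bigmax_leP; split => // -[i j] _ /=.
  by rewrite ord1 !mxE.
move=> + i; apply: le_trans.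
rewrite [leRHS]/Num.norm /= mx_normrE; apply: le_trans (le_bigmax _ _ (0, i)).
by rewrite /= !mxE.
Qed.

Lemma rV_coord_le n (x : 'rV[R]_n) i : `|x 0 i| <= `|x|.
Proof.
rewrite [leRHS]/Num.norm /= mx_normrE.
by apply: le_trans (le_bigmax _ _ (0, i)).
Qed.

Lemma rV_norm_le n (x : 'rV[R]_n) r : 0 <= r -> (forall i, `|x 0 i| <= r) -> `|x| <= r.
Proof.
move=> r0 H; rewrite [leLHS]/Num.norm /= mx_normrE.
by apply/bigmax_leP; split => // -[i j] _ /=; rewrite ord1.
Qed.

Lemma measurable_cball n (c : 'rV[R]_n) r : 0 <= r -> measurable [set x | `|x - c| <= r].
Proof. by move=> r0; rewrite -cube_ball//; exact: measurable_cube. Qed.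

Lemma lebesgue_rV_ball n (c : 'rV[R]_n) r : 0 <= r ->
  lebesgue_rV R n [set x | `|x - c| <= r] = (((2 * r) ^+ n)%:E).
Proof. by move=> r0; rewrite -cube_ball// lebesgue_rV_cube. Qed.

(** The sigma-algebra is generated by coordinates, so an open set is exhibited as a countable union
    of closed cubes with rational centres and radii 1/(k+1). *)
Lemma open_measurable_rV n (U : set 'rV[R]_n) : open U -> measurable U.
Proof.
move=> oU.
pose cb (p : 'rV[rat]_n * nat) := [set x : 'rV[R]_n | forall i, `|x 0 i - ratr (p.1 0 i)| <= p.2.+1%:R^-1].
rewrite (_ : U = \bigcup_p (if pselect (cb p `<=` U) then cb p else set0)).
  apply: countable_bigcupT_measurable => [|p]; first exact: countableP.
  case: pselect => [H|H] /=; last exact: measurable0.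
  rewrite (_ : cb p = [set x : 'rV[R]_n | forall i, `|x 0 i - (map_mx ratr p.1 : 'rV[R]_n) 0 i| <= p.2.+1%:R^-1]).
    exact: measurable_cube.
  by apply/seteqP; split => x /= Hx i; have := Hx i; rewrite ?mxE.
apply/seteqP; split => [x Ux|x [p _]]; last first.
  by case: pselect => /= [H Hx|_ []]; exact: H.
have /nbhs_ballP[e /= e0 eU] := open_nbhs_nbhs (conj oU Ux).
(* Half of [e], because two points of one cube are compared through its centre and may be 2/(k+1)
   apart. *)
have [k ke] : exists k : nat, k.+1%:R^-1 < e / 2.
  by have := near_infty_natSinv_lt (PosNum (divr_gt0 e0 (ltr0n R 2))) => -[k _ /(_ k (leqnn k))]; exists k.
have /choice[q Hq] : forall i, exists q : rat, `|x 0 i - ratr q| < k.+1%:R^-1.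
  move=> i; have [|q] := @rat_in_itvoo R (x 0 i - k.+1%:R^-1) (x 0 i + k.+1%:R^-1).
    by rewrite ltrD2l gt0_cp.
  by rewrite in_itv/= => xq; exists q; rewrite distrC ltr_distl.
exists (\row_i q i, k) => //.
case: pselect => [_ i /=|[]]; first by rewrite mxE; exact: ltW.
move=> y Hy; apply: eU; rewrite -ball_normE /= distrC.
have ke' : 2 * k.+1%:R^-1 < e by rewrite mulrC -ltr_pdivlMr.
apply: le_lt_trans ke'.
apply: rV_norm_le => [|i]; first by rewrite mulr_ge0.
have := Hy i; have := Hq i; rewrite !mxE /=.
move=> /ltW; rewrite !ler_distl; move: (k.+1%:R^-1) => t /andP[] ? ? /andP[] ? ?.
by apply/andP; split; lra.
Qed.

Lemma measurable_continuous_rV n (U : set 'rV[R]_n) (f : 'rV[R]_n -> R) :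
  open U -> (forall x, U x -> {for x, continuous f}) -> measurable_fun U f.
Proof.
move=> oU cf; apply: (measurability (@RGenOInfty.G R)) => [|_ [_ [a ->] <-]].
  exact: RGenOInfty.measurableE.
apply: open_measurable_rV; rewrite openE => x [Ux] /=; rewrite in_itv/= andbT => fx.
rewrite /interior; apply: filterI; first exact: open_nbhs_nbhs.
have: nbhs (f x) `]a, +oo[%classic.
  by apply: open_nbhs_nbhs; split => //=; rewrite in_itv/= fx.
exact: (cf x Ux).
Qed.

Lemma measurable_patch_rV n (U : set 'rV[R]_n) (f : 'rV[R]_n -> R) :
  open U -> (forall x, U x -> {for x, continuous f}) -> measurable_fun setT (f \_ U).
Proof.
move=> oU cf; apply: (iffLR (measurable_restrictT f (open_measurable_rV oU))).
exact: measurable_continuous_rV.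
Qed.

End measurability.

(** * Second differences *)

Section line.
Variable R : realType.

Lemma is_derive_line n (f : 'rV[R]_n -> R) (x v : 'rV[R]_n) (s : R) :
  derivable f (x + s *: v) v ->
  is_derive s 1 (fun t => f (x + t *: v)) ('D_v f (x + s *: v)).
Proof.
move=> df.
have E : (fun h : R => h^-1 *: ((f (x + (h *: (1:R) + s) *: v)) - f (x + s *: v))) =
    (fun h : R => h^-1 *: (f (h *: v + (x + s *: v)) - f (x + s *: v))).
  apply/funext => h; congr (_ *: (f _ - _)).
  by rewrite /GRing.scale /= mulr1 -/(GRing.scale _ _) scalerDl addrCA.
split; first by rewrite /derivable /= E.
by rewrite /derive /= E.
Qed.

(** The derivative exists, so it is already determined by right-hand difference quotients, and those
    are at most [B]. *)
Lemma derive_le (q : R -> R) (c B tau : R) : 0 < tau -> is_derive (0 : R) 1 q c ->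
  (forall t, 0 < t < tau -> q t - q 0 <= B * t) -> c <= B.
Proof.
move=> tau0 [dq <-] H; rewrite leNgt; apply/negP => Bc.
have dq' : h^-1 *: ((q (h *: 1 + 0)) - q 0) @[h --> 0^'] --> 'D_1 q 0 by exact: dq.
have /cvgrPdist_lt /(_ ('D_1 q 0 - B)) := dq'.
rewrite subr_gt0 => /(_ Bc); rewrite near_withinE => /nbhs_ballP[e /= e0 He].
pose t := Num.min (e / 2) (tau / 2).
have t0 : 0 < t by rewrite lt_min !divr_gt0.
have te : t < e by rewrite gt_min; apply/orP; left; rewrite ltr_pdivrMr// ltr_pMr// ltr1n.
have tt : t < tau by rewrite gt_min; apply/orP; right; rewrite ltr_pdivrMr// ltr_pMr// ltr1n.
have := He t; rewrite /ball /= sub0r normrN gtr0_norm// => /(_ te (lt0r_neq0 t0)).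
rewrite /GRing.scale /= mulr1 addr0.
have := H t; rewrite t0 tt => /(_ isT).
rewrite mulrC -ler_pdivrMl// => H1.
by rewrite ltr_norml => /andP[_]; rewrite ltrD2l ltrN2 ltNge H1.
Qed.

Lemma is_derive_oppr (q : R -> R) (s c : R) : is_derive (- s) 1 q c ->
  is_derive s (1 : R) (fun t => q (- t)) (- c).
Proof.
move=> dq.
have dN : is_derive s (1 : R) (fun t : R => - t) (-1) by apply: is_derive_eq.
have := is_derive1_comp dq dN.
by rewrite mulrN1.
Qed.

Lemma mean_value (q dq : R -> R) (a b : R) : a <= b ->
  (forall t, a <= t <= b -> is_derive t 1 q (dq t)) ->
  exists2 xi, a <= xi <= b & q b - q a = dq xi * (b - a).
Proof.
move=> ab D; have c : {within `[a, b], continuous q}.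
  apply: continuous_in_subspaceT => t /set_mem /=; rewrite in_itv/= => ts.
  by apply/differentiable_continuous/derivable1_diffP; case: (D t ts).
have d t : t \in `]a, b[%R -> is_derive t 1 q (dq t).
  by rewrite in_itv/= => /andP[? ?]; apply: D; apply/andP; split; exact: ltW.
by have [xi] := MVT_segment ab d c; rewrite in_itv/= => xiab E; exists xi.
Qed.

(** Cauchy's mean value theorem compares g(s) + g(-s) - 2 g(0) with s^2 on [0, t]; the ordinary one
    then turns g1(c) - g1(-c) into 2 c g2(xi). *)
Lemma second_difference (g g1 g2 : R -> R) (t : R) : 0 < t ->
  (forall s : R, - t <= s <= t -> is_derive s 1 g (g1 s)) ->
  (forall s : R, - t <= s <= t -> is_derive s 1 g1 (g2 s)) ->
  exists2 xi, `|xi| < t & g t + g (- t) - 2 * g 0 = t ^+ 2 * g2 xi.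
Proof.
move=> t0 d1 d2.
pose h s := g s + g (- s) - 2 * g 0.
have dh (s : R) : - t <= s <= t -> is_derive s 1 h (g1 s - g1 (- s)).
  move=> st; have := d1 s st; have /is_derive_oppr : is_derive (- s) 1 g (g1 (- s)).
    by apply: d1; move: st => /andP[] *; apply/andP; split; lra.
  move=> ? ?; rewrite /h.
  by apply: is_derive_eq; rewrite subr0.
have dk (s : R) : is_derive s (1 : R) (fun s : R => s ^+ 2) (2 * s).
  by apply: is_derive_eq; rewrite /GRing.scale/=; ring.
have ch (s : R) : - t <= s <= t -> {for s, continuous h}.
  by move=> st; apply/differentiable_continuous/derivable1_diffP; case: (dh s st).
have cts : {within `[0, t], continuous h}.
  apply: continuous_in_subspaceT => s /set_mem /=; rewrite in_itv/= => /andP[? ?].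
  by apply: ch; apply/andP; split; lra.
have csq : {within `[0, t], continuous (fun s : R => s ^+ 2)}.
  apply: continuous_subspaceT => s.
  by apply/differentiable_continuous/derivable1_diffP; case: (dk s).
have dht (s : R) : s \in `]0, t[%R -> is_derive s 1 h (g1 s - g1 (- s)).
  by rewrite in_itv/= => /andP[? ?]; apply: dh; apply/andP; split; lra.
have dkt (s : R) : s \in `]0, t[%R -> is_derive s (1 : R) (fun s : R => s ^+ 2) (2 * s).
  by move=> _; exact: dk.
have dk0 (s : R) : s \in `]0, t[%R -> 2 * s != 0.
  by rewrite in_itv/= => /andP[? ?]; apply/eqP; lra.
have [c ctI] : exists2 c, c \in `]0, t[%R & (g1 c - g1 (- c)) / (2 * c) = (h t - h 0) / (t ^+ 2 - 0 ^+ 2).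
  exact: (@cauchy_MVT R h (fun s => g1 s - g1 (- s)) (fun s => s ^+ 2) (fun s => 2 * s) 0 t
    t0 cts csq dht dkt dk0).
have /andP[c0 ct] : 0 < c < t by move: ctI; rewrite in_itv.
have cc : - c <= c by lra.
have [s /andP[? ?]|xi /andP[x1 x2] ->] := @mean_value g1 g2 (- c) c cc.
  by apply: d2; apply/andP; split; lra.
move=> E.
exists xi; first by rewrite ltr_norml; apply/andP; split; lra.
have h0 : h 0 = 0 by rewrite /h oppr0; ring.
move: E; rewrite h0 expr0n/= !subr0 -/(h t) => E.
have -> : g2 xi = h t / t ^+ 2 by rewrite -E; field; lra.
by field; lra.
Qed.

End line.

Section continuity.
Variables (R : realType) (T : topologicalType).
Implicit Types (f g : T -> R) (x : T).

Lemma contD f g x : {for x, continuous f} -> {for x, continuous g} ->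
  {for x, continuous (fun y => f y + g y)}.
Proof. by move=> cf cg; apply: cvgD. Qed.

Lemma contB f g x : {for x, continuous f} -> {for x, continuous g} ->
  {for x, continuous (fun y => f y - g y)}.
Proof. by move=> cf cg; apply: cvgB. Qed.

Lemma contM f g x : {for x, continuous f} -> {for x, continuous g} ->
  {for x, continuous (fun y => f y * g y)}.
Proof. by move=> cf cg; apply: cvgM. Qed.

Lemma cont_cst (c : R) x : {for x, continuous (fun _ : T => c)}.
Proof. exact: cvg_cst. Qed.

Lemma eq_cont f g x : f =1 g -> {for x, continuous f} -> {for x, continuous g}.
Proof. by move=> /funext ->. Qed.

Lemma contX f k x : {for x, continuous f} -> {for x, continuous (fun y => f y ^+ k)}.
Proof.
move=> cf; elim: k => [|k IH]; first exact: cont_cst.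
by apply: (eq_cont _ (contM cf IH)) => y; rewrite exprS.
Qed.

Lemma cont_sum (I : Type) (r : seq I) (P : pred I) (F : I -> T -> R) x :
  (forall i, P i -> {for x, continuous (F i)}) ->
  {for x, continuous (fun y => \sum_(i <- r | P i) F i y)}.
Proof.
move=> cF; elim: r => [|i r IH].
  by apply: (@eq_cont (fun=> 0)) => [y|]; [rewrite big_nil|exact: cont_cst].
have [Pi|Pi] := boolP (P i).
  by apply: (eq_cont _ (contD (cF _ Pi) IH)) => y; rewrite big_cons Pi.
by apply: (eq_cont _ IH) => y; rewrite big_cons (negbTE Pi).
Qed.

End continuity.

Lemma cont_comp (T U V : topologicalType) (h : T -> U) (f : U -> V) x :
  {for x, continuous h} -> {for h x, continuous f} ->
  {for x, continuous (fun y => f (h y))}.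
Proof. by move=> ch cf; apply: (continuous_comp ch cf). Qed.

Lemma cont_lip (R : realType) (V W : normedModType R) (f : V -> W) (C : R) x :
  0 < C -> (forall y, `|f y - f x| <= C * `|y - x|) -> {for x, continuous f}.
Proof.
move=> C0 H; apply/cvgrPdist_lt => eps eps0; apply/nbhs_ballP; exists (eps / C) => /=.
  by rewrite divr_gt0.
move=> z; rewrite -ball_normE /= => yz.
rewrite distrC; apply: le_lt_trans (H z) _.
by rewrite distrC mulrC -ltr_pdivlMr.
Qed.

(** * C^k functions, and harmonicity expressed by second differences *)

Section classC.
Variables (R : realType) (n : nat).
Implicit Types (U : set 'rV[R]_n) (f : 'rV[R]_n -> R).

Local Notation e j := (delta_mx 0 j : 'rV[R]_n).

Lemma classCW k l U f : (k <= l)%N -> classC l U f -> classC k U f.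
Proof.
move=> kl H w wk x Ux; have [c d] := H w (leq_trans wk kl) x Ux.
by split => // wk'; apply: d; exact: leq_trans kl.
Qed.

Lemma classC_continuous k U f x : classC k U f -> U x -> {for x, continuous f}.
Proof. by move=> H Ux; case: (H [::] _ x Ux). Qed.

Lemma classC_partial k U f i : classC k.+1 U f -> classC k U (partial i f).
Proof.
move=> H w wk x Ux; have := H (rcons w i); rewrite size_rcons => /(_ wk x Ux).
by rewrite /partials foldr_rcons.
Qed.

Lemma classC_is_derive k U f x i s : classC k.+1 U f -> U (x + s *: e i) ->
  is_derive s 1 (fun t => f (x + t *: e i)) (partial i f (x + s *: e i)).
Proof.
move=> H Ux; apply: is_derive_line.
by case: (H [::] isT _ Ux) => _ /(_ isT i).
Qed.

Lemma classC_is_derive0 k U f x i : classC k.+1 U f -> U x ->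
  is_derive (0 : R) (1 : R) (fun t => f (x + t *: e i)) (partial i f x).
Proof.
move=> H Ux; have x0 : x + 0 *: e i = x by rewrite scale0r addr0.
rewrite -[in partial i f x]x0; apply: classC_is_derive H _.
by rewrite x0.
Qed.

Lemma classC_is_derive0N k U f x i : classC k.+1 U f -> U x ->
  is_derive (0 : R) (1 : R) (fun t => f (x - t *: e i)) (- partial i f x).
Proof.
move=> H Ux; have d1 := classC_is_derive0 i H Ux.
have := @is_derive_oppr _ (fun s => f (x + s *: e i)) 0 (partial i f x).
rewrite oppr0 => /(_ d1).
by congr (is_derive _ _ _ _); apply/funext => s; rewrite scaleNr.
Qed.

Lemma partial_increment_le U f j (p : 'rV[R]_n) s B : classC 1 U f -> 0 <= s ->
  (forall t, 0 <= t <= s -> U (p + t *: e j) /\ `|partial j f (p + t *: e j)| <= B) ->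
  `|f (p + s *: e j) - f p| <= B * s.
Proof.
move=> C1 s0 H.
have D (t : R) : 0 <= t <= s -> is_derive t 1 (fun t => f (p + t *: e j)) (partial j f (p + t *: e j)).
  by move=> /H[Ut _]; exact: (classC_is_derive C1).
have [xi xs] := @mean_value R (fun t => f (p + t *: e j)) (fun t => partial j f (p + t *: e j)) 0 s s0 D.
rewrite scale0r addr0 subr0 => ->; have [_ Bx] := H xi xs.
by rewrite normrM (ger0_norm s0) ler_wpM2r.
Qed.

Definition sdiff i (t : R) f (x : 'rV[R]_n) :=
  f (x + t *: e i) + f (x - t *: e i) - 2 * f x.

Lemma classC_sdiff U f i x t : classC 2 U f -> 0 < t ->
  (forall s, `|s| <= t -> U (x + s *: e i)) ->
  exists2 xi, `|xi| < t & sdiff i t f x = t ^+ 2 * partial i (partial i f) (x + xi *: e i).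
Proof.
move=> Cf t0 sU.
have [s st|s st|xi xit] := @second_difference R (fun s => f (x + s *: e i))
  (fun s => partial i f (x + s *: e i))
  (fun s => partial i (partial i f) (x + s *: e i)) t t0.
- by apply: (classC_is_derive Cf); apply: sU; rewrite ler_norml.
- by apply: (classC_is_derive (classC_partial i Cf)); apply: sU; rewrite ler_norml.
by rewrite scale0r addr0 scaleNr => E; exists xi.
Qed.

Lemma rV_delta_norm i (t : R) : `|t *: e i| <= `|t|.
Proof.
apply: rV_norm_le => // j; rewrite !mxE /= normrM.
by case: eqP => _; rewrite ?normr1 ?normr0 ?mulr1 ?mulr0.
Qed.

Lemma open_cubeP U x : open U -> U x ->
  exists2 r, 0 < r & forall y, `|y - x| < r -> U y.
Proof.
move=> oU Ux; have /nbhs_ballP[r /= r0 rU] := open_nbhs_nbhs (conj oU Ux).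
exists r => // y yx; apply: rU; by rewrite -ball_normE /= distrC.
Qed.

Lemma continuous_cubeP f x : {for x, continuous f} -> forall eps, 0 < eps ->
  exists2 r, 0 < r & forall y, `|y - x| < r -> `|f y - f x| < eps.
Proof.
move=> cf eps eps0; have /cvgrPdist_lt/(_ _ eps0)/nbhs_ballP[r /= r0 H] := cf.
exists r => // y yx; rewrite distrC; apply: H; by rewrite -ball_normE /= distrC.
Qed.

Lemma classC_sdiff_lim U f i x : open U -> classC 2 U f -> U x ->
  forall eps, 0 < eps -> exists2 tau, 0 < tau & forall t, 0 < t < tau ->
    `|sdiff i t f x - t ^+ 2 * partial i (partial i f) x| <= eps * t ^+ 2.
Proof.
move=> oU Cf Ux eps eps0.
have [r r0 rU] := open_cubeP oU Ux.
have [r' r'0 H] := continuous_cubeP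
  (classC_continuous (classC_partial i (classC_partial i Cf)) Ux) eps0.
exists (Num.min r r'); first by rewrite lt_min r0.
move=> t /andP[t0]; rewrite lt_min => /andP[tr tr'].
have [s st|xi xit ->] := @classC_sdiff U f i x t Cf t0.
  apply: rU; rewrite addrC addKr; apply: le_lt_trans tr.
  exact: le_trans (rV_delta_norm _ _) _.
rewrite -mulrBr normrM ger0_norm ?sqr_ge0// mulrC ler_wpM2r ?sqr_ge0//.
apply/ltW/H; rewrite addrC addKr; apply: le_lt_trans (rV_delta_norm _ _) _.
exact: lt_trans tr'.
Qed.

Definition dlap t f x := \sum_i sdiff i t f x.

(* Harmonicity at [x] in terms of second differences; unlike the condition on
   second derivatives it visibly passes to translates and differences. *)
Definition dharmonic f x := forall eps, 0 < eps ->
  exists2 tau, 0 < tau & forall t, 0 < t < tau -> `|dlap t f x| <= eps * t ^+ 2.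

Lemma harmonic_dharmonic U f x : open U -> harmonic_in U f -> U x -> dharmonic f x.
Proof.
move=> oU [Cf Hf] Ux eps eps0.
(* Each of the [n] directions gets this share; [n.+1] keeps the denominator nonzero. *)
have en : 0 < eps / n.+1%:R by rewrite divr_gt0// ltr0n.
have /choice[tau Htau] : forall i, exists tau, 0 < tau /\ forall t, 0 < t < tau ->
    `|sdiff i t f x - t ^+ 2 * partial i (partial i f) x| <= eps / n.+1%:R * t ^+ 2.
  move=> i; have [tau tau0 H] := classC_sdiff_lim i oU Cf Ux en.
  by exists tau.
exists (\big[Num.min/1]_i tau i).
  by apply/bigmin_gtP; split => // i _; case: (Htau i).
move=> t /andP[t0 tt].
have -> : dlap t f x = \sum_i (sdiff i t f x - t ^+ 2 * partial i (partial i f) x).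
  by rewrite big_split /= sumrN -mulr_sumr Hf// mulr0 subr0.
apply: le_trans (ler_norm_sum _ _ _) _.
apply: le_trans (_ : \sum_(i < n) eps / n.+1%:R * t ^+ 2 <= _).
  apply: ler_sum => i _; apply: (Htau i).2; rewrite t0 /=.
  by apply: lt_le_trans tt _; exact: bigmin_le_cond.
rewrite sumr_const card_ord -[leLHS]mulr_natl mulrA ler_wpM2r ?sqr_ge0// mulrCA ler_piMr ?ltW//.
by rewrite ltr_pdivrMr ?ltr0n// mul1r ltr_nat.
Qed.

Lemma dharmonicB f g x : dharmonic f x -> dharmonic g x ->
  dharmonic (fun y => f y - g y) x.
Proof.
move=> hf hg eps eps0.
have e2 : 0 < eps / 2 by rewrite divr_gt0.
have [t1 t10 H1] := hf _ e2; have [t2 t20 H2] := hg _ e2.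
exists (Num.min t1 t2); first by rewrite lt_min t10.
move=> t /andP[t0]; rewrite lt_min => /andP[tt1 tt2].
have -> : dlap t (fun y => f y - g y) x = dlap t f x - dlap t g x.
  rewrite /dlap -sumrB; apply: eq_bigr => i _; rewrite /sdiff; ring.
apply: le_trans (ler_normB _ _) _.
have := H1 t; have := H2 t; rewrite t0 tt1 tt2 => /(_ isT) ? /(_ isT) ?; lra.
Qed.

Lemma dharmonic_shift f x h : dharmonic f (x + h) -> dharmonic (fun y => f (y + h)) x.
Proof.
move=> hf eps eps0; have [tau tau0 H] := hf _ eps0.
exists tau => // t tt; have := H t tt; congr (`|_| <= _).
by apply: eq_bigr => i _; rewrite /sdiff; congr (f _ + f _ - _); rewrite addrAC.
Qed.

(** * Interior derivative bounds for harmonic functions *)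

Section gradient_bound.
Variables (j : 'I_n) (w : 'rV[R]_n -> R) (x : 'rV[R]_n) (d W : R).
Hypotheses (d0 : 0 < d) (W0 : 0 < W).
Hypothesis cw : forall y, `|y - x| <= d -> {for y, continuous w}.
Hypothesis hw : forall y, `|y - x| < d -> dharmonic w y.
Hypothesis oscw : forall y z, `|y - x| <= d -> `|z - x| <= d -> `|w y - w z| <= W.

Let refl (y : 'rV[R]_n) := y - (2 * (y 0 j - x 0 j)) *: e j.
Let phi y := w y - w (refl y).
Let eta (y : 'rV[R]_n) := y 0 j - x 0 j.
(** The barrier. On the half cube [K] the last factor is at least [d], so [psi] is nonnegative, and
    it is at least [W] on every face where some coordinate is at distance [d] from that of [x]. *)
Let psi (y : 'rV[R]_n) := W / d ^+ 2 *
  (\sum_(k | k != j) (y 0 k - x 0 k) ^+ 2 + eta y * (n.+1%:R * d - n%:R * eta y)).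
Let K : set 'rV[R]_n := [set y | `|y - x| <= d /\ x 0 j <= y 0 j].

Let refl_coord y k : refl y 0 k = if k == j then 2 * x 0 j - y 0 j else y 0 k.
Proof.
rewrite /refl !mxE /=; case: eqP => [->|_]; last by rewrite mulr0 subr0.
by rewrite mulr1; ring.
Qed.

Let refl_norm y r : 0 <= r -> `|y - x| <= r -> `|refl y - x| <= r.
Proof.
move=> r0 yr; apply: rV_norm_le => // k.
have -> : (refl y - x) 0 k = refl y 0 k - x 0 k by rewrite !mxE.
rewrite refl_coord.
have := rV_coord_le (y - x) k; rewrite !mxE.
case: eqP => [->|_] H; last by apply: le_trans H _.
rewrite (_ : 2 * x 0 j - y 0 j - x 0 j = - (y 0 j - x 0 j)); last by ring.
by rewrite normrN; apply: le_trans H _.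
Qed.

Let refl_shift y k t : refl (y + t *: e k) =
  if k == j then refl y - t *: e k else refl y + t *: e k.
Proof.
have rE z l : (refl z) 0 l = if l == j then 2 * x 0 j - z 0 j else z 0 l.
  exact: refl_coord.
have vE (z : 'rV[R]_n) s l : (z + s *: e k) 0 l = z 0 l + s * (l == k)%:R.
  by rewrite !mxE.
apply/rowP => l; rewrite rE !vE.
case: (eqVneq k j) => [E|kj].
  rewrite -scaleNr (vE (refl y)) rE E.
  by case: (eqVneq l j) => lj /=; rewrite ?mulr1 ?mulr0; ring.
rewrite (vE (refl y)) rE; case: (eqVneq l j) => [->|lj] //.
by rewrite [j == k]eq_sym (negbTE kj) /= !mulr0; ring.
Qed.

(** For [k = j] the reflection exchanges the two neighbours of [y], otherwise it keeps them; either
    way it commutes with the second difference. *)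
Let sdiff_phi t y k : sdiff k t phi y = sdiff k t w y - sdiff k t w (refl y).
Proof.
rewrite /sdiff /phi -[in refl (y - _)]scaleNr !refl_shift.
by case: ifP => _; rewrite scaleNr ?opprK; ring.
Qed.

Let sdiff_psi t y k : sdiff k t psi y =
  W / d ^+ 2 * (if k == j then - (2 * n%:R * t ^+ 2) else 2 * t ^+ 2).
Proof.
rewrite /sdiff /psi -!mulrDr mulrCA -mulrBr; congr (_ * _).
case: (eqVneq k j) => [->|kj].
  rewrite /eta !mxE !eqxx /= mulr1.
  rewrite (eq_bigr (fun k => (y 0 k - x 0 k) ^+ 2)); last first.
    by move=> l lj; rewrite !mxE (negbTE lj) andbF mulr0 addr0.
  rewrite [X in _ + (X + _) - _](eq_bigr (fun k => (y 0 k - x 0 k) ^+ 2)); last first.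
    by move=> l lj; rewrite !mxE (negbTE lj) andbF mulr0 subr0.
  by rewrite -natr1; ring.
have E s : eta (y + s *: e k) = eta y.
  by rewrite /eta !mxE [j == k]eq_sym (negbTE kj) andbF mulr0 addr0.
have -> : y - t *: e k = y + (- t) *: e k by rewrite scaleNr.
rewrite !E.
have S s : \sum_(l | l != j) ((y + s *: e k) 0 l - x 0 l) ^+ 2 =
    (y 0 k + s - x 0 k) ^+ 2 + \sum_(l | (l != j) && (l != k)) (y 0 l - x 0 l) ^+ 2.
  rewrite (bigD1 k) //= !mxE !eqxx /= mulr1; congr (_ + _).
  by apply: eq_bigr => l /andP[lj lk]; rewrite !mxE (negbTE lk) andbF mulr0 addr0.
have S0 := S 0; rewrite scale0r addr0 in S0; rewrite !S S0.
ring.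
Qed.

(** The n - 1 directions other than [j] contribute 2 each and direction [j] contributes -2n, so -2
    remains: [psi] is strictly superharmonic. *)
Let dlap_psi t y : dlap t psi y = - (2 * (W / d ^+ 2) * t ^+ 2).
Proof.
rewrite /dlap (eq_bigr _ (fun k _ => sdiff_psi t y k)) -mulr_sumr (bigD1 j)//= eqxx.
rewrite (eq_bigr (fun _ => 2 * t ^+ 2)); last by move=> k /negbTE ->.
rewrite sumr_const (_ : #|_| = n.-1); last first.
  by rewrite cardC1 card_ord.
rewrite -[X in _ + X]mulr_natl.
have -> : (n%:R : R) = n.-1%:R + 1 by rewrite natr1 prednK//; case: (n) j => [[]|].
ring.
Qed.

Let coord_cvg k y : {for y, continuous (fun y : 'rV[R]_n => y 0 k)}.
Proof. exact: coord_continuous. Qed.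

Let continuous_refl y : {for y, continuous refl}.
Proof.
apply: (@cont_lip _ _ _ _ 1) => // z; rewrite mul1r.
apply: rV_norm_le => // k.
have -> : (refl z - refl y) 0 k = refl z 0 k - refl y 0 k by rewrite !mxE.
rewrite !refl_coord; have := rV_coord_le (z - y) k; rewrite !mxE.
case: eqP => // ->.
have -> : 2 * x 0 j - z 0 j - (2 * x 0 j - y 0 j) = - (z 0 j - y 0 j) by ring.
by rewrite normrN.
Qed.

Let continuous_psi y : {for y, continuous psi}.
Proof.
have cc k : {for y, continuous (fun y : 'rV[R]_n => y 0 k - x 0 k)}.
  by apply: contB; [exact: coord_cvg|exact: cont_cst].
apply: contM; first exact: cont_cst.
apply: contD; first by apply: cont_sum => k _; apply: contX; exact: cc.
apply: contM; first exact: cc.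
apply: contB; first exact: cont_cst.
by apply: contM; [exact: cont_cst|exact: cc].
Qed.

Let compactK : compact K.
Proof.
have -> : K = (fun y : 'rV[R]_n => `|y - x|) @^-1` [set r | r <= d] `&`
    (fun y : 'rV[R]_n => y 0 j) @^-1` [set r | x 0 j <= r].
  by apply/seteqP; split => y.
apply: bounded_closed_compact.
  exists (`|x| + d); split; first exact: num_real.
  move=> M HM y [/= yd _]; rewrite -(subrK x y).
  by apply: le_trans (ler_normD _ _) _; lra.
apply: closedI; apply: closed_comp.
- move=> y _; apply: (@cont_lip _ _ R^o _ 1) => // z; rewrite mul1r.
  apply: le_trans (ler_dist_dist _ _) _; by rewrite opprB addrA subrK.
- exact: closed_le.
- by move=> y _; exact: coord_cvg.
- exact: closed_ge.
Qed.

(** The comparison [phi <= psi] on [K], read on the axis through [x]: there [phi] is the symmetric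
    increment of [w] and [psi] is at most its linear part in [s]. *)
Lemma gradient_bound_pos s : 0 <= s <= d ->
  w (x + s *: e j) - w (x - s *: e j) <= n.+1%:R * W * s / d.
Proof.
move=> /andP[s0 sd].
have Kx : K x by split => //=; rewrite subrr normr0 ltW.
have [|m /= /set_mem Km Fm] := @compact_EVT_max _ R (fun y => phi y - psi y) K (ex_intro _ x Kx) compactK.
  apply: continuous_in_subspaceT => y /set_mem Ky.
  apply: contB; last exact: continuous_psi.
  apply: contB; first by apply: cw; case: Ky.
  apply: (cont_comp (h := refl) (f := w)); first exact: continuous_refl.
  by apply: cw; apply: refl_norm (ltW d0) _; case: Ky.
have Wd : 0 < W / d ^+ 2 by rewrite divr_gt0// exprn_gt0.
have eta_ge0 : 0 <= eta m by rewrite /eta; case: Km => _; lra.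
have eta_led : eta m <= d.
  case: Km => + _; have := rV_coord_le (m - x) j; rewrite !mxE => /le_trans H /H.
  by apply: le_trans; exact: ler_norm.
have sum_ge0 : 0 <= \sum_(k | k != j) (m 0 k - x 0 k) ^+ 2.
  by apply: sumr_ge0 => k _; exact: sqr_ge0.
have eta_term : eta m * d <= eta m * (n.+1%:R * d - n%:R * eta m).
  rewrite ler_wpM2l// -natr1 mulrDl mul1r addrAC lerDr subr_ge0.
  by rewrite ler_wpM2l.
have phi_le : phi m <= W.
  apply: le_trans (ler_norm _) _; apply: oscw; first by case: Km.
  by apply: refl_norm (ltW d0) _; case: Km.
(* A positive maximum would force [psi m < W], because [phi <= W]. This excludes the outer faces of
   [K]; the face [eta = 0] is excluded since [phi] vanishes there and [psi >= 0]. So [m] is interior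
   and second differences can be tested at [m]. *)
have F_le0 : phi m - psi m <= 0.
  rewrite leNgt; apply/negP => F0.
  have psi_ltW : psi m < W by lra.
  have sum_lt : \sum_(k | k != j) (m 0 k - x 0 k) ^+ 2 +
      eta m * (n.+1%:R * d - n%:R * eta m) < d ^+ 2.
    move: psi_ltW; rewrite /psi mulrAC -mulrA gtr_pMr// ltr_pdivrMr ?mul1r//.
    by rewrite exprn_gt0.
  have eta_gt0 : 0 < eta m.
    rewrite lt_neqAle eta_ge0 andbT; apply/eqP => eta0.
    move: F0; have -> : phi m = 0.
      rewrite /phi (_ : refl m = m) ?subrr//.
      by rewrite /refl -/(eta m) -eta0 mulr0 scale0r subr0.
    apply/negP; rewrite /psi -eta0 mul0r addr0 sub0r oppr_gt0 -leNgt.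
    by rewrite mulr_ge0// ltW.
  have m_in : `|m - x| < d.
    have [j0|] := eqVneq `|m - x| 0; first by rewrite j0.
    move=> /mx_norm_neq0[[a k]] /=; rewrite (ord1 a) => E.
    rewrite -[X in X < _]/(mx_norm _) E !mxE.
    case: (eqVneq k j) => [->|kj].
      rewrite ger0_norm//; rewrite -/(eta m).
      have : eta m * d < d ^+ 2 by lra.
      by rewrite expr2 ltr_pM2r.
    rewrite -(@ltr_pXn2r _ 2) ?nnegrE ?normr_ge0 ?(ltW d0)//.
    rewrite real_normK ?num_real//; move: sum_lt; rewrite (bigD1 k)//=.
    have : 0 <= \sum_(i | (i != j) && (i != k)) (m 0 i - x 0 i) ^+ 2.
      by apply: sumr_ge0 => i _; exact: sqr_ge0.
    have := mulr_ge0 eta_ge0 (ltW d0); lra.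
  (* The barrier contributes 4 [eps] t^2, while the Laplacians of [w] at [m] and at its reflection
     contribute at most [eps] t^2 each. *)
  pose eps := W / d ^+ 2 / 2.
  have eps0 : 0 < eps by rewrite divr_gt0.
  have [t1 t10 H1] := hw m_in eps0.
  have [|t2 t20 H2] := @hw (refl m) _ _ eps0.
    have [r] : exists2 r, `|m - x| <= r & 0 <= r < d.
      by exists `|m - x| => //; rewrite normr_ge0 m_in.
    by move=> mr /andP[r0 rd]; apply: le_lt_trans rd; exact: refl_norm.
  (* The halves make [t] strictly smaller than [t1] and [t2]; the other two bounds keep all
     neighbours of [m] in [K]. *)
  pose t := Num.min (Num.min (t1 / 2) (t2 / 2)) (Num.min (d - `|m - x|) (eta m)).
  have t0 : 0 < t by rewrite !lt_min !divr_gt0//= subr_gt0 m_in eta_gt0.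
  have /andP[/andP[tt1 tt2] /andP[td te]] :
      ((t <= t1 / 2) && (t <= t2 / 2)) && ((t <= d - `|m - x|) && (t <= eta m)).
    by rewrite -!le_min.
  have Kt k s' : `|s'| <= t -> K (m + s' *: e k).
    move=> s't; split.
      rewrite addrAC; apply: le_trans (ler_normD _ _) _.
      have := rV_delta_norm k s'; lra.
    rewrite !mxE; have : `|s' * ((0 == 0 :> 'I_1) && (j == k))%:R| <= t.
      by apply: le_trans s't; rewrite normrM ler_piMr//; case: (_ && _); rewrite ?normr1 ?normr0.
    by rewrite ler_norml => /andP[+ _]; move: te; rewrite /eta; lra.
  have lapF : dlap t phi m - dlap t psi m <= 0.
    rewrite /dlap -sumrB; apply: sumr_le0 => k _; rewrite /sdiff.
    have := Fm (m + t *: e k); have := Fm (m - t *: e k).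
    have p1 : m + t *: e k \in K by apply/mem_set/Kt; rewrite gtr0_norm.
    have p2 : m - t *: e k \in K.
      by rewrite -scaleNr; apply/mem_set/Kt; rewrite normrN gtr0_norm.
    by move=> /(_ p2) + /(_ p1); lra.
  have lphi : dlap t phi m = dlap t w m - dlap t w (refl m).
    by rewrite /dlap -sumrB; apply: eq_bigr => k _; exact: sdiff_phi.
  have tp : 0 < t ^+ 2 by rewrite exprn_gt0.
  have a1 : `|dlap t w m| <= eps * t ^+ 2 by apply: H1; rewrite t0; lra.
  have a2 : `|dlap t w (refl m)| <= eps * t ^+ 2 by apply: H2; rewrite t0; lra.
  move: lapF; rewrite lphi dlap_psi.
  have -> : 2 * (W / d ^+ 2) = 4 * eps by rewrite /eps; field; lra.
  move: a1 a2; rewrite !ler_norml => /andP[? ?] /andP[? ?].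
  have := mulr_gt0 eps0 tp; lra.
have Ks : K (x + s *: e j).
  split; first by rewrite addrC addKr; apply: le_trans (rV_delta_norm _ _) _; rewrite ger0_norm.
  by rewrite !mxE !eqxx mulr1 lerDl.
have := Fm _ (mem_set Ks).
have -> : phi (x + s *: e j) = w (x + s *: e j) - w (x - s *: e j).
  rewrite /phi refl_shift eqxx; congr (_ - w (_ - _)).
  by rewrite /refl subrr mulr0 scale0r subr0.
have -> : psi (x + s *: e j) = W / d ^+ 2 * (s * (n.+1%:R * d - n%:R * s)).
  rewrite /psi /eta big1; last first.
    by move=> k kj; rewrite !mxE (negbTE kj) andbF mulr0 addr0 subrr expr0n.
  by rewrite !mxE !eqxx mulr1 add0r addrAC subrr add0r.
move=> H; apply: le_trans (_ : W / d ^+ 2 * (s * (n.+1%:R * d - n%:R * s)) <= _); first lra.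
have dn0 : d != 0 by rewrite gt_eqF.
rewrite [leRHS](_ : _ = W / d ^+ 2 * (s * (n.+1%:R * d))); last by field.
apply: ler_wpM2l; first exact: ltW.
by apply: ler_wpM2l => //; rewrite lerBlDr lerDl mulr_ge0.
Qed.

End gradient_bound.

(* Odd reflection in a coordinate and comparison with a quadratic barrier, as
   in Gilbarg--Trudinger, Section 3.4. *)
Lemma gradient_bound j (w : 'rV[R]_n -> R) (x : 'rV[R]_n) (d W : R) s :
  0 < d -> (forall y, `|y - x| <= d -> {for y, continuous w}) ->
  (forall y, `|y - x| < d -> dharmonic w y) ->
  (forall y z, `|y - x| <= d -> `|z - x| <= d -> `|w y - w z| <= W) ->
  0 <= s <= d -> w (x + s *: e j) - w (x - s *: e j) <= n.+1%:R * W * s / d.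
Proof.
move=> d0 cw hw oscw sd.
have xd : `|x - x| <= d by rewrite subrr normr0 ltW.
have W0 : 0 <= W by apply: le_trans (oscw x x xd xd).
(* Strict superharmonicity of the barrier uses [W > 0]. If [W = 0], then [w] is constant on the
   cube. *)
have [W0'|] := ltrP 0 W; first exact: (gradient_bound_pos j d0 W0').
move=> W0'; have -> : W = 0 by apply/eqP; rewrite eq_le W0 W0'.
rewrite mulr0 mul0r mul0r.
apply: le_trans (ler_norm _) _; apply: le_trans W0'.
have H k : `|k| <= d -> `|x + k *: e j - x| <= d.
  by move=> kd; rewrite addrC addKr; apply: le_trans (rV_delta_norm _ _) _.
move: sd => /andP[s0 sd].
by rewrite -scaleNr; apply: oscw; apply: H; rewrite ?normrN ger0_norm.
Qed.

(** The symmetric increment along e_j has derivative 2 [partial j f x] at 0. The sign (-1)^b treats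
    f and -f together, and the factor 2 is given away. *)
Lemma partial_bound j U (f : 'rV[R]_n -> R) (x : 'rV[R]_n) (d W : R) :
  open U -> harmonic_in U f -> 0 < d -> (forall y, `|y - x| <= d -> U y) ->
  (forall y z, `|y - x| <= d -> `|z - x| <= d -> `|f y - f z| <= W) ->
  `|partial j f x| <= n.+1%:R * W / d.
Proof.
move=> oU hf d0 dU oscf.
have C2 := hf.1.
have Ux : U x by apply: dU; rewrite subrr normr0 ltW.
have H (b : bool) s : 0 < s < d -> (-1) ^+ b * (f (x + s *: e j) - f (x - s *: e j)) <= n.+1%:R * W / d * s.
  move=> /andP[s0 sd]; rewrite [leRHS]mulrAC.
  pose w y := (-1) ^+ b * f y.
  rewrite mulrBr -[X in X - _]/(w _) -[X in _ - X]/(w _).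
  apply: gradient_bound => //; last by rewrite !ltW.
  - move=> y yd; apply: contM; first exact: cont_cst.
    by apply: (classC_continuous C2); exact: dU.
  - move=> y yd eps eps0; have Uy : U y by apply: dU; exact: ltW.
    have [tau tau0 T] := harmonic_dharmonic oU hf Uy eps0; exists tau => // t tt.
    rewrite (_ : dlap t w y = (-1) ^+ b * dlap t f y).
      by rewrite normrM normr_sign mul1r; exact: T.
    by rewrite /dlap mulr_sumr; apply: eq_bigr => i _; rewrite /sdiff /w; ring.
  - by move=> y z yd zd; rewrite /w -mulrBr normrM normr_sign mul1r; exact: oscf.
have D (b : bool) : is_derive (0 : R) (1 : R)
    (fun s => (-1) ^+ b * (f (x + s *: e j) - f (x - s *: e j)))
    ((-1) ^+ b * (2 * partial j f x)).
  have d1 := classC_is_derive0 j C2 Ux; have d2 := classC_is_derive0N j C2 Ux.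
  by apply: is_derive_eq; rewrite /GRing.scale /=; ring.
have L (b : bool) : (-1) ^+ b * (2 * partial j f x) <= n.+1%:R * W / d.
  apply: (derive_le d0 (D b)) => t td.
  by rewrite scale0r subr0 addr0 subrr mulr0 subr0; exact: H.
have B0 : 0 <= n.+1%:R * W / d.
  apply: divr_ge0; last exact: ltW.
  apply: mulr_ge0 => //.
  by apply: le_trans (oscf x x _ _) => //; rewrite subrr normr0 ltW.
have := L true; have := L false; rewrite expr0 expr1 mul1r mulN1r => ? ?.
by rewrite ler_norml; apply/andP; split; lra.
Qed.

(** [gradient_bound] in direction [k] is applied to the increment f(. + t e_j) - f, which is
    [dharmonic] and oscillates by O(t). Dividing by t, then by the step s in direction [k], gives
    the mixed derivative in the limit. *)
Lemma partial2_bound j k U (f : 'rV[R]_n -> R) (x : 'rV[R]_n) (d W : R) :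
  open U -> harmonic_in U f -> 0 < d -> (forall y, `|y - x| <= d -> U y) ->
  (forall y z, `|y - x| <= d -> `|z - x| <= d -> `|f y - f z| <= W) ->
  `|partial k (partial j f) x| <= 16 * n.+1%:R ^+ 2 * W / d ^+ 2.
Proof.
move=> oU hf d0 dU oscf.
have C2 := hf.1; have C1 := classC_partial j C2.
have Ux : U x by apply: dU; rewrite subrr normr0 ltW.
(* The first-order bound on cubes of radius d/4, valid at every point within 3d/4 of [x]. *)
pose G := n.+1%:R * W / (d / 4).
have G0 : 0 <= G.
  apply: divr_ge0; last by rewrite divr_ge0// ltW.
  apply: mulr_ge0 => //.
  by apply: le_trans (oscf x x _ _) => //; rewrite subrr normr0 ltW.
have nearU y z : `|y - x| <= 3 * d / 4 -> `|z - y| <= d / 4 -> `|z - x| <= d.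
  move=> yx zy; rewrite (_ : z - x = (z - y) + (y - x)); last by rewrite addrA subrK.
  apply: le_trans (ler_normD _ _) _; lra.
have Gb y : `|y - x| <= 3 * d / 4 -> `|partial j f y| <= G.
  move=> yx; apply: (partial_bound j oU hf) => [|z zy|z1 z2 h1 h2].
  - by rewrite divr_gt0.
  - by apply: dU; apply: (nearU y).
  - by apply: oscf; apply: (nearU y).
have near2 t y : `|t| <= d / 4 -> `|y - x| <= d / 2 -> `|y + t *: e j - x| <= 3 * d / 4.
  move=> td yd; rewrite addrAC; apply: le_trans (ler_normD _ _) _.
  have := rV_delta_norm j t; lra.
have quot t y : 0 < t <= d / 4 -> `|y - x| <= d / 2 -> `|f (y + t *: e j) - f y| <= G * t.
  move=> /andP[t0 td] yd.
  apply: (partial_increment_le (classCW (isT : (1 <= 2)%N) C2) (ltW t0)) => s /andP[s0 st].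
  have near y' : `|y' - x| <= 3 * d / 4 -> U y' /\ `|partial j f y'| <= G.
    by move=> yd'; split; [apply: dU; move: d0 yd'; clear; lra|exact: Gb].
  apply: near; apply: near2 => //; rewrite ger0_norm//; move: st td; clear; lra.
have d4 : 0 < d / 4 by rewrite divr_gt0.
have d2 : 0 < d / 2 by rewrite divr_gt0.
(* The increments over length t oscillate by at most 2 G t on the cube of radius d/2. Inserting [G]
   gives 16 (n+1)^2 W / d^2. *)
pose B := n.+1%:R * (2 * G) / (d / 2).
have stepA (b : bool) s t : 0 < t < d / 4 -> 0 < s < d / 2 ->
   (-1) ^+ b * ((f (x + s *: e k + t *: e j) - f (x + s *: e k)) -
    (f (x - s *: e k + t *: e j) - f (x - s *: e k))) <= B * s * t.
  move=> /andP[t0 td] /andP[s0 sd].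
  pose w y := (-1) ^+ b * (f (y + t *: e j) - f y).
  rewrite mulrBr -[X in X - _]/(w _) -[X in _ - X]/(w _).
  rewrite (_ : B * s * t = n.+1%:R * (2 * G * t) * s / (d / 2)); last by rewrite /B; field; lra.
  have inU y : `|y - x| <= d / 2 -> U y /\ U (y + t *: e j).
    move=> yd; split; apply: dU; first lra.
    by apply: le_trans (near2 t _ _ yd) _; rewrite ?gtr0_norm; lra.
  apply: gradient_bound => //; last by rewrite !ltW.
  - move=> y yd; have [U1 U2] := inU y yd; apply: contM; first exact: cont_cst.
    apply: contB; last exact: (classC_continuous C2).
    apply: (cont_comp (h := fun y : 'rV[R]_n => y + t *: e j) (f := f)); last exact: (classC_continuous C2).
    by apply: (@cont_lip _ _ _ _ 1) => // z; rewrite mul1r opprD addrACA subrr addr0.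
  - move=> y yd eps eps0; have [U1 U2] := inU y (ltW yd).
    have hw := dharmonicB (dharmonic_shift (harmonic_dharmonic oU hf U2))
      (harmonic_dharmonic oU hf U1).
    have [tau tau0 T] := hw _ eps0; exists tau => // r rt.
    rewrite (_ : dlap r w y = (-1) ^+ b * dlap r (fun y => f (y + t *: e j) - f y) y).
      by rewrite normrM normr_sign mul1r; exact: T.
    by rewrite /dlap mulr_sumr; apply: eq_bigr => i _; rewrite /sdiff /w; ring.
  - move=> y z yd zd; rewrite /w -mulrBr normrM normr_sign mul1r.
    apply: le_trans (ler_normB _ _) _.
    have := quot t y _ yd; have := quot t z _ zd; rewrite t0 ltW//= => /(_ isT) + /(_ isT); lra.
have stepB (b : bool) s : 0 < s < d / 2 ->
   (-1) ^+ b * (partial j f (x + s *: e k) - partial j f (x - s *: e k)) <= B * s.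
  move=> sd; have /andP[s0 sd'] := sd.
  have inU r : `|r| <= d / 2 -> U (x + r *: e k).
    by move=> rd; apply: dU; rewrite addrC addKr; apply: le_trans (rV_delta_norm _ _) _; lra.
  have U1 : U (x + s *: e k) by apply: inU; rewrite gtr0_norm; lra.
  have U2 : U (x - s *: e k) by rewrite -scaleNr; apply: inU; rewrite normrN gtr0_norm; lra.
  have D1 := classC_is_derive0 j C2 U1; have D2 := classC_is_derive0 j C2 U2.
  have DD : is_derive (0 : R) (1 : R)
      (fun t => (-1) ^+ b * (f (x + s *: e k + t *: e j) - f (x - s *: e k + t *: e j)))
      ((-1) ^+ b * (partial j f (x + s *: e k) - partial j f (x - s *: e k))).
    by apply: is_derive_eq; rewrite /GRing.scale /=; ring.
  apply: (derive_le d4 DD).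
  move=> t td; rewrite scale0r !addr0 -mulrBr.
  rewrite [X in _ * X](_ : _ = ((f (x + s *: e k + t *: e j) - f (x + s *: e k)) -
    (f (x - s *: e k + t *: e j) - f (x - s *: e k)))); last by ring.
  exact: stepA.
have D (b : bool) : is_derive (0 : R) (1 : R)
    (fun s => (-1) ^+ b * (partial j f (x + s *: e k) - partial j f (x - s *: e k)))
    ((-1) ^+ b * (2 * partial k (partial j f) x)).
  have d1 := classC_is_derive0 k C1 Ux; have d3 := classC_is_derive0N k C1 Ux.
  by apply: is_derive_eq; rewrite /GRing.scale /=; ring.
have L (b : bool) : (-1) ^+ b * (2 * partial k (partial j f) x) <= B.
  apply: (derive_le d2 (D b)) => t td.
  by rewrite scale0r subr0 addr0 subrr mulr0 subr0; exact: stepB.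
have := L true; have := L false; rewrite expr0 expr1 mul1r mulN1r => ? ?.
rewrite (_ : 16 * n.+1%:R ^+ 2 * W / d ^+ 2 = B); last by rewrite /B /G; field; lra.
by rewrite ler_norml; apply/andP; split; lra.
Qed.

End classC.

(** * Layer-cake estimates *)

Section nonneg_integrals.
Context d (T : measurableType d) (R : realType) (mu : {measure set T -> \bar R}).
Implicit Types F G : T -> R.

Lemma le_integralR F G : measurable_fun setT F -> measurable_fun setT G ->
  (forall x, 0 <= F x <= G x) ->
  (\int[mu]_x (F x)%:E <= \int[mu]_x (G x)%:E)%E.
Proof.
move=> mF mG H; apply: ge0_le_integral => //.
- by move=> x _; rewrite lee_fin; case/andP: (H x).
- exact/measurable_EFinP.
- exact/measurable_EFinP.
- by move=> x _; rewrite lee_fin; case/andP: (H x).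
Qed.

Lemma integralRZl F c : measurable_fun setT F -> (forall x, 0 <= F x) -> 0 <= c ->
  (\int[mu]_x (c * F x)%:E = c%:E * \int[mu]_x (F x)%:E)%E.
Proof.
move=> mF F0 c0; under eq_integral do rewrite EFinM.
apply: ge0_integralZl_EFin => //.
- by move=> x _; rewrite lee_fin.
- exact/measurable_EFinP.
Qed.

Lemma integralR_sum (I : Type) (s : seq I) (P : pred I) (F : I -> T -> R) :
  (forall i, measurable_fun setT (F i)) -> (forall i x, 0 <= F i x) ->
  (\int[mu]_x (\sum_(i <- s | P i) F i x)%:E =
   \sum_(i <- s | P i) \int[mu]_x (F i x)%:E)%E.
Proof.
move=> mF F0.
under eq_integral do rewrite -sumEFin -big_filter.
rewrite ge0_integral_sum// => [|i|i x _]; first by rewrite big_filter.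
- exact/measurable_EFinP.
- by rewrite lee_fin.
Qed.

Lemma integralR_indic (A : set T) : measurable A ->
  (\int[mu]_x (\1_A x)%:E = mu A)%E.
Proof. by move=> mA; rewrite integral_indic// setIT. Qed.

Lemma indic_le1 (A : set T) x : \1_A x <= (1 : R).
Proof. by rewrite indicE lern1 leq_b1. Qed.

Lemma indic_in (A : set T) x : A x -> \1_A x = 1 :> R.
Proof. by move=> Ax; rewrite indicE mem_set. Qed.

Lemma indic_notin (A : set T) x : ~ A x -> \1_A x = 0 :> R.
Proof. by move=> Ax; rewrite indicE memNset. Qed.

Lemma measurable_setle (f : T -> R) c : measurable_fun setT f -> measurable [set x | f x <= c].
Proof.
move=> mf; have := mf measurableT `]-oo, c]%classic; rewrite setTI.
rewrite (_ : _ @^-1` _ = [set x | f x <= c]); first by apply; exact: measurable_itv.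
by apply/seteqP; split => x /=; rewrite in_itv.
Qed.

Lemma measurable_setlt (f : T -> R) c : measurable_fun setT f -> measurable [set x | c < f x].
Proof.
move=> mf; have := mf measurableT `]c, +oo[%classic; rewrite setTI.
rewrite (_ : _ @^-1` _ = [set x | c < f x]); first by apply; exact: measurable_itv.
by apply/seteqP; split => x /=; rewrite in_itv/= andbT.
Qed.

Lemma measurable_set0lt (f : T -> R) c : measurable_fun setT f ->
  measurable [set x | 0 < f x <= c].
Proof.
move=> mf; rewrite (_ : [set x | _] = [set x | 0 < f x] `&` [set x | f x <= c]).
  by apply: measurableI; [exact: measurable_setlt|exact: measurable_setle].
by apply/seteqP; split => x /=; [move=> /andP[]|move=> [-> ->]].
Qed.

Lemma measurable_powR_comp (f : T -> R) p : measurable_fun setT f ->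
  measurable_fun setT (fun x => f x `^ p).
Proof. by move=> mf; apply: (measurableT_comp (measurable_powR p)). Qed.

End nonneg_integrals.

Lemma measurable_nneseries (R : realType) d (T : measurableType d) (h : nat -> T -> R) :
  (forall k, measurable_fun setT (h k)) -> (forall k x, 0 <= h k x) ->
  measurable_fun setT (fun x => \sum_(k <oo) (h k x)%:E)%E.
Proof.
move=> mh h0.
apply: (eq_measurable_fun (fun x => \sum_(k <oo | k \in xpredT) (h k x)%:E)%E).
  by move=> x _; apply: eq_eseriesl.
apply: (ge0_emeasurable_sum (h := fun k x => (h k x)%:E)) => [k x _ _|k _].
  by rewrite lee_fin.
exact/measurable_EFinP.
Qed.

Lemma measurable_indic_comp (R : realType) d1 d2 (T1 : measurableType d1)
    (T2 : measurableType d2) (A : set T2) (g : T1 -> T2) :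
  measurable A -> measurable_fun setT g ->
  measurable_fun setT (fun x => \1_A (g x) : R).
Proof.
move=> mA mg.
by apply: (@measurableT_comp _ _ _ _ _ _ (\1_A : T2 -> R) _ g) => //; exact: measurable_indic.
Qed.

Lemma nneseries_geometric_le (R : realType) (a q : R) (u : nat -> \bar R) :
  0 <= a -> 0 < q < 1 -> (forall k, 0 <= u k)%E ->
  (forall k, u k <= (a * q ^+ k)%:E)%E ->
  (\sum_(k <oo) u k <= (a / (1 - q))%:E)%E.
Proof.
move=> a0 /andP[q0 q1] u0 ua.
apply: lime_le; first by apply: is_cvg_ereal_nneg_natsum_cond => n _ _; exact: u0.
apply: nearW => k; apply: (@le_trans _ _ (\sum_(0 <= i < k) (a * q ^+ i)%:E)%E).
  by apply: lee_sum => i _; exact: ua.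
rewrite sumEFin lee_fin; have := @geometric_le_lim R k a q a0 q0.
by rewrite gtr0_norm// => /(_ q1).
Qed.

(* Cut [N] into dyadic shells. *)
Lemma layer_cake (R : realType) (d p : R) : p < d -> exists2 K : R, 0 <= K &
  forall disp (T : measurableType disp) (mu : {measure set T -> \bar R})
    (S : set T) (N : T -> R) (C a : R),
  measurable S -> measurable_fun setT N -> 0 <= C -> 0 < a ->
  (forall r, 0 < r <= a ->
    (mu (S `&` [set x | (0 < N x <= r)%R]) <= (C * r `^ d)%:E)%E) ->
  (\int[mu]_x (\1_(S `&` [set x | (0 < N x <= a)%R]) x * N x `^ (- p))%:E <=
   (K * C * a `^ (d - p))%:E)%E.
Proof.
(* [q] is the ratio of the bounds for consecutive shells. [c] bounds the variation of N^(-p) over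
   one shell, where N changes by a factor at most 2, whatever the sign of p. *)
move=> pd; pose q : R := 2^-1 `^ (d - p); pose c : R := 2 `^ `|p|.
have c0 : 0 <= c by exact: powR_ge0.
have q0 : 0 < q by exact: powR_gt0.
have q1 : q < 1.
  have : q < 1 `^ (d - p).
    apply: gt0_ltr_powR; rewrite ?nnegrE//; first by rewrite subr_gt0.
    by rewrite invf_lt1// ltr1n.
  by rewrite powR1.
exists (c / (1 - q)); first by rewrite divr_ge0// subr_ge0 ltW.
move=> disp T mu S N C a mS mN C0 a0 HN.
pose b k : R := a * 2^-1 ^+ k.
have b0 k : 0 < b k by rewrite mulr_gt0// exprn_gt0.
have ba k : b k <= a by rewrite ger_pMr// exprn_ile1// invf_le1// ler1n.
pose A k := S `&` [set x | 0 < N x <= b k].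
have mA k : measurable (A k) by apply: measurableI => //; exact: measurable_set0lt.
pose u k x : R := c * b k `^ (- p) * \1_(A k) x.
have u0 k x : 0 <= u k x by rewrite /u !mulr_ge0// powR_ge0.
have mu_ k : measurable_fun setT (u k).
  by apply: measurable_funM; [exact: measurable_cst|exact: measurable_indic].
apply: (@le_trans _ _ (\int[mu]_x \sum_(k <oo) (u k x)%:E)%E).
  apply: ge0_le_integral => //.
  - by move=> x _; rewrite lee_fin mulr_ge0// powR_ge0.
  - apply/measurable_EFinP; apply: measurable_funM; last exact: measurable_powR_comp.
    by apply: measurable_indic; apply: measurableI => //; exact: measurable_set0lt.
  - exact: measurable_nneseries.
  move=> x _; have [[Sx /= /andP[N0 Na]]|nA] := pselect ((S `&` [set x | 0 < N x <= a]) x); last first.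
    rewrite indic_notin// mul0r; apply: nneseries_ge0 => k _ _; by rewrite lee_fin.
  rewrite indic_in ?mul1r; last by split => //=; rewrite N0.
  (* The least [k] with [b k.+1 < N x]: minimality gives [N x <= b k], and for [k = 0] this is the
     bound [N x <= a]. *)
  have [k /andP[k1 k2]] : exists k, b k.+1 < N x <= b k.
    have ex : exists k, b k.+1 < N x.
      have : (fun k => geometric a (2^-1 : R) k) @ \oo --> 0.
        by apply: cvg_geometric; rewrite ger0_norm// invf_lt1// ltr1n.
      move=> /cvgrPdist_lt/(_ _ N0)[M _ /(_ M (leqnn M))] /=.
      rewrite sub0r normrN -/(b M) (gtr0_norm (b0 M)) => H; exists M; apply: le_lt_trans H.
      by rewrite /b exprS mulrCA ler_piMl ?(ltW (b0 M))// invf_le1// ler1n.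
    case: (ex_minnP ex) => k k1 kmin; exists k; rewrite k1/=.
    case: k k1 kmin => [|k] k1 kmin; first by rewrite /b expr0 mulr1.
    by rewrite leNgt; apply/negP => /kmin; rewrite ltnn.
  apply: (@le_trans _ _ (u k x)%:E); last first.
    have := @nneseries_lim_ge R (fun k => (u k x)%:E) xpredT 0 k.+1.
    move=> H; apply: (le_trans _ (H _)) => [|i _ _]; last by rewrite lee_fin.
    rewrite big_nat_recr//= leeDr//.
    by apply: sume_ge0 => i _; rewrite lee_fin.
  rewrite lee_fin /u indic_in; last by split => //=; rewrite N0.
  rewrite mulr1 !powRN /c.
  (* For p >= 0 the power is largest at the lower end of the shell, which costs 2^p; for p < 0 it is
     largest at the upper end, where nothing is lost. *)
  have [p0|p0] := leP 0 p.
    rewrite ger0_norm// (_ : 2 `^ p / b k `^ p = (b k `^ p / 2 `^ p)^-1); last first.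
      by rewrite invfM invrK mulrC.
    rewrite lef_pV2 ?posrE ?divr_gt0 ?powR_gt0// ler_pdivrMr ?powR_gt0//.
    rewrite -powRM ?(ltW N0)//; apply: ge0_ler_powR => //; rewrite ?nnegrE ?mulr_ge0 ?(ltW N0) ?(ltW (b0 k))//;
      move: k1 (b0 k); rewrite /b exprS; lra.
  have pN : 0 <= - p by rewrite oppr_ge0 ltW.
  rewrite -!powRN; apply: le_trans (_ : b k `^ (- p) <= _).
    by apply: ge0_ler_powR => //; rewrite ?nnegrE ltW.
  rewrite ler_peMl ?powR_ge0//.
  have : 1 `^ `|p| <= c by apply: ge0_ler_powR; rewrite ?nnegrE// ler1n.
  by rewrite powR1.
rewrite integral_nneseries//; last 2 first.
- by move=> k; exact/measurable_EFinP.
- by move=> k x _; rewrite lee_fin.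
rewrite (_ : c / (1 - q) * C * a `^ (d - p) = (c * C * a `^ (d - p)) / (1 - q)); last first.
  by field; rewrite subr_eq0 gt_eqF.
apply: nneseries_geometric_le.
- by rewrite !mulr_ge0// powR_ge0.
- by rewrite q0.
- by move=> k; apply: integral_ge0 => x _; rewrite lee_fin.
move=> k; rewrite integralRZl; [|exact: measurable_indic|by []|by rewrite mulr_ge0// powR_ge0].
rewrite integralR_indic//.
apply: (@le_trans _ _ ((c * b k `^ (- p))%:E * (C * b k `^ d)%:E)%E).
  apply: lee_wpmul2l; first by rewrite lee_fin mulr_ge0// powR_ge0.
  by apply: HN; rewrite b0 ba.
rewrite -EFinM lee_fin.
rewrite [leLHS](_ : _ = c * C * (b k `^ (- p) * b k `^ d)); last by ring.
rewrite -powRD; last by apply/implyP => _; rewrite gt_eqF.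
rewrite -!mulrA ler_wpM2l// ler_wpM2l// addrC /b powRM ?exprn_ge0 ?(ltW a0)//.
rewrite ler_wpM2l ?powR_ge0// /q -(@powR_mulrn _ (2^-1)) ?invr_ge0//.
by rewrite -powRrM mulrC powRrM powR_mulrn ?powR_ge0.
Qed.

(** * Measure of slabs, and energy along segments *)

Section vertical.
Variables (R : realType) (n : nat).
Local Notation mu := (lebesgue_rV R n).
Variables (rho : 'rV[R]_n -> R) (e : 'rV[R]_n).
Hypotheses (mrho : measurable_fun setT rho) (e1 : `|e| <= 1).
Hypothesis rho_shift : forall x s, rho (x + s *: e) = rho x + s.

Lemma measurable_slab t h : measurable [set x | `|rho x - t| <= h].
Proof.
apply: (@measurable_setle _ _ R (fun x => `|rho x - t|) h).
by apply: measurableT_comp => //; exact: measurable_funB.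
Qed.

(* Average over the translates of the slab along [e]. *)
Lemma slab_le (c : 'rV[R]_n) r t h : 0 <= r -> 0 <= h ->
  (mu ([set x | (`|x - c| <= r)%R] `&` [set x | (`|rho x - t| <= h)%R]) <=
   ((2 * (r + 1)) ^+ n * (2 * h))%:E)%E.
Proof.
move=> r0 h0; set A := _ `&` _.
have mA : measurable A.
  by apply: measurableI; [exact: measurable_cball|exact: measurable_slab].
pose I := `[0, 1]%classic : set (measurableTypeR R).
have mI : measurable I by exact: measurable_itv.
have lI : @lebesgue_measure R I = 1%E.
  have := lebesgue_measure_itv (`[0, 1] : interval R).
  by rewrite /= lte_fin ltr01 oppr0 adde0.
pose B : set 'rV[R]_n := [set x | `|x - c| <= r + 1].
have mB : measurable B by apply: measurable_cball; rewrite addr_ge0.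
pose V (x : 'rV[R]_n) := [set s : measurableTypeR R | `|rho x + s - t| <= h].
have mshift : measurable_fun setT (fun p : measurableTypeR R * 'rV[R]_n => p.2 + p.1 *: e).
  by apply: measurable_rVD => //; apply: measurable_rVZ => //; exact: measurable_cst.
have mV2 : measurable_fun setT (fun p : measurableTypeR R * 'rV[R]_n => `|rho p.2 + p.1 - t|).
  apply: measurableT_comp => //; apply: measurable_funB => //; apply: measurable_funD => //.
  exact: measurableT_comp.
have mV x : measurable (V x).
  apply: (@measurable_setle _ _ R (fun s : measurableTypeR R => `|rho x + s - t|) h).
  apply: measurableT_comp => //; apply: measurable_funB => //.
  exact: measurable_funD.
have lV x : @lebesgue_measure R (V x) = (2 * h)%:E.
  rewrite (_ : V x = `[t - rho x - h, t - rho x + h]%classic); last first.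
    apply/seteqP; split => s /=; rewrite /V /= in_itv/= ler_norml => /andP[? ?];
      by apply/andP; split; lra.
  rewrite lebesgue_measure_itv/= lte_fin.
  case: ifPn => [_|]; first by rewrite -EFinB; congr EFin; ring.
  by rewrite -leNgt => H; congr EFin; lra.
(* All translates of [A] have the same measure, so averaging over s in [0, 1] changes nothing. *)
have -> : mu A = (\int[@lebesgue_measure R]_s \int[mu]_x (\1_I s * \1_A (x + s *: e))%:E)%E.
  under eq_integral => s _.
    rewrite integralRZl//; last first.
      by apply: measurable_indic_comp => //; exact: rV_shift.
    rewrite (integral_rV_shift _ (f := fun x => (\1_A x)%:E)); last 2 first.
    - by apply/measurable_EFinP; exact: measurable_indic.
    - by move=> x; rewrite lee_fin.
    rewrite integralR_indic//.
    over.
  rewrite ge0_integralZr//; last by apply/measurable_EFinP; exact: measurable_indic.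
  rewrite integralR_indic// -[LHS]mul1e; congr (_ * _)%E; exact/esym/lI.
rewrite (fubini_tonelli (fun p : measurableTypeR R * 'rV[R]_n => (\1_I p.1 * \1_A (p.2 + p.1 *: e))%:E)) /=; last 2 first.
- apply/measurable_EFinP; apply: measurable_funM.
    by apply: measurable_indic_comp.
  by apply: measurable_indic_comp => //.
- by move=> p; rewrite lee_fin mulr_ge0.
(* For fixed x the admissible s form a subset of an interval of length 2h, since [rho] has slope one
   along [e]; and x itself lies in the ball enlarged by 1, since [e] has norm at most 1. *)
apply: (@le_trans _ _ (\int[mu]_x (\1_B x * (2 * h))%:E)%E); last first.
  under eq_integral do rewrite mulrC.
  rewrite integralRZl; [|exact: measurable_indic|by []|by rewrite mulr_ge0].
  rewrite [X in (_ * X)%E](_ : _ = ((2 * (r + 1)) ^+ n)%:E); last first.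
    by rewrite integralR_indic//; apply: lebesgue_rV_ball; rewrite addr_ge0.
  by rewrite -EFinM mulrC.
apply: ge0_le_integral => //.
- by move=> x _; apply: integral_ge0 => s _; rewrite lee_fin mulr_ge0.
- apply: (measurable_fun_fubini_tonelli_G (fun p : measurableTypeR R * 'rV[R]_n => (\1_I p.1 * \1_A (p.2 + p.1 *: e))%:E)).
    apply/measurable_EFinP; apply: measurable_funM.
      by apply: measurable_indic_comp.
    by apply: measurable_indic_comp => //.
  by move=> p; rewrite lee_fin mulr_ge0.
- apply/measurable_EFinP; apply: measurable_funM => //; exact: measurable_indic.
move=> x _.
rewrite EFinM -(lV x) -(integralR_indic (@lebesgue_measure R))// -integralRZl//.
  apply: le_integralR => //.
  - apply: measurable_funM; first exact: measurable_indic.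
    apply: measurable_indic_comp => //.
    by apply: measurable_rVD => //; apply: measurable_rVZ.
  - by apply: measurable_funM => //; exact: measurable_indic.
  move=> s; rewrite mulr_ge0//=.
  have [Is|Is] := pselect (I s); last by rewrite indic_notin// mul0r mulr_ge0.
  have [As|As] := pselect (A (x + s *: e)); last by rewrite (indic_notin _ As) mulr0 mulr_ge0.
  move: As Is => [/= As1 As2]; rewrite /I /= in_itv/= => /andP[s0 s1].
  rewrite indic_in; last by rewrite /I /= in_itv/= s0.
  have Vs : V x s by rewrite /V /= -rho_shift.
  rewrite !indic_in ?mulr1//.
  rewrite /B /=.
  rewrite (_ : x - c = (x + s *: e - c) - s *: e); last by rewrite [RHS]addrAC addrK.
  apply: le_trans (ler_normB _ _) _; apply: lerD => //.
  rewrite normrZ ger0_norm//; apply: le_trans (_ : 1 * 1 <= _); last by rewrite mulr1.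
  exact: ler_pM.
Qed.

End vertical.

Section line_energy.
Variable R : realType.

(* [2 m F' - m^2 <= F'^2], with [m] the mean slope. *)
Lemma increment_sqr_le (F dF : R -> R) (s : R) : 0 < s ->
  (forall t, 0 <= t <= s -> is_derive t 1 F (dF t)) ->
  (forall t, 0 <= t <= s -> {for t, continuous dF}) ->
  (((F s - F 0) ^+ 2)%:E <=
   s%:E * \int[@lebesgue_measure R]_(t in `[0%R, s]) ((dF t) ^+ 2)%:E)%E.
Proof.
move=> s0 dFF cdF.
pose m := (F s - F 0) / s.
have cw (G : R -> R) : (forall t, 0 <= t <= s -> {for t, continuous G}) ->
    {within `[0, s], continuous G}.
  move=> cG; apply: continuous_in_subspaceT => t /set_mem /=; rewrite in_itv/=.
  exact: cG.
pose g t := 2 * m * dF t - m ^+ 2.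
(* A primitive of [g], whose increment over [0, s] is exactly (F s - F 0)^2 / s. *)
pose G t := 2 * m * F t - m ^+ 2 * t.
have cg t : 0 <= t <= s -> {for t, continuous g}.
  move=> ts; apply: contB; last exact: cont_cst.
  by apply: contM; [exact: cont_cst|exact: cdF].
have dG t : 0 <= t <= s -> is_derive t 1 G (g t).
  move=> ts; have := dFF t ts => ?.
  by apply: is_derive_eq; rewrite /GRing.scale/= /g; ring.
have cG t : 0 <= t <= s -> {for t, continuous G}.
  by move=> /dG[dg _]; apply/differentiable_continuous/derivable1_diffP.
have E : (\int[@lebesgue_measure R]_(t in `[0%R, s]) (g t)%:E = (G s)%:E - (G 0)%:E)%E.
  apply: continuous_FTC2 => //; first exact: cw.
    split.
    - move=> t; rewrite in_itv/= => /andP[? ?].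
      by case: (dG t) => //; rewrite !ltW.
    - by apply: cvg_at_right_filter; apply: cG; rewrite lexx ltW.
    - by apply: cvg_at_left_filter; apply: cG; rewrite lexx ltW.
  move=> t; rewrite in_itv/= => /andP[? ?].
  by rewrite derive1E; case: (dG t) => //; rewrite !ltW.
have I : (\int[@lebesgue_measure R]_(t in `[0%R, s]) (g t)%:E <=
    \int[@lebesgue_measure R]_(t in `[0%R, s]) ((dF t) ^+ 2)%:E)%E.
  apply: le_integral => //.
  - by apply: continuous_compact_integrable; [exact: segment_compact|exact: cw].
  - apply: continuous_compact_integrable; [exact: segment_compact|].
    by apply: cw => t ts; apply: contX; exact: cdF.
  - move=> t _; rewrite lee_fin /g -subr_ge0.
    rewrite (_ : _ - _ = (dF t - m) ^+ 2); last by ring.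
    exact: sqr_ge0.
have s'0 : s != 0 by rewrite gt_eqF.
rewrite (_ : (F s - F 0) ^+ 2 = s * (G s - G 0)); last first.
  by rewrite /G /m; field.
rewrite EFinM; apply: lee_wpmul2l; first by rewrite lee_fin ltW.
by rewrite EFinB -E.
Qed.

End line_energy.

Section sums.
Variable R : realFieldType.

(** The right side minus the left is the square of a - (q - 1) b divided by q - 1. *)
Lemma sqr_add_le (q a b : R) : 1 < q ->
  (a + b) ^+ 2 <= q / (q - 1) * a ^+ 2 + q * b ^+ 2.
Proof.
move=> q1; rewrite -subr_ge0.
have q10 : 0 < q - 1 by rewrite subr_gt0.
rewrite (_ : _ - _ = (a - (q - 1) * b) ^+ 2 / (q - 1)); last by field; rewrite gt_eqF.
by rewrite divr_ge0 ?sqr_ge0// ltW.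
Qed.

(** Splitting off one term at a time costs a factor [q] on the rest. The geometric weights buy a
    constant independent of [M], which lets the dyadic sums become infinite. *)
Lemma sqr_sum_le (q : R) (d : nat -> R) M : 1 < q ->
  (\sum_(0 <= m < M) d m) ^+ 2 <= q / (q - 1) * \sum_(0 <= m < M) q ^+ m * d m ^+ 2.
Proof.
move=> q1; elim: M => [|M IH] in d *; first by rewrite !big_nil expr0n mulr0.
rewrite big_nat_recl// [in leRHS]big_nat_recl// expr0 mul1r.
apply: le_trans (sqr_add_le _ _ q1) _; rewrite mulrDr lerD2l.
have q0 : 0 < q by exact: lt_trans q1.
apply: le_trans (ler_wpM2l (ltW q0) (IH (d \o S))) _.
rewrite le_eqVlt; apply/orP; left; apply/eqP.
rewrite mulrCA; congr (_ * _); rewrite mulr_sumr; apply: eq_bigr => m _ /=.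
by rewrite [q ^+ m.+1]exprS mulrA.
Qed.

End sums.

Lemma integral_indicR d (T : measurableType d) (R : realType)
    (mu : {measure set T -> \bar R}) (D : set T) (F : T -> R) :
  (\int[mu]_(x in D) (F x)%:E = \int[mu]_x (\1_D x * F x)%:E)%E.
Proof.
rewrite integral_mkcond; apply: eq_integral => x _.
rewrite patchE indicE; case: ifP => _; first by rewrite mul1r.
by rewrite mul0r.
Qed.

Section product.
Variables (R : realType) (n : nat).
Local Notation mu := (lebesgue_rV R n).
Local Notation V := 'rV[R]_n.
Local Notation mu2 := (lebesgue_rV R n \x lebesgue_rV R n)%E.

(** Turns an integral over pairs of points into one over (increment, base point): p = (h, x) is sent
    to (x, h + x). *)
Lemma integral_shear (G : V * V -> \bar R) :
  measurable_fun setT G -> (forall p, 0 <= G p)%E ->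
  (\int[mu2]_p G (p.2, p.1 + p.2)%R = \int[mu2]_p G p)%E.
Proof.
move=> mG G0.
have mG' : measurable_fun setT (fun p : V * V => G (p.2, p.1 + p.2)).
  apply: measurableT_comp => //; apply: measurable_fun_pair => //.
  exact: measurable_rVD.
rewrite (fubini_tonelli1 G mG G0) (fubini_tonelli2 _ mG' (fun p => G0 _)).
apply: eq_integral => x _; rewrite /fubini_G /fubini_F /=.
apply: (integral_rV_shift x (f := fun y => G (x, y))) => //.
exact: measurableT_comp.
Qed.

(** Moves the base point from x to x + h, which identifies the cost of the vertical leg at the far
    end with that at the near end. *)
Lemma integral_shear2 (G : V * V -> \bar R) :
  measurable_fun setT G -> (forall p, 0 <= G p)%E ->
  (\int[mu2]_p G (p.1, p.2 + p.1)%R = \int[mu2]_p G p)%E.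
Proof.
move=> mG G0.
have mG' : measurable_fun setT (fun p : V * V => G (p.1, p.2 + p.1)).
  apply: measurableT_comp => //; apply: measurable_fun_pair => //.
  exact: measurable_rVD.
rewrite (fubini_tonelli1 G mG G0) (fubini_tonelli1 _ mG' (fun p => G0 _)).
apply: eq_integral => x _; rewrite /fubini_F /=.
apply: (integral_rV_shift x (f := fun y => G (x, y))) => //.
exact: measurableT_comp.
Qed.

Lemma measurable_rV_norm : measurable_fun setT (fun x : V => `|x|).
Proof.
apply: (measurable_continuous_rV openT) => x _.
apply: (@cont_lip _ _ R^o _ 1) => // y; rewrite mul1r.
exact: ler_dist_dist.
Qed.

Lemma measurable_oball (c : V) (r : R) : measurable [set x : V | `|x - c| < r].
Proof.
have : measurable_fun setT (fun x : V => - `|x - c|).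
  apply: measurableT_comp => //; apply: (measurableT_comp measurable_rV_norm).
  exact: rV_shift.
move=> /(measurable_setlt (- r)); congr (measurable _).
by apply/seteqP; split => x /=; rewrite ltrN2.
Qed.

(** [layer_cake] for N(h) = |h| and d = n, as a sup-norm ball of radius r has measure (2r)^n. *)
Lemma ball_power (p : R) : p < n%:R -> exists2 K : R, 0 <= K &
  forall a, 0 < a ->
  (\int[mu]_h (\1_[set h | (0 < `|h| <= a)%R] h * `|h| `^ (- p))%:E <=
   (K * a `^ (n%:R - p))%:E)%E.
Proof.
move=> /layer_cake[K K0 HK]; exists (K * 2 ^+ n); first by rewrite mulr_ge0// exprn_ge0.
move=> a a0; rewrite -[X in \1_X]setTI.
apply: (HK _ _ _ setT (fun h : V => `|h|) (2 ^+ n) a) => //.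
  exact: measurable_rV_norm.
move=> r /andP[r0 _]; rewrite powR_mulrn ?(ltW r0)// -exprMn.
apply: (@le_trans _ _ (mu [set x | `|x - 0| <= r])).
  apply: le_measure; rewrite ?inE.
  - by apply: measurableI => //; apply: measurable_set0lt; exact: measurable_rV_norm.
  - by apply: measurable_cball; exact: ltW.
  - by move=> x [_ /= /andP[_]]; rewrite subr0.
by rewrite (lebesgue_rV_ball _ (ltW r0)).
Qed.

End product.

Section shift_energy.
Variables (R : realType) (n : nat) (U : set 'rV[R]_n) (f : 'rV[R]_n -> R).
Hypotheses (oU : open U) (C1 : classC 1 U f).
Local Notation mu := (lebesgue_rV R n).
Local Notation V := 'rV[R]_n.
Local Notation mu2 := (lebesgue_rV R n \x lebesgue_rV R n)%E.
Local Notation e j := (delta_mx 0 j : 'rV[R]_n).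
Local Notation f0 := (f \_ U).
Local Notation g j := ((partial j f) \_ U).

Lemma measurable_f0 : measurable_fun setT f0.
Proof. by apply: measurable_patch_rV => // x; exact: (classC_continuous C1). Qed.

Lemma measurable_g j : measurable_fun setT (g j).
Proof.
apply: measurable_patch_rV => // x.
exact: (classC_continuous (classC_partial j C1)).
Qed.

Lemma segment_energy j (y : V) (s : R) :
  (forall t, 0 <= t <= 1 -> U (y + (t * s) *: e j)) ->
  (((f0 (y + s *: e j) - f0 y) ^+ 2)%:E <=
   (s ^+ 2)%:E * \int[@lebesgue_measure R]_t (\1_`[0%R, 1%R] t * g j (y + (t * s) *: e j) ^+ 2)%:E)%E.
Proof.
move=> Uy.
have gE t : 0 <= t <= 1 -> g j (y + (t * s) *: e j) = partial j f (y + (t * s) *: e j).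
  by move=> /Uy Ut; rewrite patchE mem_set.
pose F t := f (y + (t * s) *: e j).
pose dF t := s * partial j f (y + (t * s) *: e j).
have := @increment_sqr_le R F dF 1 ltr01.
have -> : F 1 = f0 (y + s *: e j).
  by rewrite patchE mem_set /F ?mul1r//; have := Uy 1; rewrite mul1r lexx ler01; apply.
have -> : F 0 = f0 y.
  rewrite /F mul0r scale0r addr0 patchE mem_set//.
  by have := Uy 0; rewrite mul0r scale0r addr0 lexx ler01; apply.
rewrite mul1e integral_indicR => H; apply: (le_trans (H _ _)).
- move=> t /Uy Ut.
  have d1 := classC_is_derive C1 Ut.
  have d2 : is_derive t (1 : R) (fun t => t * s) s.
    by apply: is_derive_eq; rewrite /GRing.scale/=; ring.
  have -> : dF t = partial j f (y + (t * s) *: e j) * s by rewrite /dF mulrC.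
  exact: (@is_derive1_comp R (fun t => f (y + t *: e j)) (fun t => t * s) t _ _ d1 d2).
- move=> t /Uy Ut; apply: contM; first exact: cont_cst.
  apply: (cont_comp (h := fun t : R => y + (t * s) *: e j) (f := partial j f)).
    apply: (@cont_lip R R^o V _ (`|s| + 1)); first by rewrite ltr_wpDl.
    move=> t'; rewrite opprD addrACA subrr add0r -scalerBl -mulrBl.
    apply: le_trans (rV_delta_norm _ _) _.
    by rewrite normrM mulrC ler_wpM2r// lerDl.
  exact: (classC_continuous (classC_partial j C1)).
have mG : measurable_fun setT (fun t : measurableTypeR R => \1_`[0%R, 1%R] t * g j (y + (t * s) *: e j) ^+ 2).
  apply: measurable_funM; first exact: measurable_indic.
  apply: measurable_funX; apply: (measurableT_comp (measurable_g j)).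
  apply: measurable_rVD => //; apply: measurable_rVZ => //.
  exact: measurable_funM.
have mH : measurable_fun setT (fun t : measurableTypeR R => s ^+ 2 * (\1_`[0%R, 1%R] t * g j (y + (t * s) *: e j) ^+ 2)).
  exact: measurable_funM.
rewrite -integralRZl ?sqr_ge0//; last by move=> t; rewrite mulr_ge0// sqr_ge0.
rewrite le_eqVlt; apply/orP; left; apply/eqP; apply: eq_integral => t _; congr EFin.
have [t1|t1] := boolP (0 <= t <= 1); last first.
  by rewrite !indic_notin ?mul0r ?mulr0//= in_itv/=; exact/negP.
by rewrite /dF gE// exprMn mulrCA.
Qed.

(** [segment_energy] at each x, followed by Tonelli. For fixed t the segment point is a translate of
    x that stays in [T], so by translation invariance the inner integral is at most the energy on
    [T]. *)
Lemma shift_energy (S T : set V) (k : V) j (s : R) :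
  measurable S -> measurable T -> T `<=` U ->
  (forall x, S x -> forall t, 0 <= t <= 1 -> T (x + k + (t * s) *: e j)) ->
  (\int[mu]_x (\1_S x * (f0 (x + k + s *: e j) - f0 (x + k)) ^+ 2)%:E <=
   (s ^+ 2)%:E * \int[mu]_x (\1_T x * g j x ^+ 2)%:E)%E.
Proof.
move=> mS mT TU ST.
pose I : set (measurableTypeR R) := `[0%R, 1%R]%classic.
have mI : measurable I by exact: measurable_itv.
pose G (p : V * measurableTypeR R) : R :=
  \1_I p.2 * (\1_T (p.1 + k + (p.2 * s) *: e j) * g j (p.1 + k + (p.2 * s) *: e j) ^+ 2).
have mY : measurable_fun setT (fun p : V * measurableTypeR R => p.1 + k + (p.2 * s) *: e j).
  apply: measurable_rVD; first exact: measurable_rVD.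
  by apply: measurable_rVZ => //; exact: measurable_funM.
have mG : measurable_fun setT G.
  apply: measurable_funM; first exact: measurable_indic_comp.
  apply: measurable_funM; first exact: measurable_indic_comp.
  by apply: measurable_funX; apply: (measurableT_comp (measurable_g j)).
have G0 (p : V * measurableTypeR R) : 0 <= G p.
  by rewrite mulr_ge0// mulr_ge0// sqr_ge0.
have mGE : measurable_fun setT (fun p => (G p)%:E) by exact/measurable_EFinP.
have mg2 : measurable_fun setT (fun x => \1_T x * g j x ^+ 2).
  by apply: measurable_funM; [exact: measurable_indic|apply: measurable_funX; exact: measurable_g].
apply: (@le_trans _ _ (\int[mu]_x ((s ^+ 2)%:E * \int[@lebesgue_measure R]_t (G (x, t))%:E))%E).
  apply: ge0_le_integral => //.
  - by move=> x _; rewrite lee_fin mulr_ge0// sqr_ge0.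
  - apply/measurable_EFinP; apply: measurable_funM; first exact: measurable_indic.
    apply: measurable_funX; apply: measurable_funB; apply: (measurableT_comp measurable_f0).
      by apply: measurable_rVD => //; exact: measurable_rVD.
    exact: measurable_rVD.
  - apply: emeasurable_funM => //.
    exact: (measurable_fun_fubini_tonelli_F (fun p => (G p)%:E)).
  move=> x _.
  have [Sx|Sx] := pselect (S x); last first.
    rewrite indic_notin// mul0r mule_ge0//; first by rewrite lee_fin sqr_ge0.
    by apply: integral_ge0 => t _; rewrite lee_fin.
  rewrite indic_in// mul1r.
  apply: (le_trans (segment_energy (j := j) (y := x + k) (s := s) _)).
    by move=> t t1; exact/TU/ST.
  rewrite le_eqVlt; apply/orP; left; apply/eqP; congr (_ * _)%E.
  apply: eq_integral => t _; congr EFin; rewrite /G /= -/I.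
  have [It|It] := pselect (I t); last by rewrite (indic_notin _ It) !mul0r.
  have Tx : T (x + k + (t * s) *: e j).
    by apply: ST => //; move: It; rewrite /I /= in_itv.
  by rewrite (indic_in _ Tx) mul1r.
rewrite ge0_integralZl//; last 3 first.
- exact: (measurable_fun_fubini_tonelli_F (fun p => (G p)%:E)).
- by move=> x _; apply: integral_ge0 => t _; rewrite lee_fin.
- by rewrite lee_fin sqr_ge0.
apply: lee_wpmul2l; first by rewrite lee_fin sqr_ge0.
rewrite (fubini_tonelli (fun p => (G p)%:E))//=.
under eq_integral => t _.
  under eq_integral do rewrite /G /=.
  rewrite integralRZl//; last 2 first.
  - by apply: (measurableT_comp mg2); apply: measurable_rVD => //; exact: measurable_rVD.
  - by move=> x; rewrite mulr_ge0// sqr_ge0.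
  under eq_integral do rewrite -addrA.
  rewrite (integral_rV_shift _ (f := fun x => (\1_T x * g j x ^+ 2)%:E)); last 2 first.
  - exact/measurable_EFinP.
  - by move=> x; rewrite lee_fin mulr_ge0// sqr_ge0.
  over.
rewrite ge0_integralZr//; last 2 first.
- by apply/measurable_EFinP; exact: measurable_indic.
- by apply: integral_ge0 => x _; rewrite lee_fin mulr_ge0// sqr_ge0.
rewrite integralR_indic//.
have lI : @lebesgue_measure R I = 1%E.
  have := lebesgue_measure_itv (`[0, 1] : interval R).
  by rewrite /= lte_fin ltr01 oppr0 adde0.
by rewrite [X in (X * _)%E](_ : _ = 1%E)// mul1e.
Qed.

End shift_energy.

Section finite_integrals.
Context d (T : measurableType d) (R : realType) (mu : {measure set T -> \bar R}).
Implicit Types F G : T -> R.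

Lemma integralRD_lty F G : measurable_fun setT F -> measurable_fun setT G ->
  (forall x, 0 <= F x) -> (forall x, 0 <= G x) ->
  (\int[mu]_x (F x)%:E < +oo)%E -> (\int[mu]_x (G x)%:E < +oo)%E ->
  (\int[mu]_x (F x + G x)%:E < +oo)%E.
Proof.
move=> mF mG F0 G0 iF iG; under eq_integral do rewrite EFinD.
rewrite ge0_integralD//; first exact: lte_add_pinfty.
- by move=> x _; rewrite lee_fin.
- exact/measurable_EFinP.
- by move=> x _; rewrite lee_fin.
- exact/measurable_EFinP.
Qed.

Lemma integralRZ_lty F c : measurable_fun setT F ->
  (forall x, 0 <= F x) -> 0 <= c ->
  (\int[mu]_x (F x)%:E < +oo)%E -> (\int[mu]_x (c * F x)%:E < +oo)%E.
Proof. by move=> mF F0 c0 iF; rewrite integralRZl// lte_mul_pinfty// lee_fin. Qed.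

End finite_integrals.

Lemma powR_exprn (R : realType) (a r : R) k : 0 <= a -> (a ^+ k) `^ r = (a `^ r) ^+ k.
Proof.
move=> a0; elim: k => [|k IH]; first by rewrite !expr0 powR1.
by rewrite !exprS powRM ?exprn_ge0// IH.
Qed.

(** * From weighted energy to fractional seminorm *)

Section embedding.
Variables (R : realType) (n : nat) (U : set 'rV[R]_n) (f : 'rV[R]_n -> R).
Hypotheses (oU : open U) (C1 : classC 1 U f).
Local Notation mu := (lebesgue_rV R n).
Local Notation V := 'rV[R]_n.
Local Notation mu2 := (lebesgue_rV R n \x lebesgue_rV R n)%E.
Local Notation e j := (delta_mx 0 j : 'rV[R]_n).
Local Notation f0 := (f \_ U).
Local Notation g j := ((partial j f) \_ U).
Variables (c : V) (R0 L theta : R) (i : 'I_n) (b : bool) (rho : V -> R).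
Local Notation e0 := ((-1) ^+ b *: e i).
Hypotheses (R00 : 0 < R0) (L0 : 0 <= L) (mrho : measurable_fun setT rho).
Hypothesis rhoU : forall x, `|x - c| < R0 -> (U x <-> 0 < rho x).
Hypothesis rho_shift : forall x s, rho (x + s *: e0) = rho x + s.
Hypothesis rho_lip : forall x y, `|x - c| < R0 -> `|y - c| < R0 ->
  `|rho x - rho y| <= L * `|x - y|.
Hypotheses (theta0 : 0 < theta) (theta1 : theta < 1).

Let P : set V := [set x | `|x - c| < R0] `&` U.
Let m : R := 2 - 2 * theta.
Let w (h : V) : R := `|h| `^ (- (n%:R + 2 * theta)).
Let energy j := (\int[mu]_x (\1_P x * (rho x `^ m * g j x ^+ 2))%:E)%E.
Hypothesis energy_fin : forall j, (energy j < +oo)%E.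

(** Moving up by K|h| leaves height at least |h| after any displacement of norm at most |h|, since
    that lowers [rho] by at most L|h|. *)
Let K : R := L + 1.
(** Small enough that the whole path between two points of [S], up, across and down, stays where the
    chart is valid ([r1R0]). Increments between points of [S] have norm at most 2 [r1], whence
    [H]. *)
Let r1 : R := R0 / (4 * (K + 1)).
Let S : set V := [set x | `|x - c| <= r1] `&` U.
Let H : set V := [set h | 0 < `|h| <= 2 * r1].

Let K0 : 0 < K. Proof. by rewrite /K ltr_wpDl. Qed.
Let r10 : 0 < r1. Proof. by rewrite /r1 divr_gt0// mulr_gt0// addr_gt0. Qed.
Let m0 : 0 < m. Proof. by have := theta1; rewrite /m; lra. Qed.
Let r1R0 : r1 + K * (2 * r1) + 2 * r1 < R0.
Proof.
have K1 : 0 < K + 1 by rewrite addr_gt0.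
rewrite [ltLHS](_ : _ = R0 * ((2 * K + 3) / (4 * (K + 1)))); last first.
  by rewrite /r1; field; rewrite gt_eqF.
rewrite gtr_pMr// ltr_pdivrMr ?mulr_gt0//; have := K0; lra.
Qed.

Let mball (r : R) : measurable [set x : V | `|x - c| < r].
Proof. exact: measurable_oball. Qed.

Let mU : measurable U. Proof. exact: open_measurable_rV. Qed.
Let mP : measurable P. Proof. exact: measurableI. Qed.
Let mS : measurable S.
Proof. by apply: measurableI => //; apply: measurable_cball; exact: ltW. Qed.
Let mH : measurable H.
Proof. by apply: measurable_set0lt; exact: measurable_rV_norm. Qed.

Let rhoP x : P x -> 0 < rho x. Proof. by move=> [/= /rhoU H1 /H1]. Qed.

Let mg j := measurable_g oU C1 j.
Let mf0 := measurable_f0 oU C1.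
Let mw : measurable_fun setT w.
Proof. by apply: measurable_powR_comp; exact: measurable_rV_norm. Qed.
Let w0 h : 0 <= w h. Proof. exact: powR_ge0. Qed.
Let T2 lam (h : V) : set V := P `&` [set x | lam * `|h| <= rho x].

Let measurable_pairfun (k : V -> V) (F : V -> R) : measurable_fun setT k -> measurable_fun setT F ->
  measurable_fun setT (fun p : V * V => F (p.2 + k p.1)).
Proof.
move=> mk mF; apply: (measurableT_comp mF); apply: measurable_rVD => //.
exact: (measurableT_comp mk).
Qed.

Let mT2 lam : measurable_fun setT (fun p : V * V => \1_(T2 lam p.1) p.2 : R).
Proof.
have mA : measurable [set p : V * V | P p.2 /\ lam * `|p.1| <= rho p.2].
  rewrite (_ : [set p | _] = (snd @^-1` P) `&` [set p : V * V | lam * `|p.1| - rho p.2 <= 0]).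
    apply: measurableI.
      by rewrite -[X in measurable X]setTI; exact: measurable_snd.
    apply: measurable_setle; apply: measurable_funB.
      apply: measurable_funM => //; apply: (measurableT_comp (@measurable_rV_norm R n)).
      exact: measurable_fst.
    exact: (measurableT_comp mrho).
  by apply/seteqP; split => p /=; rewrite subr_le0.
rewrite (_ : (fun p => _) = (\1_[set p : V * V | P p.2 /\ lam * `|p.1| <= rho p.2] : _ -> R)).
  exact: measurable_indic.
by apply/funext => p; rewrite !indicE; congr ((nat_of_bool _)%:R).
Qed.

(** Tonelli: for fixed x only |h| <= rho(x)/lam contributes, and by [ball_power] the integral over
    those h is at most C (rho(x)/lam)^m. Here theta < 1 enters, as q < n. *)
Lemma shell_energy : exists2 C : R, 0 <= C & forall j lam, 0 < lam ->
  (\int[mu2]_p (\1_H p.1 * `|p.1| `^ (- (n%:R + 2 * theta - 2)) *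
      (\1_(T2 lam p.1) p.2 * g j p.2 ^+ 2))%:E <=
   (C * lam `^ (- m))%:E * energy j)%E.
Proof.
set q := n%:R + 2 * theta - 2.
have qn : q < n%:R by have := theta1; rewrite /q; lra.
have [C C0 HC] := ball_power qn.
have mE : n%:R - q = m by rewrite /q /m; lra.
exists C => // j lam lam0.
pose F (p : V * V) : R := \1_H p.1 * `|p.1| `^ (- q) *
      (\1_(T2 lam p.1) p.2 * g j p.2 ^+ 2).
have mF : measurable_fun setT F.
  apply: measurable_funM.
    apply: measurable_funM; first exact: measurable_indic_comp.
    apply: measurable_powR_comp; apply: (measurableT_comp (@measurable_rV_norm R n)).
    exact: measurable_fst.
  apply: measurable_funM => //.
  by apply: measurable_funX; exact: (measurableT_comp (mg j)).
have F0 p : 0 <= F p by rewrite /F mulr_ge0// mulr_ge0// ?powR_ge0// sqr_ge0.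
rewrite -[X in (X <= _)%E]/(\int[mu2]_p (F p)%:E)%E.
rewrite (fubini_tonelli2 (fun p => (F p)%:E)); [|exact/measurable_EFinP|by move=> p; rewrite lee_fin].
have mEn : measurable_fun setT (fun x => \1_P x * (rho x `^ m * g j x ^+ 2)).
  apply: measurable_funM; first exact: measurable_indic.
  apply: measurable_funM; first exact: measurable_powR_comp.
  exact: measurable_funX.
rewrite /energy -integralRZl//; last 2 first.
- by move=> x; rewrite mulr_ge0// mulr_ge0 ?powR_ge0// sqr_ge0.
- by rewrite mulr_ge0// powR_ge0.
apply: ge0_le_integral => //.
- by move=> x _; apply: integral_ge0 => h _; rewrite lee_fin.
- apply: (measurable_fun_fubini_tonelli_G (fun p => (F p)%:E)).
    exact/measurable_EFinP.
  by move=> p; rewrite lee_fin.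
- by apply/measurable_EFinP; exact: measurable_funM.
move=> x _; rewrite /fubini_G /F /=.
have [Px|Px] := pselect (P x); last first.
  rewrite (indic_notin _ Px) mul0r mulr0 le_eqVlt; apply/orP; left; apply/eqP.
  have nT h : ~ T2 lam h x by move=> [].
  by rewrite integral0_eq// => h _; rewrite (indic_notin _ (nT h)) mul0r mulr0.
have rx := rhoP Px.
have rl : 0 < rho x / lam by rewrite divr_gt0.
apply: (@le_trans _ _ (\int[mu]_h (g j x ^+ 2 *
    (\1_[set h : V | (0 < `|h| <= rho x / lam)%R] h * `|h| `^ (- q)))%:E)%E).
  apply: le_integralR.
  - exact: (measurable_fun_pair1 x mF).
  - apply: measurable_funM => //; apply: measurable_funM.
      apply: measurable_indic; apply: measurable_set0lt; exact: measurable_rV_norm.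
    by apply: measurable_powR_comp; exact: measurable_rV_norm.
  move=> h; apply/andP; split; first exact: (F0 (h, x)).
  rewrite [leLHS](_ : _ = g j x ^+ 2 * (\1_H h * `|h| `^ (- q) * \1_(T2 lam h) x)); last by ring.
  apply: ler_wpM2l; first exact: sqr_ge0.
  have [Hh|Hh] := pselect (H h); last by rewrite (indic_notin _ Hh) mul0r mul0r mulr_ge0 ?powR_ge0.
  have [Th|Th] := pselect (T2 lam h x); last by rewrite (indic_notin _ Th) mulr0 mulr_ge0 ?powR_ge0.
  rewrite (indic_in _ Hh) (indic_in _ Th) mul1r mulr1 indic_in ?mul1r//=.
  by case/andP: Hh => -> _; rewrite ler_pdivlMr// mulrC; case: Th.
rewrite integralRZl ?sqr_ge0//; last first.
  apply: measurable_funM.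
    apply: measurable_indic; apply: measurable_set0lt; exact: measurable_rV_norm.
  by apply: measurable_powR_comp; exact: measurable_rV_norm.
apply: (@le_trans _ _ ((g j x ^+ 2)%:E * (C * (rho x / lam) `^ (n%:R - q))%:E)%E).
  by apply: lee_wpmul2l; [rewrite lee_fin sqr_ge0|exact: HC].
rewrite -EFinM lee_fin (indic_in _ Px) mul1r mE.
rewrite powRM ?(ltW rx) ?invr_ge0 ?(ltW lam0)//.
rewrite (_ : lam^-1 `^ m = lam `^ (- m)); last first.
  by rewrite -powR_inv1 ?(ltW lam0)// -powRrM mulN1r.
by rewrite le_eqVlt; apply/orP; left; apply/eqP; ring.
Qed.

(* [k] and [s] send [x] to the base point and the signed length of a coordinate
   step that stays in [T2 lam h]. *)
Lemma step_energy : exists2 C : R, 0 <= C & forall j lam A (k : V -> V) (s : V -> R),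
  0 < lam -> 0 <= A -> measurable_fun setT k -> measurable_fun setT s ->
  (forall h, `|s h| <= A * `|h|) ->
  (forall h, H h -> forall x, S x -> forall t, 0 <= t <= 1 ->
    T2 lam h (x + k h + (t * s h) *: e j)) ->
  (\int[mu2]_p (\1_H p.1 * w p.1 * (\1_S p.2 *
      (f0 (p.2 + k p.1 + s p.1 *: e j) - f0 (p.2 + k p.1)) ^+ 2))%:E <=
   (A ^+ 2 * (C * lam `^ (- m)))%:E * energy j)%E.
Proof.
have [C C0 HC] := shell_energy; exists C => // j lam A k s lam0 A0 mk ms sA kT.
pose F (p : V * V) : R := \1_H p.1 * w p.1 * (\1_S p.2 *
      (f0 (p.2 + k p.1 + s p.1 *: e j) - f0 (p.2 + k p.1)) ^+ 2).
have mF : measurable_fun setT F.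
  apply: measurable_funM.
    apply: measurable_funM; first exact: measurable_indic_comp.
    exact: (measurableT_comp mw).
  apply: measurable_funM; first exact: measurable_indic_comp.
  apply: measurable_funX; apply: measurable_funB; last exact: measurable_pairfun.
  apply: (eq_measurable_fun (fun p : V * V => f0 (p.2 + (k p.1 + s p.1 *: e j)))).
    by move=> p _; rewrite addrA.
  apply: (@measurable_pairfun (fun h => k h + s h *: e j)) => //.
  by apply: measurable_rVD => //; exact: measurable_rVZ.
have F0 p : 0 <= F p by rewrite /F mulr_ge0// mulr_ge0// sqr_ge0.
pose q := n%:R + 2 * theta - 2.
pose G (p : V * V) : R := \1_H p.1 * `|p.1| `^ (- q) *
      (\1_(T2 lam p.1) p.2 * g j p.2 ^+ 2).
have mG : measurable_fun setT G.
  apply: measurable_funM.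
    apply: measurable_funM; first exact: measurable_indic_comp.
    apply: measurable_powR_comp; apply: (measurableT_comp (@measurable_rV_norm R n)).
    exact: measurable_fst.
  apply: measurable_funM => //.
  by apply: measurable_funX; exact: (measurableT_comp (mg j)).
have G0 p : 0 <= G p by rewrite /G mulr_ge0// mulr_ge0// ?powR_ge0// sqr_ge0.
rewrite EFinM -muleA.
apply: (@le_trans _ _ ((A ^+ 2)%:E * \int[mu2]_p (G p)%:E)%E); last first.
  by apply: lee_wpmul2l; [rewrite lee_fin sqr_ge0|exact: HC].
rewrite -[X in (X <= _)%E]/(\int[mu2]_p (F p)%:E)%E.
rewrite -integralRZl ?sqr_ge0//.
rewrite (fubini_tonelli1 (fun p => (F p)%:E)); [|exact/measurable_EFinP|by move=> p; rewrite lee_fin].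
rewrite (fubini_tonelli1 (fun p => (A ^+ 2 * G p)%:E)); last 2 first.
- by apply/measurable_EFinP; exact: measurable_funM.
- by move=> p; rewrite lee_fin mulr_ge0// sqr_ge0.
apply: ge0_le_integral => //.
- by move=> x _; apply: integral_ge0 => h _; rewrite lee_fin.
- apply: (measurable_fun_fubini_tonelli_F (fun p => (F p)%:E)).
    exact/measurable_EFinP.
  by move=> p; rewrite lee_fin.
- apply: (measurable_fun_fubini_tonelli_F (fun p => (A ^+ 2 * G p)%:E)).
    by apply/measurable_EFinP; exact: measurable_funM.
  by move=> p; rewrite lee_fin mulr_ge0// sqr_ge0.
move=> h _; rewrite /fubini_F /F /G /=.
have [Hh|Hh] := pselect (H h); last first.
  rewrite (indic_notin _ Hh).
  by under eq_integral do rewrite !mul0r; rewrite integral0 integral_ge0// => x _; rewrite lee_fin !mul0r mulr0.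
rewrite (indic_in _ Hh) mul1r mul1r.
have h0 : 0 < `|h| by case: Hh => /= /andP[].
have mT : measurable (T2 lam h).
  apply: measurableI => //.
  rewrite (_ : [set x | _] = [set x | - rho x <= - (lam * `|h|)]).
    by apply: measurable_setle; exact: measurableT_comp.
  by apply/seteqP; split => x /=; rewrite lerN2.
have mI1 : measurable_fun setT (fun x => \1_S x * (f0 (x + k h + s h *: e j) - f0 (x + k h)) ^+ 2).
  apply: measurable_funM; first exact: measurable_indic.
  apply: measurable_funX; apply: measurable_funB; apply: (measurableT_comp mf0); last exact: rV_shift.
  by apply: measurable_rVD => //; exact: rV_shift.
have mI2 : measurable_fun setT (fun x => \1_(T2 lam h) x * g j x ^+ 2).
  by apply: measurable_funM; [exact: measurable_indic|exact: measurable_funX].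
rewrite integralRZl//; last by move=> x; rewrite mulr_ge0// sqr_ge0.
have sE := @shift_energy R n U f oU C1 S (T2 lam h) (k h) j (s h) mS mT _ (kT h Hh).
apply: (le_trans (lee_wpmul2l _ (sE _))); first by rewrite lee_fin.
  by move=> x [[]].
have -> : (\int[mu]_x (A ^+ 2 * (`|h| `^ (- q) * (\1_(T2 lam h) x * g j x ^+ 2)))%:E =
   (A ^+ 2 * `|h| `^ (- q))%:E * \int[mu]_x (\1_(T2 lam h) x * g j x ^+ 2)%:E)%E.
  under eq_integral do rewrite mulrA.
  rewrite integralRZl ?mulr_ge0 ?sqr_ge0 ?powR_ge0//.
  by move=> x; rewrite mulr_ge0// sqr_ge0.
rewrite muleA -EFinM; apply: lee_wpmul2r.
  by apply: integral_ge0 => x _; rewrite lee_fin mulr_ge0// sqr_ge0.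
rewrite lee_fin.
have -> : `|h| `^ (- q) = w h * `|h| ^+ 2.
  rewrite /w -powR_mulrn// -powRD; last by apply/implyP => _; rewrite gt_eqF.
  by congr (_ `^ _); rewrite /q; ring.
rewrite [leRHS]mulrCA ler_wpM2l// -exprMn -[s h ^+ 2]real_normK ?num_real//.
by rewrite ler_pXn2r ?nnegrE// mulr_ge0.
Qed.

(** The corners of the staircase from 0 to h along the coordinate axes: consecutive ones differ in a
    single coordinate, and none exceeds h in sup norm. *)
Let pv (k : nat) (h : V) : V := \row_l (if (l < k)%N then h 0 l else 0).

Let pv0 h : pv 0 h = 0.
Proof. by apply/rowP => l; rewrite !mxE. Qed.

Let pvn h : pv n h = h.
Proof. by apply/rowP => l; rewrite !mxE ltn_ord. Qed.

Let pvS (j : 'I_n) h : pv j.+1 h = pv j h + h 0 j *: e j.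
Proof.
apply/rowP => l; rewrite !mxE /= ltnS leq_eqVlt -[l == j]/(l == j :> nat).
by case: ltngtP => [lj|lj|/val_inj ->]; rewrite /= ?mulr0 ?mulr1 ?addr0 ?add0r.
Qed.

Let pv_le (j : 'I_n) h t : 0 <= t <= 1 -> `|pv j h + (t * h 0 j) *: e j| <= `|h|.
Proof.
move=> /andP[t0 t1]; apply: rV_norm_le => // l; rewrite !mxE /=.
have hl := rV_coord_le h l.
case: (ltngtP l j) => lj.
- by rewrite -[l == j]/(l == j :> nat) ltn_eqF// mulr0 addr0.
- by rewrite -[l == j]/(l == j :> nat) gtn_eqF// mulr0 addr0 normr0.
rewrite -[l == j]/(l == j :> nat) lj eqxx mulr1 add0r normrM ger0_norm//.
have -> : j = l by exact/esym/val_inj.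
by apply: le_trans hl; rewrite ler_piMl.
Qed.

Let e0_le t : `|t *: e0| <= `|t|.
Proof.
rewrite scalerA; apply: le_trans (rV_delta_norm _ _) _.
by rewrite normrM normr_sign mulr1.
Qed.

Let S_c x : S x -> `|x - c| <= r1 /\ 0 < rho x.
Proof.
move=> [/= xc Ux]; split=> //; apply/rhoU => //; apply: le_lt_trans r1R0.
by have := mulr_ge0 (ltW K0) (ltW r10); have := r10; lra.
Qed.

(** Going up by t raises [rho] by exactly t from a positive value, and the displacement [v] takes
    back at most L|v|. The bounds on t and v keep the point in the chart. *)
Let T2_intro lam h x t v : S x -> 0 <= t <= K * (2 * r1) -> `|v| <= 2 * r1 ->
  lam * `|h| <= t - L * `|v| -> 0 < t - L * `|v| -> T2 lam h (x + t *: e0 + v).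
Proof.
move=> /S_c[xc rx] /andP[t0 tK] vr lt tv.
have rr := r10.
have in1 : `|x + t *: e0 - c| < R0.
  apply: le_lt_trans r1R0; rewrite addrAC; apply: le_trans (ler_normD _ _) _.
  by have := e0_le t; rewrite ger0_norm//; lra.
have in2 : `|x + t *: e0 + v - c| < R0.
  apply: le_lt_trans r1R0; rewrite addrAC; apply: le_trans (ler_normD _ _) _.
  apply: lerD => //; rewrite addrAC; apply: le_trans (ler_normD _ _) _.
  by have := e0_le t; rewrite ger0_norm//; lra.
have E : x + t *: e0 + v - (x + t *: e0) = v by rewrite addrAC subrr add0r.
have := rho_lip in2 in1; rewrite rho_shift E ler_norml => /andP[H1 _].
have lo : lam * `|h| < rho (x + t *: e0 + v) by lra.
split; last exact: ltW.
by split => //; apply/rhoU => //; lra.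
Qed.

Let mpv k : measurable_fun setT (pv k).
Proof.
apply: measurable_fun_rV => l.
apply: (eq_measurable_fun (fun h => if (l < k)%N then rV_coord l h else 0)).
  by move=> h _; rewrite /= /rV_coord mxE.
case: (l < k)%N; [exact: measurable_rV_coord|exact: measurable_cst].
Qed.

Let measurable_horizontal (j : 'I_n) :
  measurable_fun setT (fun p : V * V => \1_H p.1 * w p.1 * (\1_S p.2 *
      (f0 (p.2 + ((K * `|p.1|) *: e0 + pv j p.1) + p.1 0 j *: e j) -
       f0 (p.2 + ((K * `|p.1|) *: e0 + pv j p.1))) ^+ 2)).
Proof.
have mk : measurable_fun setT (fun h : V => (K * `|h|) *: e0 + pv j h).
  apply: measurable_rVD => //; apply: measurable_rVZ => //.
  by apply: measurable_funM => //; exact: measurable_rV_norm.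
apply: measurable_funM.
  apply: measurable_funM; first exact: measurable_indic_comp.
  exact: (measurableT_comp mw).
apply: measurable_funM; first exact: measurable_indic_comp.
apply: measurable_funX; apply: measurable_funB; last exact: (@measurable_pairfun (fun h : V => (K * `|h|) *: e0 + pv j h)).
apply: (eq_measurable_fun (fun p : V * V => f0 (p.2 + ((K * `|p.1|) *: e0 + pv j p.1 + p.1 0 j *: e j)))).
  by move=> p _; rewrite addrA.
apply: (@measurable_pairfun (fun h : V => (K * `|h|) *: e0 + pv j h + h 0 j *: e j)) => //.
apply: measurable_rVD => //; apply: measurable_rVZ => //.
exact: (measurable_rV_coord j).
Qed.

(** One stair at height K|h|: [step_energy] applies with lam = 1 and A = 1, because K - L = 1. *)
Lemma horizontal_energy (j : 'I_n) : (\int[mu2]_p (\1_H p.1 * w p.1 * (\1_S p.2 *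
      (f0 (p.2 + ((K * `|p.1|) *: e0 + pv j p.1) + p.1 0 j *: e j) -
       f0 (p.2 + ((K * `|p.1|) *: e0 + pv j p.1))) ^+ 2))%:E < +oo)%E.
Proof.
have [C C0 HC] := step_energy.
have mn : measurable_fun setT (fun h : V => K * `|h|).
  by apply: measurable_funM => //; exact: measurable_rV_norm.
apply: (le_lt_trans (HC j 1 1 (fun h => (K * `|h|) *: e0 + pv j h) (fun h => h 0 j) _ _ _ _ _ _)) => //.
- by apply: measurable_rVD => //; exact: measurable_rVZ.
- exact: (measurable_rV_coord j).
- by move=> h; rewrite mul1r; exact: rV_coord_le.
- move=> h Hh x Sx t t1.
  have -> : x + ((K * `|h|) *: e0 + pv j h) + (t * h 0 j) *: e j =
      x + (K * `|h|) *: e0 + (pv j h + (t * h 0 j) *: e j) by rewrite !addrA.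
  have /andP[h0 hr] : 0 < `|h| <= 2 * r1 by [].
  have pl := pv_le j h t1.
  have Lh : L * `|pv j h + (t * h 0 j) *: e j| <= L * `|h| by rewrite ler_wpM2l.
  apply: (@T2_intro 1 h x (K * `|h|) (pv j h + (t * h 0 j) *: e j) Sx).
  + by rewrite mulr_ge0 ?(ltW K0)//= ler_wpM2l// ltW.
  + exact: le_trans hr.
  + by rewrite mul1r; move: Lh; rewrite /K; lra.
  + by move: Lh; rewrite /K; lra.
apply: lte_mul_pinfty => //.
by rewrite lee_fin mulr_ge0 ?sqr_ge0// mulr_ge0 ?powR_ge0.
Qed.

Let f0_cvg x (r : R) : U x -> f0 (x + (r * 2^-1 ^+ M) *: e0) @[M --> \oo] --> f0 x.
Proof.
move=> Ux; have cf := classC_continuous C1 Ux.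
have [d1 d10 Hd1] := open_cubeP oU Ux.
apply/cvgrPdist_lt => eps eps0.
have [d2 d20 Hd2] := continuous_cubeP cf eps0.
have d0 : 0 < Num.min d1 d2 by rewrite lt_min d10.
have : (fun k => geometric `|r| (2^-1 : R) k) @ \oo --> 0.
  by apply: cvg_geometric; rewrite ger0_norm// invf_lt1// ltr1n.
move=> /cvgrPdist_lt/(_ _ d0); apply: filterS => M /=.
rewrite sub0r normrN lt_min => /andP[M1 M2].
have Mn : `|x + (r * 2^-1 ^+ M) *: e0 - x| <= `| `|r| * 2^-1 ^+ M|.
  by rewrite addrC addKr; apply: le_trans (e0_le _) _; rewrite !normrM normr_id.
rewrite !patchE !mem_set//; last by apply: Hd1; exact: le_lt_trans M1.
by rewrite distrC; apply: Hd2; exact: le_lt_trans M2.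
Qed.

(** The increment telescopes over the points x + r 2^(-k) e0, which converge to x. Since x lies in
    the open set [U], continuity of f there closes the limit, and [sqr_sum_le] bounds every partial
    sum. *)
Let dyadic_le q x r : 1 < q -> U x ->
  (((f0 (x + r *: e0) - f0 x) ^+ 2)%:E <=
   \sum_(k <oo) (q / (q - 1) * (q ^+ k * (f0 (x + (r * 2^-1 ^+ k) *: e0) -
      f0 (x + (r * 2^-1 ^+ k.+1) *: e0)) ^+ 2))%:E)%E.
Proof.
move=> q1 Ux.
have q0 : 0 < q by exact: lt_trans q1.
have c0 : 0 <= q / (q - 1) by rewrite divr_ge0 ?subr_ge0// ltW.
pose F k := f0 (x + (r * 2^-1 ^+ k) *: e0).
have u0 k : 0 <= q / (q - 1) * (q ^+ k * (F k - F k.+1) ^+ 2).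
  by rewrite mulr_ge0// mulr_ge0 ?sqr_ge0// exprn_ge0// ltW.
have ge0 : (0 <= \sum_(k <oo) (q / (q - 1) * (q ^+ k * (F k - F k.+1) ^+ 2))%:E)%E.
  by apply: nneseries_ge0 => k _ _; rewrite lee_fin.
have leS M : (((F 0%N - F M) ^+ 2)%:E <= \sum_(k <oo) (q / (q - 1) * (q ^+ k * (F k - F k.+1) ^+ 2))%:E)%E.
  apply: le_trans (@nneseries_lim_ge R _ xpredT 0%N M _); last by move=> k _ _; rewrite lee_fin.
  rewrite sumEFin lee_fin -mulr_sumr.
  apply: le_trans (sqr_sum_le _ _ q1); rewrite le_eqVlt; apply/orP; left; apply/eqP.
  congr (_ ^+ 2); rewrite -[LHS]opprK opprB -(telescope_sumr F (leq0n M)) -sumrN.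
  by apply: eq_bigr => k _; rewrite opprB.
rewrite -[X in (_ <= X)%E]/(\sum_(k <oo) (q / (q - 1) * (q ^+ k * (F k - F k.+1) ^+ 2))%:E)%E.
move: ge0 leS; case: (\sum_(k <oo) _)%E => [s| |] // _ leS; last by rewrite leey.
rewrite lee_fin; have F0 : F 0%N = f0 (x + r *: e0) by rewrite /F expr0 mulr1.
have cv : (F 0%N - F M) ^+ 2 @[M --> \oo] --> (f0 (x + r *: e0) - f0 x) ^+ 2.
  rewrite -F0 expr2; under eq_fun do rewrite expr2.
  by apply: cvgM; (apply: cvgB; [exact: cvg_cst|exact: f0_cvg]).
rewrite -(cvg_lim (@Rhausdorff R) cv); apply: limr_le; first by apply/cvg_ex; eexists; exact: cv.
by apply: nearW => M; have := leS M; rewrite lee_fin.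
Qed.

Let vert (p : V * V) : R :=
  \1_H p.1 * w p.1 * (\1_S p.2 * (f0 (p.2 + (K * `|p.1|) *: e0) - f0 p.2) ^+ 2).

Let mvert : measurable_fun setT vert.
Proof.
apply: measurable_funM.
  apply: measurable_funM; first exact: measurable_indic_comp.
  exact: (measurableT_comp mw).
apply: measurable_funM; first exact: measurable_indic_comp.
apply: measurable_funX; apply: measurable_funB.
  apply: (@measurable_pairfun (fun h : V => (K * `|h|) *: e0)) => //.
  apply: measurable_rVZ => //; apply: measurable_funM => //; exact: measurable_rV_norm.
exact: (measurableT_comp mf0).
Qed.

Let vert_ge0 p : 0 <= vert p.
Proof. by rewrite /vert mulr_ge0// mulr_ge0// sqr_ge0. Qed.

(** The k-th dyadic piece runs from height [lam k] |h| to twice that, so [step_energy] charges it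
    lam^2 lam^(-m) = lam^(2 theta), which decays geometrically in k. *)
Lemma vertical_energy : (\int[mu2]_p (vert p)%:E < +oo)%E.
Proof.
have [C C0 HC] := step_energy.
(* Half of the available decay 2^(-2 theta k) pays for the weights q^k; the ratio [Q] = 2^(-theta)
   remains. *)
pose q : R := 2 `^ theta.
have q1 : 1 < q.
  rewrite ltNge; apply/negP => qle.
  have : ln q <= 0 by exact: ln_le0.
  rewrite /q ln_powR leNgt mulr_gt0//.
  by apply: ln_gt0; rewrite ltr1n.
have q0 : 0 < q by exact: lt_trans q1.
have c0 : 0 <= q / (q - 1) by rewrite divr_ge0 ?subr_ge0// ltW.
(* The exponent is [k.+1] because [lam k] is the lower end of the piece; its upper end is K /
   2^k. *)
pose lam k : R := 2^-1 ^+ k.+1 * K.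
have lam0 k : 0 < lam k by rewrite mulr_gt0// exprn_gt0.
have lamK k : 2 * lam k <= K.
  rewrite /lam exprS !mulrA divff// mul1r ler_piMl ?(ltW K0)// exprn_ile1//.
  by rewrite invf_le1// ler1n.
pose d k (p : V * V) := f0 (p.2 + (lam k * `|p.1|) *: e0 + (lam k * `|p.1| * (-1) ^+ b) *: e i) -
   f0 (p.2 + (lam k * `|p.1|) *: e0).
pose F k (p : V * V) := \1_H p.1 * w p.1 * (\1_S p.2 * d k p ^+ 2).
have mn k : measurable_fun setT (fun h : V => lam k * `|h|).
  by apply: measurable_funM => //; exact: measurable_rV_norm.
have mF k : measurable_fun setT (F k).
  apply: measurable_funM.
    apply: measurable_funM; first exact: measurable_indic_comp.
    exact: (measurableT_comp mw).
  apply: measurable_funM; first exact: measurable_indic_comp.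
  apply: measurable_funX; apply: measurable_funB; last first.
    by apply: (@measurable_pairfun (fun h : V => (lam k * `|h|) *: e0)) => //; exact: measurable_rVZ.
  apply: (eq_measurable_fun (fun p : V * V => f0 (p.2 + ((lam k * `|p.1|) *: e0 +
      (lam k * `|p.1| * (-1) ^+ b) *: e i)))).
    by move=> p _; rewrite addrA.
  apply: (@measurable_pairfun (fun h : V => (lam k * `|h|) *: e0 +
      (lam k * `|h| * (-1) ^+ b) *: e i)) => //.
  apply: measurable_rVD; apply: measurable_rVZ => //.
  exact: measurable_funM.
have F0 k p : 0 <= F k p by rewrite /F mulr_ge0// mulr_ge0// sqr_ge0.
have stepF k : (\int[mu2]_p (F k p)%:E <= (lam k ^+ 2 * (C * lam k `^ (- m)))%:E * energy i)%E.
  apply: (HC i (lam k) (lam k) (fun h => (lam k * `|h|) *: e0)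
    (fun h => lam k * `|h| * (-1) ^+ b)) => //.
  - exact: ltW.
  - exact: measurable_rVZ.
  - exact: measurable_funM.
  - by move=> h; rewrite normrM normr_sign mulr1 ger0_norm// mulr_ge0// ltW.
  move=> h /andP[h0 hr] x Sx t /andP[t0 t1].
  have lh : 0 < lam k * `|h| by rewrite mulr_gt0.
  have -> : x + (lam k * `|h|) *: e0 + (t * (lam k * `|h| * (-1) ^+ b)) *: e i =
      x + (lam k * `|h| * (1 + t)) *: e0 + 0.
    by rewrite addr0 -addrA -scalerA !scalerA -scalerDl; congr (_ + _ *: _); ring.
  apply: (@T2_intro (lam k) h x _ 0 Sx); rewrite ?normr0 ?mulr0 ?subr0.
  - rewrite mulr_ge0 ?addr_ge0 ?(ltW lh)//=.
    apply: (@le_trans _ _ (lam k * `|h| * 2)).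
      by rewrite ler_wpM2l ?(ltW lh)//; lra.
    have := ler_wpM2r (ltW h0) (lamK k); have := ler_wpM2l (ltW K0) hr; lra.
  - by have := r10; lra.
  - by rewrite ler_peMr ?(ltW lh)//; lra.
  - by rewrite mulr_gt0//; lra.
have energy_ge0 : (0 <= energy i)%E.
  by apply: integral_ge0 => x _; rewrite lee_fin mulr_ge0// mulr_ge0 ?powR_ge0// sqr_ge0.
have [E E0 EE] : exists2 E : R, 0 <= E & energy i = E%:E.
  exists (fine (energy i)); first exact: fine_ge0.
  by rewrite fineK// ge0_fin_numE.
pose Q := 2^-1 `^ theta.
have Q1 : 0 < Q < 1.
  rewrite powR_gt0//=; rewrite (_ : Q = q^-1) ?invf_lt1//.
  by rewrite /Q /q -powR_inv1// -powRrM mulN1r powRN.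
apply: (@le_lt_trans _ _ (\int[mu2]_p \sum_(k <oo) (q / (q - 1) * (q ^+ k * F k p))%:E)%E).
  apply: ge0_le_integral => //.
  - by move=> p _; rewrite lee_fin.
  - exact/measurable_EFinP.
  - apply: measurable_nneseries => [k|k p].
      by do 2 apply: measurable_funM => //.
    by rewrite mulr_ge0// mulr_ge0// exprn_ge0// ltW.
  move=> [h x] _.
  have sge0 : (0 <= \sum_(k <oo) (q / (q - 1) * (q ^+ k * F k (h, x)))%:E)%E.
    by apply: nneseries_ge0 => k _ _; rewrite lee_fin mulr_ge0// mulr_ge0// exprn_ge0// ltW.
  have [Sx|Sx] := pselect (S x); last by rewrite /vert /= (indic_notin _ Sx) mul0r mulr0.
  rewrite /vert /= (indic_in _ Sx) mul1r EFinM.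
  apply: (le_trans (lee_wpmul2l _ (dyadic_le (K * `|h|) q1 _))).
  - by rewrite lee_fin mulr_ge0.
  - by case: Sx.
  rewrite -nneseriesZl; last first.
    by move=> k _; rewrite lee_fin mulr_ge0// mulr_ge0 ?sqr_ge0// exprn_ge0// ltW.
  apply: lee_nneseries => k.
    move=> _ _; rewrite -EFinM lee_fin; apply: mulr_ge0; first by rewrite mulr_ge0.
    apply: mulr_ge0 => //; apply: mulr_ge0; last exact: sqr_ge0.
    by rewrite exprn_ge0// ltW.
  move=> _; rewrite -EFinM lee_fin /F /= (indic_in _ Sx) mul1r /d /=.
  have -> : K * `|h| * 2^-1 ^+ k.+1 = lam k * `|h| by rewrite /lam; ring.
  have -> : x + (lam k * `|h|) *: e0 + (lam k * `|h| * (-1) ^+ b) *: e i =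
      x + (K * `|h| * 2^-1 ^+ k) *: e0.
    rewrite -addrA !scalerA -scalerDl; congr (_ + _ *: _).
    by rewrite /lam exprS; field.
  by rewrite le_eqVlt; apply/orP; left; apply/eqP; ring.
rewrite integral_nneseries//; last 2 first.
- by move=> k; apply/measurable_EFinP; do 2 apply: measurable_funM => //.
- by move=> k p _; rewrite lee_fin mulr_ge0// mulr_ge0// exprn_ge0// ltW.
pose a := q / (q - 1) * (C * E * K `^ (2 * theta)) * 2^-1 `^ (2 * theta).
apply: (@le_lt_trans _ _ (a / (1 - Q))%:E); last by rewrite ltry.
apply: nneseries_geometric_le => //.
- apply: mulr_ge0; last exact: powR_ge0.
  by apply: mulr_ge0 => //; apply: mulr_ge0; [exact: mulr_ge0|exact: powR_ge0].
- by move=> k; apply: integral_ge0 => p _; rewrite lee_fin mulr_ge0// mulr_ge0// exprn_ge0// ltW.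
move=> k.
under eq_integral do rewrite mulrA.
rewrite integralRZl//; last by rewrite mulr_ge0// exprn_ge0// ltW.
apply: (le_trans (lee_wpmul2l _ (stepF k))).
  by rewrite lee_fin mulr_ge0// exprn_ge0// ltW.
rewrite EE -!EFinM lee_fin le_eqVlt; apply/orP; left; apply/eqP.
have lamE : lam k ^+ 2 * lam k `^ (- m) = K `^ (2 * theta) * (2^-1 `^ (2 * theta) * (2^-1 `^ (2 * theta)) ^+ k).
  rewrite -exprS -powR_mulrn ?(ltW (lam0 k))// -powRD; last by apply/implyP => _; rewrite gt_eqF.
  rewrite (_ : 2%:R + - m = 2 * theta); last by rewrite /m; ring.
  rewrite /lam powRM ?exprn_ge0 ?(ltW K0)// mulrC; congr (_ * _).
  by rewrite powR_exprn ?invr_ge0// exprS.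
have qQ : q ^+ k * (2^-1 `^ (2 * theta)) ^+ k = Q ^+ k.
  rewrite -exprMn; congr (_ ^+ _).
  rewrite (_ : 2 * theta = theta + theta); last by ring.
  rewrite powRD; last by apply/implyP => _; rewrite invr_eq0.
  by rewrite mulrA -powRM// divff// powR1 mul1r.
rewrite -qQ /a.
transitivity (q / (q - 1) * (C * E) * q ^+ k * (lam k ^+ 2 * lam k `^ (- m))); first by ring.
by rewrite lamE; ring.
Qed.

(** With h the increment, f(x) - f(x + h) = -A - B + C, where A and C are the vertical legs of
    length K|h| at x and at x + h, and B is the staircase between their tops. Each square has a
    finite integral against the kernel. *)
Lemma local_embedding : (\int[mu2]_p (\1_S p.1 * \1_S p.2 *
   ((f0 p.1 - f0 p.2) ^+ 2 * `|p.1 - p.2| `^ (- (n%:R + 2 * theta))))%:E < +oo)%E.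
Proof.
pose G (p : V * V) : R := \1_S p.1 * \1_S p.2 * ((f0 p.1 - f0 p.2) ^+ 2 * w (p.1 - p.2)).
have mG : measurable_fun setT G.
  apply: measurable_funM.
    by apply: measurable_funM; exact: measurable_indic_comp.
  apply: measurable_funM.
    by apply: measurable_funX; apply: measurable_funB; exact: (measurableT_comp mf0).
  apply: (measurableT_comp mw).
  apply: (eq_measurable_fun (fun p : V * V => p.1 + (-1) *: p.2)).
    by move=> p _; rewrite scaleN1r.
  by apply: measurable_rVD => //; apply: measurable_rVZ.
have G0 p : 0 <= G p.
  by rewrite /G mulr_ge0//; apply: mulr_ge0; [exact: sqr_ge0|exact: w0].
rewrite -[X in (X < _)%E]/(\int[mu2]_p (G p)%:E)%E.
rewrite -(integral_shear (G := fun p => (G p)%:E)); [|exact/measurable_EFinP|by move=> p; rewrite lee_fin].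
pose hz (j : 'I_n) (p : V * V) : R := \1_H p.1 * w p.1 * (\1_S p.2 *
      (f0 (p.2 + ((K * `|p.1|) *: e0 + pv j p.1) + p.1 0 j *: e j) -
       f0 (p.2 + ((K * `|p.1|) *: e0 + pv j p.1))) ^+ 2).
have hz0 j p : 0 <= hz j p by rewrite /hz mulr_ge0// mulr_ge0// sqr_ge0.
have mhz j : measurable_fun setT (hz j) by exact: measurable_horizontal.
pose vs (p : V * V) := vert (p.1, p.2 + p.1).
have mvs : measurable_fun setT vs.
  apply: (measurableT_comp mvert); apply: measurable_fun_pair => //.
  exact: measurable_rVD.
have cj0 (j : nat) : 0 <= 6 * 2 ^+ j :> R by rewrite mulr_ge0// exprn_ge0.
have mtot : measurable_fun setT (fun p => 3 * vert p + 3 * vs p + \sum_(j < n) 6 * 2 ^+ j * hz j p).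
  apply: measurable_funD; first by apply: measurable_funD; exact: measurable_funM.
  by apply: measurable_sum => j; exact: measurable_funM.
(* The 3 comes from squaring a sum of three terms; 6 * 2^j is that 3 times the constant 2 and the
   weights 2^j of [sqr_sum_le] with q = 2. *)
apply: (@le_lt_trans _ _ (\int[mu2]_p (3 * vert p + 3 * vs p +
    \sum_(j < n) 6 * 2 ^+ j * hz j p)%:E)%E); last first.
  have v3 p : 0 <= 3 * vert p by rewrite mulr_ge0.
  have vs3 p : 0 <= 3 * vs p by rewrite mulr_ge0// vert_ge0.
  have mv3 : measurable_fun setT (fun p => 3 * vert p) by exact: measurable_funM.
  have mvs3 : measurable_fun setT (fun p => 3 * vs p) by exact: measurable_funM.
  apply: integralRD_lty.
  - exact: measurable_funD.
  - by apply: measurable_sum => j; exact: measurable_funM.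
  - by move=> p; rewrite addr_ge0.
  - by move=> p; apply: sumr_ge0 => j _; rewrite mulr_ge0.
  - apply: integralRD_lty => //.
      by apply: integralRZ_lty => //; exact: vertical_energy.
    apply: integralRZ_lty => //; first by move=> p; exact: vert_ge0.
    rewrite /vs (integral_shear2 (G := fun p => (vert p)%:E)).
    + exact: vertical_energy.
    + exact/measurable_EFinP.
    + by move=> p; rewrite lee_fin.
  - rewrite integralR_sum => [|j|j p]; last 2 first.
    + exact: measurable_funM.
    + by rewrite mulr_ge0.
    apply: lte_sum_pinfty => j _.
    by apply: integralRZ_lty => //; exact: horizontal_energy.
apply: le_integralR; [|exact: mtot|].
  apply: (measurableT_comp mG); apply: measurable_fun_pair; first exact: measurable_snd.
  by apply: measurable_rVD; [exact: measurable_fst|exact: measurable_snd].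
move=> [h x] /=; rewrite G0/= /G /=.
have rhs0 : 0 <= 3 * vert (h, x) + 3 * vs (h, x) + \sum_(j < n) 6 * 2 ^+ j * hz j (h, x).
  apply: addr_ge0; first by apply: addr_ge0; apply: mulr_ge0 => //; exact: vert_ge0.
  by apply: sumr_ge0 => j _; rewrite mulr_ge0.
have [Sx|Sx] := pselect (S x); last by rewrite (indic_notin _ Sx) !mul0r.
have [Shx|Shx] := pselect (S (h + x)); last by rewrite (indic_notin _ Shx) mulr0 mul0r.
(* On the diagonal the difference of values is 0, so the value of the power at 0 is irrelevant. *)
have [h0|h0] := eqVneq h 0.
  by rewrite [X in f0 x - f0 X](_ : _ = x) ?subrr ?expr0n/= ?mul0r ?mulr0//; rewrite h0 add0r.
have Hh : H h.
  rewrite /H /= normr_gt0 h0 /=.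
  rewrite (_ : h = (h + x - c) - (x - c)); last by rewrite opprB addrA subrK addrK.
  apply: le_trans (ler_normB _ _) _.
  by have [+ _] := Sx; have [+ _] := Shx; move=> /=; lra.
have xh : x + h = h + x by rewrite addrC.
rewrite /vs /vert /= xh (indic_in _ Hh) (indic_in _ Sx) (indic_in _ Shx) !mul1r.
have -> : w (x - (h + x)) = w h by rewrite /w opprD addrCA subrr addr0 normrN.
have -> : \sum_(j < n) 6 * 2 ^+ j * hz j (h, x) = w h * (3 * (2 * \sum_(j < n)  2 ^+ j *
    (f0 (x + ((K * `|h|) *: e0 + pv j h) + h 0 j *: e j) - f0 (x + ((K * `|h|) *: e0 + pv j h))) ^+ 2)).
  rewrite !mulr_sumr; apply: eq_bigr => j _.
  by rewrite /hz /= (indic_in _ Hh) (indic_in _ Sx) !mul1r; ring.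
set A := f0 (x + _) - f0 x; set C := f0 (h + x + _) - f0 (h + x).
pose phi k := f0 (x + ((K * `|h|) *: e0 + pv k h)).
pose B := phi n - phi 0%N.
have BE : f0 x - f0 (h + x) = - A - B + C.
  rewrite /A /B /C /phi pvn pv0 addr0.
  have -> : x + ((K * `|h|) *: e0 + h) = h + x + (K * `|h|) *: e0.
    by rewrite addrA addrAC [x + h]addrC.
  by ring.
have B2 : B ^+ 2 <= 2 * \sum_(j < n) 2 ^+ j *
    (f0 (x + ((K * `|h|) *: e0 + pv j h) + h 0 j *: e j) - f0 (x + ((K * `|h|) *: e0 + pv j h))) ^+ 2.
  have := @sqr_sum_le R 2 (fun k => phi k.+1 - phi k) n; rewrite ltr1n => /(_ isT).
  rewrite telescope_sumr// -/B (_ : 2 / (2 - 1) = 2); last by field.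
  rewrite big_mkord => /le_trans; apply; rewrite le_eqVlt; apply/orP; left; apply/eqP.
  by congr (_ * _); apply: eq_bigr => j _; rewrite /phi pvS !addrA.
rewrite BE mulrC; set B' := 2 * _ in B2 *.
have ABC : (- A - B + C) ^+ 2 <= 3 * A ^+ 2 + 3 * C ^+ 2 + 3 * B ^+ 2.
  rewrite -subr_ge0 [X in 0 <= X](_ : _ = (A - B) ^+ 2 + (A + C) ^+ 2 + (B + C) ^+ 2); last by ring.
  by rewrite !addr_ge0// sqr_ge0.
apply: le_trans (ler_wpM2l (w0 h) ABC) _.
have := ler_wpM2l (w0 h) B2; lra.
Qed.

End embedding.

(** * Energy of bounded harmonic functions *)

Section positive_part.
Variable R : realFieldType.
Implicit Types a b m : R.

Definition pospart a : R := Num.max a 0.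

Lemma pospart_ge0 a : 0 <= pospart a.
Proof. by rewrite /pospart le_max lexx orbT. Qed.

Lemma pospart_id a : 0 <= a -> pospart a = a.
Proof. by move=> a0; rewrite /pospart; apply/max_idPl. Qed.

Lemma pospart_eq0 a : a <= 0 -> pospart a = 0.
Proof. by move=> a0; rewrite /pospart; apply/max_idPr. Qed.

Lemma pospart_lip a b : `|pospart a - pospart b| <= `|a - b|.
Proof.
case: (leP 0 a) => a0; case: (leP 0 b) => b0.
- by rewrite !pospart_id.
- rewrite pospart_id// (pospart_eq0 (ltW b0)) subr0 ger0_norm// ger0_norm; lra.
- rewrite (pospart_eq0 (ltW a0)) pospart_id// sub0r normrN ger0_norm// ler0_norm; lra.
- by rewrite (pospart_eq0 (ltW a0)) (pospart_eq0 (ltW b0)) subrr normr0.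
Qed.

(** The square of the positive part is C^{1,1}, with derivative 2 [pospart] and quadratic Taylor
    remainder. This makes the radial factor of the cutoff regular across its own boundary. *)
Lemma pospart_sqr_taylor a m :
  `|pospart a ^+ 2 - pospart m ^+ 2 - 2 * pospart m * (a - m)| <= (a - m) ^+ 2.
Proof.
case: (leP 0 a) => a0; case: (leP 0 m) => m0.
- rewrite !pospart_id// (_ : _ - _ - _ = (a - m) ^+ 2); last by ring.
  by rewrite ger0_norm// sqr_ge0.
- by rewrite pospart_id// (pospart_eq0 (ltW m0)) ger0_norm; nra.
- by rewrite (pospart_eq0 (ltW a0)) pospart_id// ger0_norm; nra.
- by rewrite (pospart_eq0 (ltW a0)) (pospart_eq0 (ltW m0)) mulr0 mul0r expr0n/= !subr0 normr0 sqr_ge0.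
Qed.

(* Away from the kink, that is when [`|m| > d], the positive part is affine. *)
Lemma pospart_sdiff a b m d : `|a - m| <= d -> `|b - m| <= d ->
  `|pospart a + pospart b - 2 * pospart m| <=
    `|a + b - 2 * m| + (if `|m| <= d then 2 * d else 0).
Proof.
move=> ad bd; case: ifPn => md.
  have := pospart_lip a m; have := pospart_lip b m.
  have := ler_normD (pospart a - pospart m) (pospart b - pospart m).
  rewrite (_ : pospart a - _ + _ = pospart a + pospart b - 2 * pospart m); last by ring.
  by have := normr_ge0 (a + b - 2 * m); lra.
rewrite -ltNge in md; rewrite addr0.
have /andP[a1 a2] : - d <= a - m <= d by rewrite -ler_norml.
have /andP[b1 b2] : - d <= b - m <= d by rewrite -ler_norml.
case: (leP 0 m) => m0.
  have dm : d < m by rewrite ger0_norm// in md.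
  by rewrite !pospart_id//; lra.
have dm : d < - m by rewrite ltr0_norm// in md.
rewrite (@pospart_eq0 a) ?(@pospart_eq0 b) ?(@pospart_eq0 m); try lra.
by rewrite mulr0 addr0 subr0 normr0.
Qed.

(** Discrete Leibniz rule: X times the second difference of A, plus A times that of X, plus two
    products of first differences. *)
Lemma sdiffM_le (A Ap Am X Xp Xm sa sx l y N Q : R) :
  0 <= A <= N -> 0 <= X <= Q -> `|Ap - A| <= l -> `|Am - A| <= l ->
  `|Xp - X| <= y -> `|Xm - X| <= y -> `|Ap + Am - 2 * A| <= sa ->
  `|Xp + Xm - 2 * X| <= sx ->
  `|Ap * Xp + Am * Xm - 2 * (A * X)| <= Q * sa + N * sx + 2 * (l * y).
Proof.
move=> /andP[A0 AN] /andP[X0 XQ] h1 h2 h3 h4 h5 h6.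
rewrite [X in `|X|](_ : _ = X * (Ap + Am - 2 * A) + A * (Xp + Xm - 2 * X) +
  ((Ap - A) * (Xp - X) + (Am - A) * (Xm - X))); last by ring.
apply: le_trans (ler_normD _ _) _; apply: lerD.
  apply: le_trans (ler_normD _ _) _; rewrite !normrM !(ger0_norm X0) !(ger0_norm A0).
  by apply: lerD; apply: ler_pM.
apply: le_trans (ler_normD _ _) _; rewrite !normrM mulr2n mulrDl !mul1r.
by apply: lerD; apply: ler_pM.
Qed.

End positive_part.

Section fatou.
Context d (T : measurableType d) (R : realType) (mu : {measure set T -> \bar R}).

Lemma fatou_le (F : nat -> T -> R) (G : T -> R) (C : R) :
  (forall k, measurable_fun setT (F k)) -> (forall k x, 0 <= F k x) ->
  (forall x, F k x @[k --> \oo] --> G x) ->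
  (forall k, \int[mu]_x (F k x)%:E <= C%:E)%E ->
  (\int[mu]_x (G x)%:E <= C%:E)%E.
Proof.
move=> mF F0 FG FC.
have H := @fatou _ _ _ mu setT measurableT (fun k x => (F k x)%:E)
  (fun k => (measurable_EFinP _ _).2 (mF k)) (fun k x _ => F0 k x).
apply: (@le_trans _ _ (\int[mu]_x (limn_einf (fun k => (F k x)%:E)))%E).
  rewrite le_eqVlt; apply/orP; left; apply/eqP; apply: eq_integral => x _.
  have /cvg_limn_einf_sup[-> _] : (F k x)%:E @[k --> \oo] --> (G x)%:E by apply: cvg_EFin; [exact: nearW|exact: FG].
  by [].
apply: le_trans H _.
apply: le_trans (limn_einf_sup _) _.
rewrite limn_esup_lim; apply: lime_le.
  exact: is_cvg_esups.
by apply: nearW => k; apply: ub_ereal_sup => _ [j _ <-].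
Qed.

End fatou.

Section sequences.
Variable R : realType.

Lemma cvgn_sum (I : Type) (s : seq I) (F : I -> nat -> R) (l : I -> R) :
  (forall i, F i k @[k --> \oo] --> l i) ->
  \sum_(i <- s) F i k @[k --> \oo] --> \sum_(i <- s) l i.
Proof.
move=> H; elim: s => [|i s IH].
  by under eq_fun do rewrite big_nil; rewrite big_nil; exact: cvg_cst.
by under eq_fun do rewrite big_cons; rewrite big_cons; apply: cvgD.
Qed.

Lemma cvgn_difference_quotient (q : R -> R) (l : R) (tau : nat -> R) :
  is_derive (0 : R) (1 : R) q l -> (forall k, tau k != 0) -> tau k @[k --> \oo] --> 0 ->
  (q (tau k) - q 0) / tau k @[k --> \oo] --> l.
Proof.
move=> [dq <-] tau0 tc.
have /cvgr_dnbhsP/(_ tau (conj tau0 tc)) : (fun h : R => h^-1 *: (q (h *: (1 : R) + 0) - q 0)) h @[h --> (0 : R)^'] --> 'D_1 q 0.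
  exact: dq.
apply: cvg_trans; apply: near_eq_cvg; apply: nearW => k /=.
by rewrite addr0 /GRing.scale /= mulr1 mulrC.
Qed.

End sequences.

(** Unit slope along a coordinate axis ([chart_shift]) controls slabs and vertical legs, [chart_lip]
    controls sideways moves, and [chart_sdiff] stands for bounded pure second derivatives, which is
    all that a discrete Laplacian sees. *)
Record chart (R : realType) (n : nat) (U : set 'rV[R]_n) (c : 'rV[R]_n)
    (R0 L C2 : R) (i : 'I_n) (b : bool) (rho : 'rV[R]_n -> R) : Prop := Chart {
  chart_R0 : 0 < R0;
  chart_L : 0 <= L;
  chart_C2 : 0 <= C2;
  chart_measurable : measurable_fun setT rho;
  chart_dom : forall x, `|x - c| < R0 -> (U x <-> 0 < rho x);
  chart_shift : forall x s, rho (x + s *: ((-1) ^+ b *: delta_mx 0 i)) = rho x + s;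
  chart_lip : forall x y, `|x - c| < R0 -> `|y - c| < R0 ->
    `|rho x - rho y| <= L * `|x - y|;
  chart_sdiff : forall j x t, 0 < t -> `|x - c| + t < R0 ->
    `|sdiff j t rho x| <= C2 * t ^+ 2 }.

(** * Second differences of the cutoff in L^1 *)

Section cutoff.
Variables (R : realType) (n : nat) (U : set 'rV[R]_n) (c : 'rV[R]_n).
Variables (R0 L C2 : R) (i : 'I_n) (b : bool) (rho : 'rV[R]_n -> R).
Hypothesis ch : chart U c R0 L C2 i b rho.
Local Notation mu := (lebesgue_rV R n).
Local Notation V := 'rV[R]_n.
Local Notation e j := (delta_mx 0 j : 'rV[R]_n).

Let R00 := chart_R0 ch.
Let L0 := chart_L ch.
Let C20 := chart_C2 ch.
Let r := R0 / 2.
Let r0 : 0 < r. Proof. by rewrite divr_gt0. Qed.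
Let rE : R0 = 2 * r. Proof. by rewrite /r mulrC divfK. Qed.

(** Positive exactly in the Euclidean ball of radius R0/2 about [c]; being quadratic, it has
    constant pure second differences -2 t^2. *)
Definition bowl (x : V) : R := (R0 / 2) ^+ 2 - \sum_k (x 0 k - c 0 k) ^+ 2.
(** The first factor is linear in [rho] since [rho] is the wanted weight. The second is squared to
    be C^{1,1}, so the only kink in the support is at rho = eps. *)
Definition cutoff eps (x : V) : R := pospart (rho x - eps) * pospart (bowl x) ^+ 2.

Lemma cutoff_ge0 eps x : 0 <= cutoff eps x.
Proof. by rewrite mulr_ge0 ?pospart_ge0// sqr_ge0. Qed.

Lemma bowl_gt0 x : 0 < bowl x -> `|x - c| <= R0 / 2.
Proof.
rewrite subr_gt0 => H; apply: rV_norm_le => [|k]; first exact: ltW.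
rewrite !mxE -(ler_pXn2r (_ : 0 < 2)%N) ?nnegrE ?(ltW r0)//.
rewrite real_normK ?num_real//; apply: le_trans (ltW H).
rewrite (bigD1 k)//= lerDl; apply: sumr_ge0 => l _; exact: sqr_ge0.
Qed.

Lemma cutoff_supp eps x : cutoff eps x != 0 -> `|x - c| <= R0 / 2 /\ eps < rho x.
Proof.
move=> H; split.
  apply: bowl_gt0; rewrite ltNge; apply: contra H => /pospart_eq0 E.
  by rewrite /cutoff E expr0n mulr0.
rewrite -subr_gt0 ltNge; apply: contra H => /pospart_eq0 E.
by rewrite /cutoff E mul0r.
Qed.

Lemma measurable_cutoff eps : measurable_fun setT (cutoff eps).
Proof.
have mp (F : V -> R) : measurable_fun setT F -> measurable_fun setT (fun x => pospart (F x)).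
  by move=> mF; apply: measurable_maxr => //; exact: measurable_cst.
apply: measurable_funM.
  by apply: mp; apply: measurable_funB => //; exact: (chart_measurable ch).
apply: measurable_funX; apply: mp; apply: measurable_funB => //.
apply: measurable_sum => k; apply: measurable_funX; apply: measurable_funB => //.
exact: (measurable_rV_coord k).
Qed.

Lemma bowl_shift x j t :
  bowl (x + t *: e j) = bowl x - 2 * t * (x 0 j - c 0 j) - t ^+ 2.
Proof.
have E : \sum_(k | k != j) ((x + t *: e j) 0 k - c 0 k) ^+ 2 =
    \sum_(k | k != j) (x 0 k - c 0 k) ^+ 2.
  by apply: eq_bigr => k kj; rewrite !mxE /= (negbTE kj) mulr0 addr0.
rewrite /bowl [in LHS](bigD1 j)//= [in RHS](bigD1 j)//= E !mxE !eqxx /= mulr1.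
by ring.
Qed.

Let bump (x : V) := pospart (bowl x) ^+ 2.

Lemma pospart_bowl_le x : pospart (bowl x) ^+ 2 <= R0 ^+ 4.
Proof.
rewrite (_ : R0 ^+ 4 = (R0 ^+ 2) ^+ 2); last by ring.
rewrite ler_pXn2r ?nnegrE ?pospart_ge0 ?exprn_ge0 ?(ltW R00)//.
rewrite /pospart ge_max exprn_ge0 ?(ltW R00)// andbT /bowl.
rewrite lerBlDr; apply: (@le_trans _ _ (R0 ^+ 2)).
  rewrite (_ : (R0 / 2) ^+ 2 = R0 ^+ 2 / 4); last by field.
  by have := sqr_ge0 R0; lra.
by rewrite lerDl; apply: sumr_ge0 => k _; exact: sqr_ge0.
Qed.

Let bump_bound x : 0 <= bump x <= R0 ^+ 4.
Proof. by rewrite sqr_ge0 pospart_bowl_le. Qed.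

Let pb_le x : pospart (bowl x) <= r ^+ 2.
Proof.
rewrite /pospart ge_max exprn_ge0 ?(ltW r0)// andbT /bowl lerBlDr lerDl.
by apply: sumr_ge0 => k _; exact: sqr_ge0.
Qed.

Let bowl_dev x j s : `|x - c| <= R0 -> `|s| <= R0 ->
  `|bowl (x + s *: e j) - bowl x| <= 3 * R0 * `|s|.
Proof.
move=> xc sR; rewrite bowl_shift (_ : _ - _ = - (s * (2 * (x 0 j - c 0 j) + s))); last by ring.
rewrite normrN normrM mulrC ler_wpM2r//.
apply: le_trans (ler_normD _ _) _; rewrite normrM (ger0_norm (ler0n _ 2)).
have := rV_coord_le (x - c) j; rewrite !mxE; lra.
Qed.

Let bump_dev x j s : `|x - c| <= R0 -> `|s| <= R0 ->
  `|bump (x + s *: e j) - bump x| <= 15 * R0 ^+ 3 * `|s|.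
Proof.
move=> xc sR; have H := bowl_dev j xc sR; rewrite /bump.
set A := bowl _ in H *; set B := bowl x in H *.
have T := pospart_sqr_taylor A B.
have := ler_normD (pospart A ^+ 2 - pospart B ^+ 2 - 2 * pospart B * (A - B)) (2 * pospart B * (A - B)).
rewrite subrK => /le_trans; apply.
have H2 : (A - B) ^+ 2 <= (3 * R0 * `|s|) ^+ 2.
  rewrite -[_ ^+ 2]real_normK ?num_real// ler_pXn2r ?nnegrE//.
  by rewrite !mulr_ge0// ltW.
have H3 : `|2 * pospart B * (A - B)| <= 2 * r ^+ 2 * (3 * R0 * `|s|).
  have pB := pospart_ge0 B.
  rewrite normrM (ger0_norm (mulr_ge0 (ler0n _ 2) pB)).
  apply: ler_pM => //; first exact: mulr_ge0.
  by rewrite ler_wpM2l//; exact: pb_le.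
have H4 : `|s| ^+ 2 <= R0 * `|s| by rewrite expr2 ler_wpM2r.
have H5 := ler_wpM2l (exprn_ge0 2 (ltW R00)) H4.
have H6 : (3 * R0 * `|s|) ^+ 2 = 9 * (R0 ^+ 2 * `|s| ^+ 2) by ring.
have H7 : 2 * r ^+ 2 * (3 * R0 * `|s|) = (3/2) * (R0 ^+ 3 * `|s|).
  by rewrite /r; field.
have H8 : R0 ^+ 2 * (R0 * `|s|) = R0 ^+ 3 * `|s| by ring.
have H9 : 0 <= R0 ^+ 3 * `|s| by rewrite mulr_ge0// exprn_ge0// ltW.
apply: le_trans (lerD (le_trans T H2) H3) _; rewrite H6 H7 -[leRHS]mulrA.
rewrite H8 in H5.
have aux (a1 a2 : R) : a1 <= a2 -> 0 <= a2 -> 9 * a1 + 3 / 2 * a2 <= 15 * a2 by lra.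
exact: aux.
Qed.

(** Taylor expansion of the squared positive part at both neighbours: the two remainders cost 9 each
    and the second difference of [bowl] costs 1, rounded up to 22. *)
Let bump_sdiff x j t : 0 < t <= R0 -> `|x - c| <= R0 ->
  `|sdiff j t bump x| <= 22 * R0 ^+ 2 * t ^+ 2.
Proof.
move=> /andP[t0 tR] xc.
have tn : `|t| <= R0 by rewrite gtr0_norm.
have tn' : `|- t| <= R0 by rewrite normrN.
have Hp := bowl_dev j xc tn; have Hm := bowl_dev j xc tn'.
rewrite normrN (gtr0_norm t0) in Hm; rewrite (gtr0_norm t0) in Hp.
rewrite /sdiff -scaleNr /bump.
have S : bowl (x + t *: e j) + bowl (x + (- t) *: e j) - 2 * bowl x = - (2 * t ^+ 2).
  by rewrite !bowl_shift; ring.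
set A := bowl (x + t *: _) in Hp S *; set A' := bowl (x + (- t) *: _) in Hm S *.
set B := bowl x in Hp Hm S *.
have T := pospart_sqr_taylor A B; have T' := pospart_sqr_taylor A' B.
rewrite [X in `|X|](_ : _ = (pospart A ^+ 2 - pospart B ^+ 2 - 2 * pospart B * (A - B)) +
  (pospart A' ^+ 2 - pospart B ^+ 2 - 2 * pospart B * (A' - B)) +
  2 * pospart B * (A + A' - 2 * B)); last by ring.
have sq a : `|a| <= 3 * R0 * t -> a ^+ 2 <= 9 * (R0 ^+ 2 * t ^+ 2).
  move=> Ha; rewrite (_ : 9 * _ = (3 * R0 * t) ^+ 2); last by ring.
  by rewrite -[a ^+ 2]real_normK ?num_real// ler_pXn2r ?nnegrE// !mulr_ge0// ltW.
have := sq _ Hp; have := sq _ Hm => s1 s2.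
have H3 : `|2 * pospart B * (A + A' - 2 * B)| <= R0 ^+ 2 * t ^+ 2.
  have pB := pospart_ge0 B; have t2 := sqr_ge0 t.
  rewrite S normrM normrN (ger0_norm (mulr_ge0 (ler0n _ 2) pB)).
  rewrite (ger0_norm (mulr_ge0 (ler0n _ 2) t2)).
  rewrite (_ : R0 ^+ 2 = 4 * r ^+ 2); last by rewrite rE; ring.
  rewrite [leLHS](_ : _ = 4 * (pospart B * t ^+ 2)); last by ring.
  by rewrite -mulrA ler_wpM2l// ler_wpM2r//; exact: pb_le.
apply: le_trans (ler_normD _ _) _; apply: le_trans (lerD (ler_normD _ _) (lexx _)) _.
apply: le_trans (lerD (lerD (le_trans T s2) (le_trans T' s1)) H3) _.
rewrite -[leRHS]mulrA.
have : 0 <= R0 ^+ 2 * t ^+ 2 by apply: mulr_ge0; exact: sqr_ge0.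
generalize (R0 ^+ 2 * t ^+ 2) => a1; lra.
Qed.

Let N : R := `|rho c| + L * R0.

Lemma pospart_rho_le x eps : 0 <= eps -> `|x - c| < R0 ->
  pospart (rho x - eps) <= `|rho c| + L * R0.
Proof.
move=> e0 xc; rewrite /pospart ge_max.
have := chart_lip ch xc (_ : `|c - c| < R0); rewrite subrr normr0 => /(_ R00).
have := ler_wpM2l L0 (ltW xc); have N0 := mulr_ge0 L0 (ltW R00).
have := ler_norm (rho c); have := ler_norm (rho x - rho c); have := normr_ge0 (rho c).
by move=> *; apply/andP; split; lra.
Qed.

Let rho_le x eps : 0 <= eps -> `|x - c| < R0 -> 0 <= pospart (rho x - eps) <= N.
Proof. by move=> e0 xc; rewrite pospart_ge0 pospart_rho_le. Qed.

Let slab eps t : set V := [set x | `|x - c| <= 3 / 4 * R0] `&` [set x | `|rho x - eps| <= L * t].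

(** Coefficient of t^2 in the discrete Leibniz rule: R0^4 bounds [bump], [N] bounds the height
    factor, and 30 L R0^3 is twice the product of the first-difference bounds L and 15 R0^3. *)
Let D : R := R0 ^+ 4 * C2 + 22 * N * R0 ^+ 2 + 30 * L * R0 ^+ 3.

(** Outside the slab |rho - eps| <= L t the positive part is affine on the three points involved,
    and everything is of order t^2; inside, the kink costs order t. *)
Let cutoff_sdiff_le eps j t x : 0 <= eps -> 0 < t <= R0 / 8 ->
  `|sdiff j t (cutoff eps) x| <=
    D * t ^+ 2 * \1_[set x | `|x - c| <= 3 / 4 * R0] x +
    2 * L * R0 ^+ 4 * t * \1_(slab eps t) x.
Proof.
move=> eps0 /andP[t0 tR].
have tN : t <= R0 by have := R00; lra.
(* The support lies within R0/2 of [c] and t <= R0/8, so all three values vanish outside radius 3/4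
   R0. *)
have [xB|xB] := pselect (`|x - c| <= 3 / 4 * R0); last first.
  rewrite (indic_notin _ (xB : ~ [set x | `|x - c| <= 3 / 4 * R0] x)).
  rewrite (@indic_notin _ _ _ (slab eps t)); last by case.
  rewrite !mulr0 addr0 normr_le0 /sdiff.
  have far s : `|s| <= t -> cutoff eps (x + s *: e j) = 0.
    move=> st; apply/eqP; apply/negPn; apply/negP => /cutoff_supp[H _]; apply: xB.
    have := ler_normB (x + s *: e j - c) (s *: e j).
    rewrite addrAC addrK; have := rV_delta_norm j s; lra.
  have := far t; rewrite gtr0_norm// lexx => /(_ isT) ->.
  have := far (- t); rewrite normrN gtr0_norm// lexx scaleNr => /(_ isT) ->.
  by have := far 0; rewrite normr0 scale0r addr0 (ltW t0) => /(_ isT) ->; rewrite mulr0 addr0 subr0.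
rewrite (indic_in _ (xB : [set x | `|x - c| <= 3 / 4 * R0] x)) mulr1.
have xR : `|x - c| < R0 by have := R00; lra.
have near s : `|s| <= t -> `|x + s *: e j - c| < R0 /\ `|rho (x + s *: e j) - eps - (rho x - eps)| <= L * t.
  move=> st; have sR := rV_delta_norm j s.
  have in1 : `|x + s *: e j - c| < R0.
    by rewrite addrAC; apply: le_lt_trans (ler_normD _ _) _; have := R00; lra.
  split => //; rewrite opprB addrA subrK.
  apply: le_trans (chart_lip ch in1 xR) _; rewrite ler_wpM2l// addrC addKr; lra.
have tt : `|t| <= t by rewrite gtr0_norm.
have tt' : `|- t| <= t by rewrite normrN gtr0_norm.
have [p1 p2] := near t tt; have [m1 m2] := near (- t) tt'.
rewrite scaleNr in m1 m2.
have S := pospart_sdiff p2 m2.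
have S2 : `|pospart (rho (x + t *: e j) - eps) + pospart (rho (x - t *: e j) - eps) - 2 * pospart (rho x - eps)| <=
    C2 * t ^+ 2 + 2 * L * t * \1_(slab eps t) x.
  apply: le_trans S _; apply: lerD.
    rewrite [X in `|X|](_ : _ = sdiff j t rho x); last by rewrite /sdiff; ring.
    by apply: (chart_sdiff ch) => //; have := R00; lra.
  case: ifPn => H; first by rewrite indic_in ?mulr1 ?mulrA.
  by rewrite !mulr_ge0// ltW.
have B1 := bump_sdiff j (_ : 0 < t <= R0) (ltW xR); rewrite t0 tN in B1.
have B2 := @bump_dev x j t (ltW xR); rewrite gtr0_norm// in B2.
have B3 := @bump_dev x j (- t) (ltW xR); rewrite normrN gtr0_norm// scaleNr in B3.
have := sdiffM_le (rho_le eps0 xR) (bump_bound x)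
  (le_trans (pospart_lip _ _) p2) (le_trans (pospart_lip _ _) m2) (B2 tN) (B3 tN) S2 (B1 isT).
move=> /le_trans; apply; rewrite le_eqVlt; apply/orP; left; apply/eqP.
by rewrite /D; ring.
Qed.

(** The order-t term lives on a slab whose measure is of order t by [slab_le], so the total is of
    order t^2, uniformly in [eps]: the Laplacian of the cutoff is bounded in L^1. *)
Lemma cutoff_sdiff : exists2 C : R, 0 <= C & forall eps j t, 0 <= eps -> 0 < t <= R0 / 8 ->
  (\int[mu]_x (`|sdiff j t (cutoff eps) x|)%:E <= (C * t ^+ 2)%:E)%E.
Proof.
have N0 : 0 <= N by rewrite /N addr_ge0// mulr_ge0// ltW.
have R0X k : 0 <= R0 ^+ k by rewrite exprn_ge0// ltW.
have D0 : 0 <= D.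
  apply: addr_ge0; first apply: addr_ge0; apply: mulr_ge0 => //.
  - exact: mulr_ge0.
  - exact: mulr_ge0.
pose s := 3 / 4 * R0.
have s0 : 0 <= s by rewrite /s; have := R00; lra.
exists (D * (2 * s) ^+ n + 4 * L ^+ 2 * R0 ^+ 4 * (2 * (s + 1)) ^+ n).
  apply: addr_ge0; first by rewrite mulr_ge0// exprn_ge0// mulr_ge0.
  apply: mulr_ge0; last by rewrite exprn_ge0// mulr_ge0// addr_ge0.
  by apply: mulr_ge0 => //; apply: mulr_ge0 => //; exact: sqr_ge0.
move=> eps j t eps0 tR; have /andP[t0 _] := tR.
have e1 : `|((-1) ^+ b *: e i : V)| <= 1.
  by apply: le_trans (rV_delta_norm _ _) _; rewrite normr_sign.
have mB : measurable [set x : V | `|x - c| <= s] by exact: measurable_cball.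
have mS : measurable (slab eps t).
  by apply: measurableI => //; exact: (measurable_slab (chart_measurable ch)).
have msd : measurable_fun setT (sdiff j t (cutoff eps)).
  apply: measurable_funB; last by apply: measurable_funM => //; exact: measurable_cutoff.
  by apply: measurable_funD; apply: (measurableT_comp (measurable_cutoff eps)); exact: rV_shift.
have a0 : 0 <= D * t ^+ 2 by rewrite mulr_ge0// sqr_ge0.
have b0 : 0 <= 2 * L * R0 ^+ 4 * t by rewrite !mulr_ge0// ltW.
apply: (@le_trans _ _ (\int[mu]_x (D * t ^+ 2 * \1_[set x : V | (`|x - c| <= s)%R] x +
    2 * L * R0 ^+ 4 * t * \1_(slab eps t) x)%:E)%E).
  apply: le_integralR; first exact: measurableT_comp.
    by apply: measurable_funD; apply: measurable_funM => //; exact: measurable_indic.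
  by move=> x; rewrite normr_ge0/=; exact: cutoff_sdiff_le.
under eq_integral do rewrite EFinD.
rewrite ge0_integralD//; last 4 first.
- by move=> x _; rewrite lee_fin mulr_ge0.
- by apply/measurable_EFinP; apply: measurable_funM => //; exact: measurable_indic.
- by move=> x _; rewrite lee_fin mulr_ge0.
- by apply/measurable_EFinP; apply: measurable_funM => //; exact: measurable_indic.
rewrite integralRZl//; rewrite integralRZl//.
rewrite integralR_indic// integralR_indic//.
have LT : 0 <= L * t by rewrite mulr_ge0// ltW.
have sl := slab_le (chart_measurable ch) e1 (chart_shift ch) c eps s0 LT.
rewrite (mulrDl (D * _)) EFinD; apply: leeD.
  rewrite [X in (_ * X)%E](_ : _ = ((2 * s) ^+ n)%:E); last exact: lebesgue_rV_ball.
  by rewrite -EFinM lee_fin mulrAC.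
apply: (le_trans (lee_wpmul2l _ sl)); first by rewrite lee_fin.
rewrite -EFinM lee_fin le_eqVlt; apply/orP; left; apply/eqP; ring.
Qed.

End cutoff.

(** * The Laplacian of u^2 tested against the cutoff *)

Section energy.
Variables (R : realType) (n : nat) (U : set 'rV[R]_n) (u : 'rV[R]_n -> R) (M : R).
Hypotheses (oU : open U) (hu : harmonic_in U u) (M0 : 0 < M).
Hypothesis uM : forall x, U x -> `|u x| <= M.
Variables (c : 'rV[R]_n) (R0 L C2 : R) (i : 'I_n) (b : bool) (rho : 'rV[R]_n -> R).
Hypothesis ch : chart U c R0 L C2 i b rho.
Local Notation mu := (lebesgue_rV R n).
Local Notation V := 'rV[R]_n.
Local Notation e j := (delta_mx 0 j : 'rV[R]_n).
Local Notation g j := ((partial j u) \_ U).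
Local Notation cutoff := (cutoff c R0 rho).

Let R00 := chart_R0 ch.
Let L0 := chart_L ch.
Let C1 : classC 1 U u := classCW (isT : (1 <= 2)%N) hu.1.
Let v : V -> R := (fun x => u x ^+ 2) \_ U.
Let grad2 (x : V) := \sum_j g j x ^+ 2.

Let vE x : v x = (u \_ U) x ^+ 2.
Proof. by rewrite /v !patchE; case: ifP => // _; rewrite expr0n. Qed.

Let mv : measurable_fun setT v.
Proof.
rewrite (_ : v = fun x => (u \_ U) x ^+ 2); last by apply/funext.
by apply: measurable_funX; exact: measurable_f0.
Qed.

Let v_bound x : 0 <= v x <= M ^+ 2.
Proof.
rewrite vE sqr_ge0 /= patchE; case: ifPn => [|_]; last by rewrite expr0n sqr_ge0.
rewrite inE => Ux; rewrite -[leLHS]real_normK ?num_real// ler_pXn2r ?nnegrE ?(ltW M0)//.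
exact: uM.
Qed.

Let mcut eps : measurable_fun setT (cutoff eps).
Proof. exact: (measurable_cutoff ch). Qed.

Let cut0 eps x : 0 <= cutoff eps x. Proof. exact: cutoff_ge0. Qed.

Let msum j t (w : V -> R) : measurable_fun setT w ->
  measurable_fun setT (fun x : V => w (x + t *: e j) + w (x - t *: e j)).
Proof.
by move=> mw; apply: measurable_funD; apply: (measurableT_comp mw); exact: rV_shift.
Qed.

(** Discrete integration by parts: translating by h moves the shift from [v] to the cutoff, and the
    symmetric sum is unchanged under h -> -h. *)
Let swap eps j t :
  (\int[mu]_x (cutoff eps x * (v (x + t *: e j) + v (x - t *: e j)))%:E =
   \int[mu]_x (v x * (cutoff eps (x + t *: e j) + cutoff eps (x - t *: e j)))%:E)%E.
Proof.
have v0 x : 0 <= v x by have /andP[] := v_bound x.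
have one (h : V) : (\int[mu]_x (cutoff eps x * v (x + h))%:E =
    \int[mu]_x (v x * cutoff eps (x - h))%:E)%E.
  rewrite -(integral_rV_shift (n := n) h (f := fun x => (v x * cutoff eps (x - h))%:E)).
  - by apply: eq_integral => x _; rewrite addrK mulrC.
  - by apply/measurable_EFinP; apply: measurable_funM => //; apply: (measurableT_comp (mcut eps)); exact: rV_shift.
  - by move=> x; rewrite lee_fin mulr_ge0.
have mF (h : V) : measurable_fun setT (fun x => (cutoff eps x * v (x + h))%:E).
  by apply/measurable_EFinP; apply: measurable_funM => //; apply: (measurableT_comp mv); exact: rV_shift.
have mG (h : V) : measurable_fun setT (fun x => (v x * cutoff eps (x + h))%:E).
  by apply/measurable_EFinP; apply: measurable_funM => //; apply: (measurableT_comp (mcut eps)); exact: rV_shift.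
under eq_integral do rewrite mulrDr EFinD.
rewrite ge0_integralD//; last 2 first.
- by move=> x _; rewrite lee_fin mulr_ge0.
- by move=> x _; rewrite lee_fin mulr_ge0.
under [RHS]eq_integral do rewrite mulrDr EFinD.
rewrite ge0_integralD//; last 2 first.
- by move=> x _; rewrite lee_fin mulr_ge0.
- by move=> x _; rewrite lee_fin mulr_ge0.
by rewrite one (one (- (t *: e j))) opprK addeC.
Qed.

Let finite_cut eps : 0 <= eps -> exists2 C : R, 0 <= C & (\int[mu]_x (cutoff eps x)%:E = C%:E)%E.
Proof.
move=> eps0.
suff fin : (\int[mu]_x (cutoff eps x)%:E < +oo)%E.
  exists (fine (\int[mu]_x (cutoff eps x)%:E)).
    by apply: fine_ge0; apply: integral_ge0 => x _; rewrite lee_fin.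
  by rewrite fineK// ge0_fin_numE// integral_ge0// => x _; rewrite lee_fin.
pose N : R := (`|rho c| + L * R0) * R0 ^+ 4.
have N0 : 0 <= N by rewrite mulr_ge0 ?addr_ge0 ?mulr_ge0 ?exprn_ge0// ltW.
have r0 : 0 <= R0 / 2 by rewrite divr_ge0// ltW.
apply: (@le_lt_trans _ _ (\int[mu]_x (N * \1_[set x : V | (`|x - c| <= R0 / 2)%R] x)%:E)%E).
  apply: le_integralR => //.
    by apply: measurable_funM => //; apply: measurable_indic; exact: measurable_cball.
  move=> x; rewrite cut0/=.
  have [->|/(cutoff_supp ch)[xc rx]] := eqVneq (cutoff eps x) 0; first by rewrite mulr_ge0.
  rewrite (indic_in _ (xc : [set x : V | `|x - c| <= R0 / 2] x)) mulr1.
  have xR : `|x - c| < R0 by have := R00; lra.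
  apply: ler_pM; rewrite ?pospart_ge0 ?sqr_ge0//.
    exact: (pospart_rho_le ch).
  exact: (pospart_bowl_le ch).
rewrite integralRZl//; last by apply: measurable_indic; exact: measurable_cball.
rewrite integralR_indic; last exact: measurable_cball.
rewrite [X in (_ * X)%E](_ : _ = ((2 * (R0 / 2)) ^+ n)%:E); last exact: lebesgue_rV_ball.
by rewrite -EFinM ltry.
Qed.

Let mgrad : measurable_fun setT grad2.
Proof. by apply: measurable_sum => j; apply: measurable_funX; exact: measurable_g. Qed.

Let grad20 x : 0 <= grad2 x.
Proof. by apply: sumr_ge0 => j _; exact: sqr_ge0. Qed.

(** On the support [rho > eps], and [rho] is Lipschitz, so it stays positive within a distance that
    depends only on [eps] and the chart. *)
Let support_margin eps : 0 < eps -> exists2 d, 0 < d & forall x, cutoff eps x != 0 ->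
  forall y, `|y - x| <= d -> U y.
Proof.
move=> eps0; have L1 : 0 < L + 1 by rewrite ltr_wpDl.
exists (Num.min (R0 / 4) (eps / (2 * (L + 1)))).
  by rewrite lt_min !divr_gt0// mulr_gt0.
move=> x /(cutoff_supp ch)[xc rx] y; rewrite le_min => /andP[y1 y2].
have xR : `|x - c| < R0 by have := R00; lra.
have yR : `|y - c| < R0.
  rewrite -(subrK x y) -addrA; apply: le_lt_trans (ler_normD _ _) _; have := R00; lra.
apply/(chart_dom ch) => //.
have := chart_lip ch yR xR; rewrite ler_norml => /andP[H _].
have H2 : L * `|y - x| <= eps / 2.
  apply: le_trans (ler_wpM2l L0 y2) _.
  rewrite mulrCA ler_pM2l// ler_pdivrMr ?mulr_gt0// mulrC -mulrA; have := L0; lra.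
have := eps0; lra.
Qed.

(** The quotients of [dlap] of u^2 by tau^2 tend to 2 |grad u|^2. Fatou needs a lower bound, so a
    constant [B] is added and its contribution subtracted at the end; [B] depends on [eps], the
    resulting bound does not. *)
Let cutoff_energy : exists2 C : R, 0 <= C & forall eps, 0 < eps ->
  (\int[mu]_x (cutoff eps x * grad2 x)%:E <= C%:E)%E.
Proof.
have [Cc Cc0 HC] := cutoff_sdiff ch.
exists (n%:R * (M ^+ 2 * Cc)); first by rewrite mulr_ge0// mulr_ge0// sqr_ge0.
move=> eps eps0; have [d d0 Hd] := support_margin eps0.
pose B2 : R := 16 * n.+1%:R ^+ 2 * (2 * M) / (d / 2) ^+ 2.
have B20 : 0 <= B2.
  by rewrite divr_ge0 ?sqr_ge0// mulr_ge0 ?mulr_ge0 ?sqr_ge0// ltW.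
(* In each direction the second difference of u^2 is two squares plus 2 u times that of u. The last
   term exceeds -2 M [B2] tau^2, with [B2] the interior bound on cubes of radius d/2. *)
pose B : R := n%:R * (2 * M * B2).
have B0 : 0 <= B by rewrite mulr_ge0// mulr_ge0// mulr_ge0// ltW.
have inU x t : cutoff eps x != 0 -> `|t| <= d -> forall j, U (x + t *: e j).
  move=> cx td j; apply: (Hd x cx); rewrite addrC addKr.
  exact: le_trans (rV_delta_norm _ _) td.
have supU x : cutoff eps x != 0 -> U x.
  by move=> cx; have := inU x 0 cx _ i; rewrite scale0r addr0 normr0; apply; exact: ltW.
have vin y : U y -> v y = u y ^+ 2 by move=> Uy; rewrite /v patchE mem_set.
have sdB x t j : cutoff eps x != 0 -> 0 < t <= d / 2 -> `|sdiff j t u x| <= t ^+ 2 * B2.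
  move=> cx /andP[t0 td].
  have sU s : `|s| <= t -> U (x + s *: e j).
    by move=> st; apply: inU => //; have := d0; lra.
  have [xi xit ->] := classC_sdiff hu.1 t0 sU.
  rewrite normrM ger0_norm ?sqr_ge0// ler_wpM2l ?sqr_ge0//.
  have cubeU y : `|y - (x + xi *: e j)| <= d / 2 -> U y.
    move=> yx; apply: (Hd x cx).
    have -> : y - x = (y - (x + xi *: e j)) + xi *: e j by rewrite opprD addrA subrK.
    apply: le_trans (ler_normD _ _) _; have := rV_delta_norm j xi; lra.
  have osc y z : `|y - (x + xi *: e j)| <= d / 2 -> `|z - (x + xi *: e j)| <= d / 2 ->
      `|u y - u z| <= 2 * M.
    move=> yx zx; apply: le_trans (ler_normB _ _) _.
    by have := uM (cubeU _ yx); have := uM (cubeU _ zx); lra.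
  have d20 : 0 < d / 2 by rewrite divr_gt0.
  exact: (@partial2_bound R n j j U u _ (d / 2) (2 * M) oU hu d20 cubeU osc).
pose tau k : R := Num.min (d / 2) (R0 / 8) * 2^-1 ^+ k.
have mn0 : 0 < Num.min (d / 2) (R0 / 8) by rewrite lt_min !divr_gt0.
have tau0 k : 0 < tau k by rewrite mulr_gt0// exprn_gt0.
have tau_le k : tau k <= Num.min (d / 2) (R0 / 8).
  by rewrite ler_piMr ?(ltW mn0)// exprn_ile1// invf_le1// ler1n.
have taud k : tau k <= d / 2 by have := tau_le k; rewrite le_min => /andP[].
have tauR k : tau k <= R0 / 8 by have := tau_le k; rewrite le_min => /andP[].
have tau_cvg : tau @ \oo --> 0.
  by apply: cvg_geometric; rewrite ger0_norm// invf_lt1// ltr1n.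
pose F k (x : V) := cutoff eps x * (\sum_j sdiff j (tau k) v x / tau k ^+ 2 + B).
have sdv x k j : cutoff eps x != 0 -> sdiff j (tau k) v x =
    (u (x + tau k *: e j) - u x) ^+ 2 + (u (x - tau k *: e j) - u x) ^+ 2 +
    2 * u x * sdiff j (tau k) u x.
  move=> cx.
  have tk : `|tau k| <= d by rewrite gtr0_norm//; have := taud k; have := d0; lra.
  have U1 := inU x (tau k) cx tk j.
  have U2 : U (x - tau k *: e j) by rewrite -scaleNr; apply: inU; rewrite ?normrN.
  rewrite /sdiff (vin _ U1) (vin _ U2) (vin _ (supU x cx)); ring.
have mF k : measurable_fun setT (F k).
  apply: measurable_funM => //; apply: measurable_funD => //.
  apply: measurable_sum => j; apply: measurable_funM => //.
  by apply: measurable_funB; [exact: msum|exact: measurable_funM].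
have F0 k x : 0 <= F k x.
  rewrite /F; have [->|cx] := eqVneq (cutoff eps x) 0; first by rewrite mul0r.
  have Ux := supU x cx.
  apply: mulr_ge0 => //.
  have H j : - (2 * M * B2) <= sdiff j (tau k) v x / tau k ^+ 2.
    rewrite ler_pdivlMr ?exprn_gt0// sdv//.
    have := sdB x (tau k) j cx; rewrite tau0 taud => /(_ isT) H1.
    have H2 : `|2 * u x * sdiff j (tau k) u x| <= 2 * M * (tau k ^+ 2 * B2).
      rewrite normrM normrM (ger0_norm (ler0n _ 2)); apply: ler_pM => //.
      by rewrite ler_wpM2l//; exact: uM.
    move: H2; rewrite ler_norml => /andP[H2 _].
    have := sqr_ge0 (u (x + tau k *: e j) - u x).
    have := sqr_ge0 (u (x - tau k *: e j) - u x).
    rewrite (_ : - (2 * M * B2) * tau k ^+ 2 = - (2 * M * (tau k ^+ 2 * B2))); last by ring.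
    lra.
  have : \sum_(j < n) - (2 * M * B2) <= \sum_j sdiff j (tau k) v x / tau k ^+ 2.
    by apply: ler_sum => j _; exact: H.
  by rewrite sumr_const card_ord -[leLHS]mulr_natl mulrN -/B; lra.
have F_cvg x : F k x @[k --> \oo] --> cutoff eps x * (2 * grad2 x + B).
  rewrite /F; have [->|cx] := eqVneq (cutoff eps x) 0.
    by under eq_fun do rewrite mul0r; rewrite mul0r; exact: cvg_cst.
  have Ux := supU x cx.
  apply: cvgM; first exact: cvg_cst.
  apply: cvgD; last exact: cvg_cst.
  have gE j : g j x = partial j u x by rewrite patchE mem_set.
  have dqp j : (u (x + tau k *: e j) - u x) / tau k @[k --> \oo] --> partial j u x.
    have := cvgn_difference_quotient (classC_is_derive0 j C1 Ux) (fun k => lt0r_neq0 (tau0 k)) tau_cvg.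
    by under eq_fun do rewrite scale0r addr0.
  have dqm j : (u (x - tau k *: e j) - u x) / tau k @[k --> \oo] --> - partial j u x.
    have := cvgn_difference_quotient (classC_is_derive0N j C1 Ux) (fun k => lt0r_neq0 (tau0 k)) tau_cvg.
    by under eq_fun do rewrite scale0r subr0.
  (* The terms containing second differences of u are summed over j before passing to the limit, so
     that harmonicity applies. *)
  have lap : (\sum_j sdiff j (tau k) u x) / tau k ^+ 2 @[k --> \oo] --> (0 : R).
    apply/cvgrPdist_le => e1 e10; have [t1 t10 H1] := harmonic_dharmonic oU hu Ux e10.
    move/cvgrPdist_lt : tau_cvg => /(_ _ t10); apply: filterS => k.
    rewrite !sub0r !normrN (gtr0_norm (tau0 k)) => tk.
    rewrite normrM normfV (gtr0_norm (exprn_gt0 2 (tau0 k))).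
    rewrite ler_pdivrMr ?exprn_gt0//; apply: H1; by rewrite tau0.
  have split k : \sum_j sdiff j (tau k) v x / tau k ^+ 2 =
      \sum_j (((u (x + tau k *: e j) - u x) / tau k) * ((u (x + tau k *: e j) - u x) / tau k) +
        ((u (x - tau k *: e j) - u x) / tau k) * ((u (x - tau k *: e j) - u x) / tau k)) +
      2 * u x * ((\sum_j sdiff j (tau k) u x) / tau k ^+ 2).
    rewrite mulrA mulr_sumr mulr_suml -big_split /=; apply: eq_bigr => j _.
    by rewrite sdv//; field; exact: lt0r_neq0.
  have gS : 2 * grad2 x = \sum_j (partial j u x * partial j u x +
      (- partial j u x) * (- partial j u x)) + 2 * u x * 0.
    rewrite mulr0 addr0 /grad2 mulr_sumr; apply: eq_bigr => j _; rewrite gE; ring.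
  rewrite gS; under eq_fun do rewrite split.
  apply: cvgD; last by apply: cvgM => //; exact: cvg_cst.
  by apply: cvgn_sum => j; apply: cvgD; apply: cvgM.
have [Cf Cf0 HCf] := finite_cut (ltW eps0).
have main k : (\int[mu]_x (F k x)%:E <= (n%:R * (M ^+ 2 * Cc))%:E + B%:E * \int[mu]_x (cutoff eps x)%:E)%E.
  set t := tau k; have t0 : 0 < t by exact: tau0.
  have v0 x : 0 <= v x by have /andP[] := v_bound x.
  have [I I0 HI] : exists2 I : R, 0 <= I & (\int[mu]_x (cutoff eps x * v x)%:E = I%:E)%E.
    have ge0 : (0 <= \int[mu]_x (cutoff eps x * v x)%:E)%E.
      by apply: integral_ge0 => x _; rewrite lee_fin mulr_ge0.
    have fin : (\int[mu]_x (cutoff eps x * v x)%:E < +oo)%E.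
      apply: (@le_lt_trans _ _ (\int[mu]_x (M ^+ 2 * cutoff eps x)%:E)%E); last first.
        by rewrite integralRZl ?sqr_ge0// HCf -EFinM ltry.
      apply: le_integralR; [exact: measurable_funM|exact: measurable_funM|].
      move=> x; rewrite mulr_ge0//= mulrC ler_wpM2r//; by have /andP[] := v_bound x.
    exists (fine (\int[mu]_x (cutoff eps x * v x)%:E)); first exact: fine_ge0.
    by rewrite fineK// ge0_fin_numE.
  have mp j : measurable_fun setT (fun x => cutoff eps x * (v (x + t *: e j) + v (x - t *: e j))).
    by apply: measurable_funM => //; exact: msum.
  have p0 j x : 0 <= cutoff eps x * (v (x + t *: e j) + v (x - t *: e j)).
    by rewrite mulr_ge0// addr_ge0.
  have Bt0 : 0 <= B * t ^+ 2 by rewrite mulr_ge0// sqr_ge0.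
  have t20 : 0 <= t ^+ 2 by exact: sqr_ge0.
  have n20 : 0 <= 2 * n%:R :> R by rewrite mulr_ge0.
  (* The term -2 n cutoff v is moved to the left, so that only integrals of nonnegative functions
     are split. *)
  have id1 : ((t ^+ 2)%:E * \int[mu]_x (F k x)%:E + (2 * n%:R * I)%:E =
      \sum_j \int[mu]_x (cutoff eps x * (v (x + t *: e j) + v (x - t *: e j)))%:E + (B * t ^+ 2 * Cf)%:E)%E.
    rewrite (EFinM (2 * _)) -HI (EFinM (B * _)) -HCf -!integralRZl//; last 2 first.
    - exact: measurable_funM.
    - by move=> x; rewrite mulr_ge0.
    rewrite -integralR_sum// -!ge0_integralD//; last 8 first.
    - by move=> x _; rewrite lee_fin mulr_ge0.
    - by apply/measurable_EFinP; exact: measurable_funM.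
    - by move=> x _; rewrite lee_fin mulr_ge0// mulr_ge0.
    - by apply/measurable_EFinP; apply: measurable_funM => //; exact: measurable_funM.
    - by move=> x _; rewrite lee_fin; apply: sumr_ge0.
    - by apply/measurable_EFinP; exact: measurable_sum.
    - by move=> x _; rewrite lee_fin mulr_ge0.
    - by apply/measurable_EFinP; exact: measurable_funM.
    apply: eq_integral => x _; rewrite -!EFinD; congr (_%:E).
    rewrite /F -/t -mulr_sumr -mulr_suml.
    have -> : \sum_j sdiff j t v x = \sum_j (v (x + t *: e j) + v (x - t *: e j)) - 2 * n%:R * v x.
      rewrite /sdiff sumrB sumr_const card_ord -[X in _ - X = _]mulr_natl; congr (_ - _); ring.
    by field; exact: lt0r_neq0.
  (* After [swap] the second difference falls on the cutoff and is paid by [cutoff_sdiff]; the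
     remaining 2 I in each direction cancels against 2 n I in [id1]. *)
  have le1 : (\sum_j \int[mu]_x (cutoff eps x * (v (x + t *: e j) + v (x - t *: e j)))%:E <=
      (n%:R * (M ^+ 2 * (Cc * t ^+ 2) + 2 * I))%:E)%E.
    apply: (@le_trans _ _ (\sum_(j < n) (M ^+ 2 * (Cc * t ^+ 2) + 2 * I)%:E)%E); last first.
      by rewrite sumEFin sumr_const card_ord -[_ *+ n]mulr_natl.
    apply: lee_sum => j _; rewrite swap.
    have ms : measurable_fun setT (fun x => `|sdiff j t (cutoff eps) x|).
      apply: measurableT_comp => //; apply: measurable_funB; first exact: msum.
      exact: measurable_funM.
    apply: (@le_trans _ _ (\int[mu]_x (M ^+ 2 * `|sdiff j t (cutoff eps) x| + 2 * (cutoff eps x * v x))%:E)%E).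
      apply: le_integralR.
      - by apply: measurable_funM => //; exact: msum.
      - by apply: measurable_funD; apply: measurable_funM => //; exact: measurable_funM.
      move=> x; rewrite mulr_ge0 ?addr_ge0//=.
      have -> : cutoff eps (x + t *: e j) + cutoff eps (x - t *: e j) =
          sdiff j t (cutoff eps) x + 2 * cutoff eps x by rewrite /sdiff; ring.
      rewrite mulrDr; apply: lerD; last by rewrite le_eqVlt; apply/orP; left; apply/eqP; ring.
      apply: (@le_trans _ _ (v x * `|sdiff j t (cutoff eps) x|)); first by rewrite ler_wpM2l// ler_norm.
      by rewrite ler_wpM2r//; have /andP[] := v_bound x.
    under eq_integral do rewrite EFinD.
    rewrite ge0_integralD//; last 4 first.
    - by move=> x _; rewrite lee_fin mulr_ge0// sqr_ge0.
    - by apply/measurable_EFinP; exact: measurable_funM.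
    - by move=> x _; rewrite lee_fin mulr_ge0// mulr_ge0.
    - by apply/measurable_EFinP; apply: measurable_funM => //; exact: measurable_funM.
    rewrite integralRZl ?sqr_ge0// integralRZl//; [|exact: measurable_funM|by move=> x; exact: mulr_ge0].
    rewrite HI (EFinD (M ^+ 2 * _)) (EFinM (M ^+ 2) (Cc * t ^+ 2)) (EFinM 2 I); apply: leeD => //.
    apply: lee_wpmul2l; first by rewrite lee_fin sqr_ge0.
    by apply: HC; rewrite ?(ltW eps0)// t0 tauR.
  have FI0 : (0 <= \int[mu]_x (F k x)%:E)%E by apply: integral_ge0 => x _; rewrite lee_fin.
  have := leeD2r (B * t ^+ 2 * Cf)%:E le1; rewrite -id1 HCf; move: FI0.
  case: (\int[mu]_x (F k x)%:E)%E => [s| |]//.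
    rewrite -!EFinM -!EFinD !lee_fin => s0 H.
    by rewrite -(ler_pM2l (exprn_gt0 2 t0)); move: H; lra.
  by move=> _; rewrite gt0_muley// lte_fin exprn_gt0.
have fin : (\int[mu]_x (cutoff eps x * (2 * grad2 x + B))%:E <= (n%:R * (M ^+ 2 * Cc) + B * Cf)%:E)%E.
  by apply: (fatou_le mF F0 F_cvg) => k; have := main k; rewrite HCf -EFinM.
have E1 : (\int[mu]_x (cutoff eps x * (2 * grad2 x + B))%:E =
  2%:E * \int[mu]_x (cutoff eps x * grad2 x)%:E + (B * Cf)%:E)%E.
  rewrite (EFinM B Cf) -HCf -integralRZl//; [|exact: measurable_funM|by move=> x; rewrite mulr_ge0].
  rewrite -integralRZl//.
  rewrite -ge0_integralD//; last 4 first.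
  - by move=> x _; rewrite lee_fin mulr_ge0// mulr_ge0.
  - by apply/measurable_EFinP; apply: measurable_funM => //; exact: measurable_funM.
  - by move=> x _; rewrite lee_fin mulr_ge0.
  - by apply/measurable_EFinP; apply: measurable_funM.
  by apply: eq_integral => x _; rewrite -EFinD; congr (_%:E); ring.
have I0 : (0 <= \int[mu]_x (cutoff eps x * grad2 x)%:E)%E.
  by apply: integral_ge0 => x _; rewrite lee_fin mulr_ge0.
move: fin; rewrite E1; move: I0.
case: (\int[mu]_x (cutoff eps x * grad2 x)%:E)%E => [s| |]// s0.
  rewrite -EFinM -EFinD !lee_fin; move: s0; rewrite lee_fin; lra.
by rewrite gt0_muley.
Qed.

(** Fatou lets [eps] tend to 0 in the uniform bound; on a smaller cube the radial factor is bounded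
    below, so the cutoff dominates a multiple of [rho]. *)
Lemma harmonic_energy : exists2 r, 0 < r <= R0 & forall j,
  (\int[mu]_x (\1_([set x | (`|x - c| < r)%R] `&` U) x * (rho x * g j x ^+ 2))%:E < +oo)%E.
Proof.
have [C C0 HC] := cutoff_energy.
have lim : (\int[mu]_x (cutoff 0 x * grad2 x)%:E <= C%:E)%E.
  apply: (fatou_le (F := fun k x => cutoff (2^-1 ^+ k) x * grad2 x)).
  - by move=> k; exact: measurable_funM.
  - by move=> k x; exact: mulr_ge0.
  - move=> x; apply: cvgM; last exact: cvg_cst.
    rewrite /cutoff; apply: cvgM; last exact: cvg_cst.
    have hg : (fun k => geometric 1 (2^-1 : R) k) @ \oo --> 0.
      by apply: cvg_geometric; rewrite ger0_norm// invf_lt1// ltr1n.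
    apply/cvgrPdist_le => eps eps0; move/cvgrPdist_le : hg => /(_ _ eps0).
    apply: filterS => k; rewrite sub0r normrN /= mul1r => H.
    by apply: le_trans (pospart_lip _ _) _; rewrite opprB subr0 addrCA subrr addr0.
  - by move=> k; apply: HC; rewrite exprn_gt0.
(* On this cube the squared Euclidean distance is at most R0^2/4 * n/(n+1)^2, and n/(n+1)^2 <= 1/4,
   so [bowl] is at least R0^2/8; [q0] below is the square of that. *)
pose r := R0 / (2 * n.+1%:R).
have n0 : 0 < n.+1%:R :> R by rewrite ltr0n.
have rR : r < R0.
  rewrite ltr_pdivrMr ?mulr_gt0// ltr_pMr//.
  have : (1 : R) <= n.+1%:R by rewrite ler1n.
  lra.
exists r; first by rewrite (ltW rR) andbT divr_gt0// mulr_gt0.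
pose q0 : R := (R0 ^+ 2 / 8) ^+ 2.
have q00 : 0 < q0 by rewrite exprn_gt0// divr_gt0// exprn_gt0.
move=> j.
have mr := chart_measurable ch.
have mI : measurable_fun setT (fun x => q0^-1 * (cutoff 0 x * grad2 x)).
  by apply: measurable_funM => //; exact: measurable_funM.
apply: (@le_lt_trans _ _ (\int[mu]_x (q0^-1 * (cutoff 0 x * grad2 x))%:E)%E); last first.
  rewrite integralRZl//; [|exact: measurable_funM|by move=> x; exact: mulr_ge0|by rewrite invr_ge0 ltW].
  apply: lte_mul_pinfty => //; first by rewrite lee_fin invr_ge0 ltW.
  exact: le_lt_trans lim (ltry _).
have mB : measurable [set x : V | `|x - c| < r] by exact: measurable_oball.
apply: le_integralR => //.
  apply: measurable_funM.
    by apply: measurable_indic; apply: measurableI => //; exact: open_measurable_rV.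
  by apply: measurable_funM => //; apply: measurable_funX; exact: measurable_g.
move=> x.
have cg0 : 0 <= q0^-1 * (cutoff 0 x * grad2 x).
  by apply: mulr_ge0; [rewrite invr_ge0 ltW|exact: mulr_ge0].
have [Px|Px] := pselect (([set x | `|x - c| < r] `&` U) x); last first.
  by rewrite (indic_notin _ Px) mul0r lexx.
rewrite (indic_in _ Px) mul1r; case: Px => /= xr Ux.
have rx : 0 < rho x by apply/(chart_dom ch) => //; exact: lt_trans rR.
rewrite mulr_ge0 ?(ltW rx) ?sqr_ge0//=.
rewrite ler_pdivlMl// /cutoff subr0 (pospart_id (ltW rx)).
have gj : g j x ^+ 2 <= grad2 x.
  by rewrite /grad2 (bigD1 j)//= lerDl; apply: sumr_ge0 => k _; exact: sqr_ge0.
rewrite mulrCA -[leRHS]mulrA ler_pM2l//; apply: ler_pM => //; rewrite ?(ltW q00) ?sqr_ge0//.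
have bx : R0 ^+ 2 / 8 <= bowl c R0 x.
  have Rn : (R0 / (2 * n.+1%:R)) ^+ 2 = R0 ^+ 2 / 4 * (n.+1%:R ^- 2).
    by field; rewrite addrC -natr1 in n0 *; rewrite gt_eqF.
  have sq k : (x 0 k - c 0 k) ^+ 2 <= r ^+ 2.
    have := rV_coord_le (x - c) k; rewrite !mxE => H.
    by rewrite -[leLHS]real_normK ?num_real// ler_pXn2r ?nnegrE ?(le_trans H (ltW xr))// ltW// divr_gt0// mulr_gt0.
  have sm : \sum_k (x 0 k - c 0 k) ^+ 2 <= R0 ^+ 2 / 4 * (n%:R * n.+1%:R ^- 2).
    apply: le_trans (ler_sum _ (fun k _ => sq k)) _.
    by rewrite sumr_const card_ord -[leLHS]mulr_natl /r Rn mulrCA.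
  have n2 : n%:R * n.+1%:R ^- 2 <= 1 / 4 :> R.
    rewrite ler_pdivrMr ?exprn_gt0// -natr1 -subr_ge0.
    rewrite (_ : _ - _ = (n%:R - 1) ^+ 2 / 4); last by field.
    by rewrite divr_ge0// sqr_ge0.
  have R2 : 0 <= R0 ^+ 2 / 4 by rewrite divr_ge0// sqr_ge0.
  have sm4 := le_trans sm (ler_wpM2l R2 n2).
  rewrite /bowl lerBrDr (_ : (R0 / 2) ^+ 2 = R0 ^+ 2 / 8 + R0 ^+ 2 / 8); last by field.
  rewrite lerD2l; apply: le_trans sm4 _.
  rewrite (_ : R0 ^+ 2 / 8 = R0 ^+ 2 / 4 * (1 / 2)); last by field.
  by rewrite ler_wpM2l//; lra.
have bx0 : 0 <= bowl c R0 x by apply: le_trans bx; rewrite divr_ge0// sqr_ge0.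
by rewrite pospart_id// /q0 ler_pXn2r ?nnegrE// divr_ge0// sqr_ge0.
Qed.

End energy.

(** * Boundary charts *)

Section lipschitz.
Variables (R : realType) (n : nat).
Implicit Types (U : set 'rV[R]_n) (f : 'rV[R]_n -> R).
Local Notation e j := (delta_mx 0 j : 'rV[R]_n).

(** The coordinates of z are replaced by those of y one at a time. Intermediate points stay in the
    cube because it is a product of intervals; each step is a mean value estimate. *)
Lemma lipschitz_cube U f (y0 : 'rV[R]_n) r B : classC 1 U f -> 0 <= B ->
  (forall y, `|y - y0| < r -> U y /\ forall j, `|partial j f y| <= B) ->
  forall y z, `|y - y0| < r -> `|z - y0| < r -> `|f y - f z| <= n%:R * B * `|y - z|.
Proof.
move=> C1 B0 H y z yr zr.
pose w (k : nat) : 'rV[R]_n := \row_l (if (l < k)%N then y 0 l else z 0 l).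
have w0 : w 0%N = z by apply/rowP => l; rewrite !mxE.
have wn : w n = y by apply/rowP => l; rewrite !mxE ltn_ord.
pose r' := Num.max `|y - y0| `|z - y0|.
have r'r : r' < r by rewrite gt_max yr zr.
have r'0 : 0 <= r' by rewrite le_max normr_ge0.
have yl l : `|y 0 l - y0 0 l| <= r'.
  by rewrite le_max; have := rV_coord_le (y - y0) l; rewrite !mxE => ->.
have zl l : `|z 0 l - y0 0 l| <= r'.
  by rewrite le_max; have := rV_coord_le (z - y0) l; rewrite !mxE => ->; rewrite orbT.
have cube (v : 'rV[R]_n) : (forall l, `|v 0 l - y0 0 l| <= r') -> `|v - y0| < r.
  move=> vl; apply: le_lt_trans r'r; apply: rV_norm_le => // l; rewrite !mxE; exact: vl.
have stepE (k : 'I_n) : w k.+1 = w k + (y 0 k - z 0 k) *: e k.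
  apply/rowP => l; rewrite !mxE /= ltnS leq_eqVlt -[l == k]/(l == k :> nat).
  by case: ltngtP => [lk|lk|/val_inj ->]; rewrite /= ?mulr0 ?mulr1 ?addr0// addrC subrK.
have step (k : 'I_n) : `|f (w k.+1) - f (w k)| <= B * `|y - z|.
  apply: (@le_trans _ _ (B * `|y 0 k - z 0 k|)); last first.
    by rewrite ler_wpM2l//; have := rV_coord_le (y - z) k; rewrite !mxE.
  have wl l : `|w k 0 l - y0 0 l| <= r' by rewrite mxE; case: ifP.
  have /andP[z1 z2] : - r' <= z 0 k - y0 0 k <= r' by rewrite -ler_norml.
  have /andP[y1 y2] : - r' <= y 0 k - y0 0 k <= r' by rewrite -ler_norml.
  case: (leP 0 (y 0 k - z 0 k)) => [s0|/ltW s0].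
    rewrite (ger0_norm s0) stepE; apply: (partial_increment_le C1 s0) => t /andP[t0 ts].
    have : `|w k + t *: e k - y0| < r.
      apply: cube => l; rewrite !mxE /=; case: (eqVneq l k) => [->|lk].
        by rewrite ltnn mulr1 ler_norml; apply/andP; split; lra.
      by rewrite mulr0 addr0; have := wl l; rewrite mxE.
    by move=> /H[? /(_ k)].
  rewrite (ler0_norm s0) distrC.
  have -> : w k = w k.+1 + (- (y 0 k - z 0 k)) *: e k by rewrite stepE scaleNr addrK.
  apply: (partial_increment_le C1); first by rewrite oppr_ge0.
  move=> t /andP[t0 ts].
  have : `|w k.+1 + t *: e k - y0| < r.
    rewrite stepE; apply: cube => l; rewrite !mxE /=; case: (eqVneq l k) => [->|lk].
      by rewrite ltnn !mulr1 ler_norml; apply/andP; split; lra.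
    by rewrite !mulr0 !addr0; have := wl l; rewrite mxE.
  by move=> /H[? /(_ k)].
rewrite -wn -{1}w0 -(telescope_sumr (fun k => f (w k)) (leq0n n)) big_mkord.
apply: le_trans (ler_norm_sum _ _ _) _; rewrite wn.
apply: le_trans (ler_sum _ (fun k _ => step k)) _.
by rewrite sumr_const card_ord -[leLHS]mulr_natl mulrA.
Qed.

Lemma classC_locally_bounded f (y0 : 'rV[R]_n) : classC 2 setT f -> exists r B : R,
  [/\ 0 < r, 0 <= B & forall y, `|y - y0| < r -> forall j,
    `|partial j f y| <= B /\ `|partial j (partial j f) y| <= B].
Proof.
move=> C2.
have bnd (F : 'I_n -> 'rV[R]_n -> R) : (forall j, {for y0, continuous (F j)}) ->
    exists r B : R, [/\ 0 < r, 0 <= B & forall y, `|y - y0| < r -> forall j, `|F j y| <= B].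
  move=> cF; have /choice[r Hr] : forall j, exists r, 0 < r /\
      forall y, `|y - y0| < r -> `|F j y - F j y0| < 1.
    by move=> j; have [r r0 H] := continuous_cubeP (cF j) ltr01; exists r.
  exists (\big[Num.min/1]_j r j), (\sum_j (`|F j y0| + 1)); split.
  - by apply/bigmin_gtP; split => // j _; case: (Hr j).
  - by apply: sumr_ge0 => j _; rewrite addr_ge0.
  move=> y yr j; apply: (@le_trans _ _ (`|F j y0| + 1)); last first.
    by rewrite (bigD1 j)//= lerDl; apply: sumr_ge0 => k _; rewrite addr_ge0.
  have /(Hr j).2 : `|y - y0| < r j by apply: lt_le_trans yr _; exact: bigmin_le_cond.
  have := ler_normD (F j y - F j y0) (F j y0); rewrite subrK; lra.
have [r1 [B1 [r10 B10 H1]]] := bnd (fun j => partial j f)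
  (fun j => classC_continuous (classC_partial j C2) I).
have [r2 [B2 [r20 B20 H2]]] := bnd (fun j => partial j (partial j f))
  (fun j => classC_continuous (classC_partial j (classC_partial j C2)) I).
exists (Num.min r1 r2), (B1 + B2); split; first by rewrite lt_min r10.
  exact: addr_ge0.
move=> y; rewrite lt_min => /andP[y1 y2] j; split.
  by apply: le_trans (H1 y y1 j) _; rewrite lerDl.
by apply: le_trans (H2 y y2 j) _; rewrite lerDr.
Qed.

End lipschitz.

Section charts.
Variables (R : realType) (n : nat) (U : set 'rV[R]_n).
Local Notation V := 'rV[R]_n.
Local Notation e j := (delta_mx 0 j : 'rV[R]_n).

Lemma interior_chart (i : 'I_n) c : open U -> U c ->
  exists R0 L C2 i b rho, chart U c R0 L C2 i b rho.
Proof.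
move=> oU Uc; have [r r0 rU] := open_cubeP oU Uc.
exists r, 1, 0, i, false, (fun x : V => x 0 i - c 0 i + 2 * r); split => //.
- apply: measurable_funD => //; apply: measurable_funB => //.
  exact: (measurable_rV_coord i).
- move=> x xr; split => [_|_]; last exact: rU.
  have := le_lt_trans (rV_coord_le (x - c) i) xr; rewrite !mxE ltr_norml => /andP[]; lra.
- by move=> x s; rewrite !mxE /= expr0 !eqxx mulr1; ring.
- move=> x y _ _; rewrite mul1r; have := rV_coord_le (x - y) i; rewrite !mxE.
  by congr (`|_| <= _); ring.
- move=> j x t t0 _; rewrite mul0r normr_le0 /sdiff !mxE; apply/eqP; ring.
Qed.

Let col'_shift (i : 'I_n) (x : V) j t : col' i (x + t *: e j) =
  col' i x + (if unlift i j is Some k then t *: delta_mx 0 k else 0).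
Proof.
apply/rowP => k; rewrite !mxE /=.
case: unliftP => [j' ->|->]; rewrite !mxE /=.
  by rewrite (inj_eq (@lift_inj _ i)).
by rewrite eq_sym eq_liftF mulr0.
Qed.

Let col'_norm (i : 'I_n) (x : V) : `|col' i x| <= `|x|.
Proof. by apply: rV_norm_le => // k; rewrite mxE; exact: rV_coord_le. Qed.

Let col'B (i : 'I_n) (x y : V) : col' i (x - y) = col' i x - col' i y.
Proof. by apply/rowP => k; rewrite !mxE. Qed.

(** [rho] is the signed height x_i - gamma. It has unit slope along e_i as [gamma] ignores that
    coordinate; local bounds on the derivatives of [gamma] give the constants. *)
Lemma graph_chart (i : 'I_n) (b : bool) (gamma : 'rV[R]_n.-1 -> R) c :
  classC 2 setT gamma ->
  (\forall x \near c, U x <-> (-1) ^+ b * gamma (col' i x) < (-1) ^+ b * x 0 i) ->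
  exists R0 L C2 i b rho, chart U c R0 L C2 i b rho.
Proof.
move=> Cg /nbhs_ballP[r /= r0 rU].
have [r' [B [r'0 B0 HB]]] := classC_locally_bounded (col' i c) Cg.
have C1 : classC 1 setT gamma by exact: classCW Cg.
have lip := @lipschitz_cube R n.-1 setT gamma (col' i c) r' B C1 B0
  (fun y yr => conj I (fun j => (HB y yr j).1)).
pose rho (x : V) := (-1) ^+ b * (x 0 i - gamma (col' i x)).
have sgn2 : ((-1) ^+ b * (-1) ^+ b : R) = 1 by rewrite -expr2 sqrr_sign.
have inr x s : `|x - c| < s -> `|col' i x - col' i c| < s.
  by move=> xs; rewrite -col'B; exact: le_lt_trans (col'_norm _ _) xs.
exists (Num.min r r'), (1 + n.-1%:R * B), B, i, b, rho; split => //.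
- by rewrite lt_min r0.
- by rewrite addr_ge0// mulr_ge0.
- apply: measurable_funM => //; apply: measurable_funB.
    exact: (measurable_rV_coord i).
  have mg : measurable_fun setT gamma.
    by apply: measurable_continuous_rV; [exact: openT|move=> x _; exact: (classC_continuous Cg)].
  apply: (measurableT_comp mg); apply: measurable_fun_rV => k.
  apply: (eq_measurable_fun (fun x : V => rV_coord (lift i k) x)).
    by move=> x _; rewrite /= /rV_coord mxE.
  exact: measurable_rV_coord.
- move=> x; rewrite lt_min => /andP[xr _].
  have := rU x; rewrite -ball_normE /= distrC => /(_ xr).
  by rewrite /rho mulrBr subr_gt0.
- move=> x s; rewrite scalerA /rho col'_shift unlift_none addr0 !mxE /= !eqxx mulr1.
  transitivity ((-1) ^+ b * (x 0 i - gamma (col' i x)) + s * ((-1) ^+ b * (-1) ^+ b)).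
    by ring.
  by rewrite sgn2 mulr1.
- move=> x y; rewrite !lt_min => /andP[xr xr'] /andP[yr yr'].
  rewrite /rho -mulrBr normrM normr_sign mul1r.
  rewrite (_ : _ - _ - _ = (x 0 i - y 0 i) - (gamma (col' i x) - gamma (col' i y))); last by ring.
  apply: le_trans (ler_normB _ _) _; rewrite mulrDl mul1r; apply: lerD.
    by have := rV_coord_le (x - y) i; rewrite !mxE.
  apply: le_trans (lip _ _ (inr _ _ xr') (inr _ _ yr')) _.
  by rewrite ler_wpM2l ?mulr_ge0// -col'B.
move=> j x t t0; rewrite lt_min => /andP[xr xr'].
have -> : sdiff j t rho x = - (-1) ^+ b * (gamma (col' i (x + t *: e j)) +
    gamma (col' i (x - t *: e j)) - 2 * gamma (col' i x)).
  by rewrite /sdiff /rho !mxE; ring.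
rewrite -scaleNr !col'_shift normrM normrN normr_sign mul1r.
(* In the vertical direction [rho] is affine and its second difference vanishes; in any other it is
   that of [gamma] up to sign. *)
case: (unlift i j) => [k|]; last first.
  rewrite !addr0 (_ : _ - _ = 0); last by ring.
  by rewrite normr0 mulr_ge0// sqr_ge0.
have [//|xi xit E] := @classC_sdiff R n.-1 setT gamma k (col' i x) t Cg t0.
rewrite scaleNr -[X in `|X|]/(sdiff k t gamma (col' i x)) E normrM ger0_norm ?sqr_ge0//.
rewrite mulrC ler_wpM2r ?sqr_ge0//; apply: (HB _ _ k).2.
rewrite addrAC; apply: le_lt_trans (ler_normD _ _) _.
have := rV_delta_norm k xi; have := col'_norm i (x - c); rewrite col'B; lra.
Qed.

Lemma exists_chart c : (0 < n)%N -> open U -> smooth_boundary U -> closure U c ->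
  exists R0 L C2 i b rho, chart U c R0 L C2 i b rho.
Proof.
move=> n0 oU sU cU; have [Uc|Uc] := pselect (U c).
  by apply: interior_chart => //; exact: (Ordinal n0).
have [|i [b [gamma [sg H]]]] := sU c.
  by split => //; move=> /interior_subset.
exact: graph_chart (sg 2%N) H.
Qed.

End charts.

(** * Globalization *)

Section covering.
Variables (R : realType) (n : nat).
Local Notation V := 'rV[R]_n.
Local Notation mu := (lebesgue_rV R n).

Lemma positive_lower_bound (s : seq V) (f : V -> R) : (forall c, c \in s -> 0 < f c) ->
  exists2 d, 0 < d & forall c, c \in s -> d <= f c.
Proof.
elim: s => [_|c s IH f0]; first by exists 1.
have [d d0 Hd] := IH (fun c' cs => f0 c' (mem_behead (cs : c' \in behead (c :: s)))).
exists (Num.min (f c) d); first by rewrite lt_min d0 f0 ?mem_head.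
by move=> c'; rewrite inE ge_min => /predU1P[->|/Hd ->]; rewrite ?lexx ?orbT.
Qed.

Lemma finite_cover (K : set V) (r : V -> R) : compact K -> (forall c, K c -> 0 < r c) ->
  exists s : seq V, (forall c, c \in s -> K c) /\
    forall x, K x -> exists2 c, c \in s & `|x - c| < r c.
Proof.
rewrite compact_cover => cK r0.
have [|x Kx|D DK KD] := cK V K (fun c => interior (ball c (r c))).
- by move=> c Kc; exact: open_interior.
- by exists x => //; exact: nbhsx_ballx (r0 x Kx).
exists (finmap.enum_fset D); split => [c cD|x Kx]; first by have /set_mem := DK c cD.
by have [c /= cD /interior_subset] := KD x Kx; rewrite -ball_normE /= distrC => H; exists c.
Qed.

Variable U : set V.
Hypotheses (oU : open U) (cU : compact (closure U)).

Lemma local_integral_lty (F : V -> R) : measurable_fun setT F -> (forall x, 0 <= F x) ->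
  (forall c, closure U c -> exists2 r, 0 < r &
    (\int[mu]_x (\1_([set x | (`|x - c| < r)%R] `&` U) x * F x)%:E < +oo)%E) ->
  (\int[mu]_x (\1_U x * F x)%:E < +oo)%E.
Proof.
move=> mF F0 loc.
have mU : measurable U by exact: open_measurable_rV.
have /choice[r Hr] : forall c, exists r, closure U c -> 0 < r /\
    (\int[mu]_x (\1_([set x | (`|x - c| < r)%R] `&` U) x * F x)%:E < +oo)%E.
  move=> c; have [cUc|ncU] := pselect (closure U c); last by exists 0.
  by have [r r0 H] := loc c cUc; exists r.
have [s [sU cov]] := finite_cover cU (fun c cUc => (Hr c cUc).1).
pose S c : set V := [set x | `|x - c| < r c] `&` U.
have mS c : measurable (S c) by apply: measurableI => //; exact: measurable_oball.
have mSF c : measurable_fun setT (fun x => \1_(S c) x * F x).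
  by apply: measurable_funM => //; exact: measurable_indic.
apply: (@le_lt_trans _ _ (\int[mu]_x (\sum_(c <- s) \1_(S c) x * F x)%:E)%E).
  apply: le_integralR.
  - by apply: measurable_funM => //; exact: measurable_indic.
  - exact: measurable_sum.
  move=> x; rewrite mulr_ge0//=.
  have [Ux|Ux] := pselect (U x); last first.
    by rewrite (indic_notin _ Ux) mul0r; apply: sumr_ge0 => c _; rewrite mulr_ge0.
  have [c cs xc] := cov x (@subset_closure _ U x Ux).
  rewrite (big_rem c cs)/= indic_in// (indic_in _ (conj xc Ux : S c x)) lerDl.
  by apply: sumr_ge0 => c' _; rewrite mulr_ge0.
rewrite integralR_sum//; last by move=> c x; rewrite mulr_ge0.
rewrite big_seq; apply: lte_sum_pinfty => c cs.
exact: (Hr c (sU c cs)).2.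
Qed.

Lemma bounded_measure_lty : (mu U < +oo)%E.
Proof.
have := @local_integral_lty (cst 1) (measurable_cst _) (fun=> ler01).
have mU : measurable U by exact: open_measurable_rV.
under eq_integral do rewrite mulr1.
rewrite integralR_indic//; apply => c _; exists 1 => //.
under eq_integral do rewrite mulr1.
rewrite integralR_indic; last by apply: measurableI => //; exact: measurable_oball.
apply: (@le_lt_trans _ _ (mu [set x : V | `|x - c| <= 1])).
  apply: le_measure; rewrite ?inE.
  - by apply: measurableI => //; exact: measurable_oball.
  - exact: measurable_cball.
  - by move=> x [/= /ltW].
by rewrite [X in (X < _)%E](_ : _ = ((2 * 1) ^+ n)%:E) ?ltry//; exact: lebesgue_rV_ball.
Qed.

End covering.

(** * Near and far pairs in the Gagliardo seminorm *)

Section products.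
Variables (R : realType) (n : nat).
Local Notation V := 'rV[R]_n.
Local Notation mu := (lebesgue_rV R n).
Local Notation mu2 := (lebesgue_rV R n \x lebesgue_rV R n)%E.

Lemma integral_prod (A B : V -> R) : measurable_fun setT A -> measurable_fun setT B ->
  (forall x, 0 <= A x) -> (forall x, 0 <= B x) ->
  (\int[mu2]_p (A p.1 * B p.2)%:E = \int[mu]_x (A x)%:E * \int[mu]_x (B x)%:E)%E.
Proof.
move=> mA mB A0 B0.
have mAB : measurable_fun setT (fun p : V * V => A p.1 * B p.2).
  by apply: measurable_funM; [exact: (measurableT_comp mA)|exact: (measurableT_comp mB)].
rewrite (fubini_tonelli1 (fun p : V * V => (A p.1 * B p.2)%:E)); last 2 first.
- exact/measurable_EFinP.
- by move=> p; rewrite lee_fin mulr_ge0.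
rewrite /fubini_F /=.
under eq_integral => x _ do rewrite integralRZl//.
rewrite ge0_integralZr//.
- exact/measurable_EFinP.
- by move=> x _; rewrite lee_fin.
- by apply: integral_ge0 => x _; rewrite lee_fin.
Qed.

Lemma euclidean_norm_ge (x : V) : `|x| <= euclidean_norm x.
Proof.
apply: rV_norm_le => [|i]; first exact: sqrtr_ge0.
rewrite -(sqrtr_sqr (x 0 i)) ler_wsqrtr// (bigD1 i)//= lerDl.
by apply: sumr_ge0 => j _; exact: sqr_ge0.
Qed.

Lemma euclidean_norm_le (x : V) : euclidean_norm x <= n.+1%:R * `|x|.
Proof.
rewrite -[leRHS]ger0_norm ?mulr_ge0// -sqrtr_sqr ler_wsqrtr// exprMn.
apply: (@le_trans _ _ (n%:R * `|x| ^+ 2)).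
  rewrite mulr_natl -[X in _ *+ X]card_ord -sumr_const; apply: ler_sum => i _.
  by rewrite -[leLHS]real_normK ?num_real// ler_pXn2r ?nnegrE//; exact: rV_coord_le.
rewrite ler_wpM2r ?sqr_ge0// -natrX ler_nat expnS expn1 mulSn.
by rewrite -addnS leq_addl || apply: leq_trans (leqnSn n) (leq_addr _ _).
Qed.

Lemma measurable_euclidean_norm : measurable_fun setT (@euclidean_norm R n).
Proof.
rewrite (_ : @euclidean_norm R n = fun x : V => (\sum_(i < n) x 0 i ^+ 2) `^ 2^-1).
  apply: measurable_powR_comp; apply: measurable_sum => i; apply: measurable_funX.
  exact: (measurable_rV_coord i).
by apply/funext => x; rewrite powR12_sqrt//; apply: sumr_ge0 => i _; exact: sqr_ge0.
Qed.

Variables (U : set V) (f : V -> R) (theta : R).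
Hypotheses (oU : open U) (cU : compact (closure U)) (C1 : classC 1 U f) (theta0 : 0 < theta).
Hypothesis L2 : (\int[mu]_x ((f \_ U) x ^+ 2)%:E < +oo)%E.
Local Notation f0 := (f \_ U).
Let q : R := n%:R + 2 * theta.
Let q0 : 0 < q. Proof. by rewrite /q ltr_wpDl// mulr_gt0. Qed.

(** Cubes of half the admissible radius cover the closure. A pair closer than the least half radius
    [delta] lies in one full cube; for any other pair the kernel is bounded, and square
    integrability on a set of finite measure suffices. *)
Lemma gagliardo_lty :
  (forall c, closure U c -> exists2 r, 0 < r &
    (\int[mu2]_p (\1_([set x | (`|x - c| <= r)%R] `&` U) p.1 *
       \1_([set x | (`|x - c| <= r)%R] `&` U) p.2 *
       ((f0 p.1 - f0 p.2) ^+ 2 * `|p.1 - p.2| `^ (- (n%:R + 2 * theta))))%:E < +oo)%E) ->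
  (gagliardo theta U f < +oo)%E.
Proof.
move=> loc; rewrite /gagliardo integral_indicR.
have mU : measurable U by exact: open_measurable_rV.
have mf := measurable_f0 oU C1.
have msub : measurable_fun setT (fun p : V * V => p.1 - p.2).
  apply: (eq_measurable_fun (fun p : V * V => p.1 + (-1) *: p.2)).
    by move=> p _; rewrite scaleN1r.
  by apply: measurable_rVD => //; apply: measurable_rVZ.
have mdf : measurable_fun setT (fun p : V * V => (f0 p.1 - f0 p.2) ^+ 2).
  by apply: measurable_funX; apply: measurable_funB; exact: (measurableT_comp mf).
have mw : measurable_fun setT (fun p : V * V => `|p.1 - p.2| `^ (- q)).
  by apply: measurable_powR_comp; exact: (measurableT_comp (@measurable_rV_norm R n)).
pose G (p : V * V) : R := (f0 p.1 - f0 p.2) ^+ 2 * `|p.1 - p.2| `^ (- q).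
have mG : measurable_fun setT G by exact: measurable_funM.
have G0 p : 0 <= G p by rewrite mulr_ge0 ?powR_ge0// sqr_ge0.
have mUU : measurable_fun setT (fun p : V * V => \1_U p.1 * \1_U p.2 : R).
  by apply: measurable_funM; exact: measurable_indic_comp.
have /choice[r Hr] : forall c, exists r, closure U c -> 0 < r / 2 /\
    (\int[mu2]_p (\1_([set x | (`|x - c| <= r)%R] `&` U) p.1 *
       \1_([set x | (`|x - c| <= r)%R] `&` U) p.2 * G p)%:E < +oo)%E.
  move=> c; have [cUc|ncU] := pselect (closure U c); last by exists 0.
  by have [r r0 H] := loc c cUc; exists r => _; split => //; rewrite divr_gt0.
have [s [sU cov]] := finite_cover cU (fun c cUc => (Hr c cUc).1).
pose S c : set V := [set x | `|x - c| <= r c] `&` U.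
have mS c : closure U c -> measurable (S c).
  move=> /Hr[r0 _]; apply: measurableI => //; apply: measurable_cball.
  by move: r0; rewrite pmulr_lgt0// => /ltW.
have [delta delta0 Hdelta] := positive_lower_bound (fun c cs => (Hr c (sU c cs)).1).
pose D : R := delta `^ (- q).
have D0 : 0 <= D by exact: powR_ge0.
(* Kernel bound at distance [delta] times (a - b)^2 <= 2 a^2 + 2 b^2. *)
pose far (p : V * V) : R := D * (2 * (f0 p.1 ^+ 2 * \1_U p.2 + \1_U p.1 * f0 p.2 ^+ 2)).
have mf2 : measurable_fun setT (fun x => f0 x ^+ 2) by exact: measurable_funX.
have m1U : measurable_fun setT (\1_U : V -> R) by exact: measurable_indic.
have mfar1 : measurable_fun setT (fun p : V * V => f0 p.1 ^+ 2 * \1_U p.2).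
  by apply: measurable_funM; [exact: (measurableT_comp mf2)|exact: measurable_indic_comp].
have mfar2 : measurable_fun setT (fun p : V * V => \1_U p.1 * f0 p.2 ^+ 2).
  by apply: measurable_funM; [exact: measurable_indic_comp|exact: (measurableT_comp mf2)].
have mfar12 : measurable_fun setT (fun p : V * V => f0 p.1 ^+ 2 * \1_U p.2 + \1_U p.1 * f0 p.2 ^+ 2).
  exact: measurable_funD.
have far1 (p : V * V) : 0 <= f0 p.1 ^+ 2 * \1_U p.2 by rewrite mulr_ge0// sqr_ge0.
have far2 (p : V * V) : 0 <= \1_U p.1 * f0 p.2 ^+ 2 by rewrite mulr_ge0// sqr_ge0.
have far12 (p : V * V) : 0 <= f0 p.1 ^+ 2 * \1_U p.2 + \1_U p.1 * f0 p.2 ^+ 2 by rewrite addr_ge0.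
have mfar : measurable_fun setT far by do 2 apply: measurable_funM => //.
have far0 p : 0 <= far p by rewrite /far mulr_ge0// mulr_ge0.
have muU := bounded_measure_lty oU cU.
have intfar : (\int[mu2]_p (far p)%:E < +oo)%E.
  apply: integralRZ_lty => //; first by apply: measurable_funM.
    by move=> p; rewrite mulr_ge0.
  apply: integralRZ_lty => //.
  have L20 : (0 <= \int[mu]_x (f0 x ^+ 2)%:E)%E.
    by apply: integral_ge0 => x _; rewrite lee_fin sqr_ge0.
  have fU : (\int[mu]_x (f0 x ^+ 2)%:E * mu U < +oo)%E.
    by rewrite lte_mul_pinfty// ge0_fin_numE.
  apply: integralRD_lty => //.
    rewrite (integral_prod (A := fun x => f0 x ^+ 2) (B := \1_U))//; last by move=> x; exact: sqr_ge0.
    by rewrite integralR_indic.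
  rewrite (integral_prod (A := \1_U) (B := fun x => f0 x ^+ 2))//; last by move=> x; exact: sqr_ge0.
  by rewrite integralR_indic// muleC.
pose near c (p : V * V) : R := \1_(S c) p.1 * \1_(S c) p.2 * G p.
have mnear c : closure U c -> measurable_fun setT (near c).
  move=> cUc; apply: measurable_funM => //.
  by apply: measurable_funM; apply: measurable_indic_comp => //; exact: mS.
have near0 c p : 0 <= near c p by rewrite mulr_ge0// mulr_ge0.
(* Radii are controlled only at points of the closure, so the summand is set to 0 off the list to be
   measurable for every [c]. *)
have mnear' c : measurable_fun setT (fun p => if c \in s then near c p else 0).
  by case: (boolP (c \in s)) => [/sU/mnear//|_]; exact: measurable_cst.
have intnear : (\int[mu2]_p (\sum_(c <- s) (if c \in s then near c p else 0))%:E < +oo)%E.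
  rewrite integralR_sum.
  - rewrite big_seq; apply: lte_sum_pinfty => c cs; rewrite cs.
    exact: (Hr c (sU c cs)).2.
  - exact: mnear'.
  - by move=> c p; case: ifP.
have mnears : measurable_fun setT (fun p => \sum_(c <- s) (if c \in s then near c p else 0)).
  exact: measurable_sum.
have nears0 p : 0 <= \sum_(c <- s) (if c \in s then near c p else 0).
  by apply: sumr_ge0 => c _; case: ifP.
apply: le_lt_trans (integralRD_lty mnears mfar nears0 far0 intnear intfar).
apply: le_integralR.
- apply: (eq_measurable_fun (fun p : V * V => \1_U p.1 * \1_U p.2 *
     ((f0 p.1 - f0 p.2) ^+ 2 * euclidean_norm (p.1 - p.2) `^ (- q)))).
    move=> p _; rewrite powRN; have [Up|Up] := pselect ((U `*` U) p).
      have [U1 U2] := Up.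
      by rewrite (indic_in _ Up) (indic_in _ U1) (indic_in _ U2) !patchE !mem_set// !mul1r.
    rewrite (indic_notin _ Up) mul0r; have [U1|U1] := pselect (U p.1).
      by rewrite (@indic_notin _ _ _ U p.2) ?mulr0 ?mul0r// => U2; exact: Up.
    by rewrite (indic_notin _ U1) !mul0r.
  apply: measurable_funM => //; apply: measurable_funM => //.
  by apply: measurable_powR_comp; exact: (measurableT_comp measurable_euclidean_norm).
- exact: measurable_funD.
move=> p; apply/andP; split.
  by rewrite mulr_ge0// mulr_ge0 ?sqr_ge0// invr_ge0 powR_ge0.
have [Up|Up] := pselect ((U `*` U) p); last by rewrite (indic_notin _ Up) mul0r addr_ge0.
have [U1 U2] := Up.
rewrite (indic_in _ Up) mul1r.
have E : f p.1 - f p.2 = f0 p.1 - f0 p.2 by rewrite !patchE !mem_set.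
rewrite E -powRN.
apply: (@le_trans _ _ (G p)).
  rewrite /G ler_wpM2l ?sqr_ge0// !powRN.
  (* On the diagonal both norms are 0, and both sides are the same power of 0. *)
  have [->|pp] := eqVneq (p.1 - p.2) 0.
    by rewrite /euclidean_norm big1 ?sqrtr0 ?normr0// => i _; rewrite mxE expr0n.
  rewrite lef_pV2 ?posrE ?powR_gt0 ?normr_gt0//; last first.
    by apply: lt_le_trans (euclidean_norm_ge _); rewrite normr_gt0.
  by apply: ge0_ler_powR; rewrite ?nnegrE ?(ltW q0)// ?sqrtr_ge0//; exact: euclidean_norm_ge.
have [c cs pc] := cov p.1 (@subset_closure _ U _ U1).
case: (leP delta `|p.1 - p.2|) => dp.
  apply: (@le_trans _ _ (far p)); last by rewrite lerDr.
  rewrite /G /far (indic_in _ U1) (indic_in _ U2) mulr1 mul1r mulrC.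
  apply: ler_pM; rewrite ?powR_ge0 ?sqr_ge0//.
    rewrite /D !powRN lef_pV2 ?posrE ?powR_gt0//; last exact: lt_le_trans dp.
    by apply: ge0_ler_powR; rewrite ?nnegrE ?(ltW q0) ?(ltW delta0)//.
  rewrite -subr_ge0 (_ : _ - _ = (f0 p.1 + f0 p.2) ^+ 2); last by ring.
  exact: sqr_ge0.
apply: (@le_trans _ _ (\sum_(c <- s) (if c \in s then near c p else 0))); last by rewrite lerDl.
rewrite (big_rem c cs)/= cs; apply: (@le_trans _ _ (near c p)); last first.
  by rewrite lerDl; apply: sumr_ge0 => c' _; case: ifP.
have dr := Hdelta c cs.
have r0 := (Hr c (sU c cs)).1.
have S1 : S c p.1 by split => //=; lra.
have S2 : S c p.2.
  split => //=; rewrite (_ : p.2 - c = (p.1 - c) - (p.1 - p.2)); last first.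
    by rewrite opprB [RHS]addrC addrA subrK.
  by apply: le_trans (ler_normB _ _) _; lra.
by rewrite /near (indic_in _ S1) (indic_in _ S2) !mul1r.
Qed.

End products.

(** * Estimates in a chart *)

Section chart_estimates.
Variables (R : realType) (n : nat) (U : set 'rV[R]_n).
Local Notation V := 'rV[R]_n.
Local Notation mu := (lebesgue_rV R n).
Local Notation mu2 := (lebesgue_rV R n \x lebesgue_rV R n)%E.
Local Notation e j := (delta_mx 0 j : 'rV[R]_n).

Lemma chart_shrink c R0 L C2 i b rho r : chart U c R0 L C2 i b rho -> 0 < r -> r <= R0 ->
  chart U c r L C2 i b rho.
Proof.
move=> ch r0 rR; split => //.
- exact: (chart_L ch).
- exact: (chart_C2 ch).
- exact: (chart_measurable ch).
- by move=> x xr; apply: (chart_dom ch); exact: lt_le_trans rR.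
- exact: (chart_shift ch).
- by move=> x y xr yr; apply: (chart_lip ch); exact: lt_le_trans rR.
- by move=> j x t t0 xr; apply: (chart_sdiff ch) => //; exact: lt_le_trans rR.
Qed.

Variables (c : V) (R0 L C2 : R) (i : 'I_n) (b : bool) (rho : V -> R).
Hypothesis ch : chart U c R0 L C2 i b rho.
Let R00 := chart_R0 ch.
Let L0 := chart_L ch.
Let mrho := chart_measurable ch.
Hypothesis oU : open U.
Let mU : measurable U. Proof. exact: open_measurable_rV. Qed.
Let a : R := `|rho c| + L * R0 + 1.
Let a0 : 0 < a. Proof. by rewrite /a ltr_wpDl// addr_ge0// mulr_ge0// ltW. Qed.

Let rho_bound x : `|x - c| < R0 -> rho x <= a.
Proof.
move=> xR; have := chart_lip ch xR (_ : `|c - c| < R0); rewrite subrr normr0 => /(_ R00).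
have := ler_wpM2l L0 (ltW xR); have := ler_norm (rho c); have := ler_norm (rho x - rho c).
by rewrite /a; lra.
Qed.

Lemma embedding_at f r theta : classC 1 U f -> 0 < r -> r <= R0 -> 0 < theta < 1 ->
  (forall j, \int[mu]_x (\1_([set x | (`|x - c| < r)%R] `&` U) x *
     (rho x `^ (2 - 2 * theta) * ((partial j f) \_ U) x ^+ 2))%:E < +oo)%E ->
  exists2 r', 0 < r' &
    (\int[mu2]_p (\1_([set x | (`|x - c| <= r')%R] `&` U) p.1 *
       \1_([set x | (`|x - c| <= r')%R] `&` U) p.2 *
       (((f \_ U) p.1 - (f \_ U) p.2) ^+ 2 *
         `|p.1 - p.2| `^ (- (n%:R + 2 * theta))))%:E < +oo)%E.
Proof.
move=> C1 r0 rR /andP[t0 t1] en; have ch' := chart_shrink ch r0 rR.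
exists (r / (4 * (L + 1 + 1))); first by rewrite divr_gt0// mulr_gt0// ltr_wpDl// addr_ge0.
exact: (local_embedding oU C1 r0 L0 mrho (chart_dom ch') (chart_shift ch')
  (chart_lip ch') t0 t1 en).
Qed.

(** [layer_cake] with d = 1 for N = [rho]: by [slab_le] the set where 0 < rho <= r has measure of
    order r, so powers above -1 are integrable. *)
Lemma chart_power_lty (p : R) : -1 < p ->
  (\int[mu]_x (\1_([set x | (`|x - c| < R0)%R] `&` U) x * rho x `^ p)%:E < +oo)%E.
Proof.
move=> p1; have p1' : - p < 1 by rewrite ltrNl.
have [K K0 HK] := layer_cake p1'.
pose S : set V := [set x | `|x - c| <= R0].
pose C : R := (2 * (R0 + 1)) ^+ n * 2.
have C0 : 0 <= C by rewrite mulr_ge0// exprn_ge0// mulr_ge0// addr_ge0// ltW.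
have mS : measurable S by exact: measurable_cball (ltW R00).
have e1 : `|((-1) ^+ b *: e i : V)| <= 1.
  by apply: le_trans (rV_delta_norm _ _) _; rewrite normr_sign.
have slab r : 0 < r <= a ->
    (mu (S `&` [set x | (0 < rho x <= r)%R]) <= (C * r `^ 1)%:E)%E.
  move=> /andP[r0 ra]; rewrite powRr1 ?(ltW r0)//.
  apply: (@le_trans _ _ (mu (S `&` [set x | (`|rho x - 0| <= r)%R]))).
    apply: le_measure; rewrite ?inE.
    + by apply: measurableI => //; exact: measurable_set0lt.
    + by apply: measurableI => //; exact: (measurable_slab mrho).
    + by move=> x [Sx /= /andP[x0 xr]]; split => //=; rewrite subr0 ger0_norm// ltW.
  apply: (le_trans (slab_le mrho e1 (chart_shift ch) c 0 (ltW R00) (ltW r0))).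
  by rewrite lee_fin /C mulrA.
have := HK _ _ mu S rho C a mS mrho C0 a0 slab; rewrite opprK => HI.
apply: le_lt_trans (le_lt_trans HI (ltry _)).
apply: le_integralR.
- apply: measurable_funM; last exact: measurable_powR_comp.
  by apply: measurable_indic; apply: measurableI => //; exact: measurable_oball.
- apply: measurable_funM; last exact: measurable_powR_comp.
  by apply: measurable_indic; apply: measurableI => //; exact: measurable_set0lt.
move=> x; rewrite mulr_ge0 ?powR_ge0//= ler_wpM2r ?powR_ge0//.
have [Px|Px] := pselect (([set x | `|x - c| < R0] `&` U) x); last by rewrite (indic_notin _ Px).
rewrite (indic_in _ Px) indic_in//; have [/= xR Ux] := Px.
split => /=; first exact: ltW.
by rewrite rho_bound// andbT; apply/(chart_dom ch).
Qed.

Lemma chart_weighted_lty (F : V -> R) r C m beta : 0 < r -> r <= R0 -> 0 <= C ->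
  measurable_fun setT F -> -1 < m + 2 * beta ->
  (forall x, `|x - c| < r -> U x -> `|F x| <= C * rho x `^ beta) ->
  (\int[mu]_x (\1_([set x | (`|x - c| < r)%R] `&` U) x *
     (rho x `^ m * F x ^+ 2))%:E < +oo)%E.
Proof.
move=> r0 rR C0 mF mb HF.
have mP : measurable_fun setT (fun x => \1_([set x | `|x - c| < R0] `&` U) x * rho x `^ (m + 2 * beta)).
  apply: measurable_funM; last exact: measurable_powR_comp.
  by apply: measurable_indic; apply: measurableI => //; exact: measurable_oball.
apply: (@le_lt_trans _ _ (\int[mu]_x (C ^+ 2 * (\1_([set x | (`|x - c| < R0)%R] `&` U) x *
    rho x `^ (m + 2 * beta)))%:E)%E); last first.
  apply: integralRZ_lty => //; last exact: chart_power_lty.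
    by move=> x; rewrite mulr_ge0 ?powR_ge0.
  exact: sqr_ge0.
apply: le_integralR.
- apply: measurable_funM.
    by apply: measurable_indic; apply: measurableI => //; exact: measurable_oball.
  by apply: measurable_funM; [exact: measurable_powR_comp|exact: measurable_funX].
- exact: measurable_funM.
move=> x; apply/andP; split.
  by apply: mulr_ge0 => //; apply: mulr_ge0; [exact: powR_ge0|exact: sqr_ge0].
have rhs0 : 0 <= C ^+ 2 * (\1_([set x | `|x - c| < R0] `&` U) x * rho x `^ (m + 2 * beta)).
  by apply: mulr_ge0; [exact: sqr_ge0|rewrite mulr_ge0 ?powR_ge0].
have [Px|Px] := pselect (([set x | `|x - c| < r] `&` U) x); last by rewrite (indic_notin _ Px) mul0r.
have [/= xr Ux] := Px; have xR := lt_le_trans xr rR.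
rewrite (indic_in _ Px) (indic_in _ (conj xR Ux : ([set x | `|x - c| < R0] `&` U) x)) !mul1r.
have rx : 0 < rho x by apply/(chart_dom ch).
rewrite powRD; last by apply/implyP => _; rewrite gt_eqF.
rewrite [leRHS]mulrCA ler_wpM2l ?powR_ge0//.
have -> : rho x `^ (2 * beta) = (rho x `^ beta) ^+ 2.
  by rewrite mulrC powRrM powR_mulrn ?powR_ge0.
rewrite -exprMn -[leLHS]real_normK ?num_real// ler_pXn2r ?nnegrE ?mulr_ge0 ?powR_ge0//.
exact: HF.
Qed.

Variables (u : V -> R) (H alpha : R).
Hypotheses (hu : harmonic_in U u) (H0 : 0 <= H) (al0 : 0 < alpha).
Hypothesis hol : forall y z, U y -> U z -> `|u y - u z| <= H * `|y - z| `^ alpha.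

(** The interior bounds on a cube of radius d = ka rho(x), where Hoelder continuity limits the
    oscillation to H (2d)^alpha; dividing by d or d^2 gives the powers. *)
Lemma holder_partial_bound : exists2 C : R, 0 <= C & forall x, `|x - c| < R0 / 2 -> U x ->
  forall j k, `|partial j u x| <= C * rho x `^ (alpha - 1) /\
    `|partial k (partial j u) x| <= C * rho x `^ (alpha - 2).
Proof.
(* The first bound gives L d <= rho(x)/2, so [rho] stays positive on the cube; the second gives d <=
   R0/4, so the cube stays in the chart. *)
pose ka : R := Num.min ((2 * (L + 1))^-1) (R0 / (4 * a)).
have L1 : 0 < 2 * (L + 1) by rewrite mulr_gt0// ltr_wpDl.
have ka0 : 0 < ka by rewrite lt_min invr_gt0 L1 divr_gt0// mulr_gt0.
pose CA : R := n.+1%:R * (H * (2 * ka) `^ alpha) / ka.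
pose CB : R := 16 * n.+1%:R ^+ 2 * (H * (2 * ka) `^ alpha) / ka ^+ 2.
have W0 : 0 <= H * (2 * ka) `^ alpha by rewrite mulr_ge0 ?powR_ge0.
have CA0 : 0 <= CA by apply: divr_ge0; [exact: mulr_ge0|exact: ltW].
have CB0 : 0 <= CB.
  apply: divr_ge0; last exact: sqr_ge0.
  by apply: mulr_ge0 => //; apply: mulr_ge0 => //; exact: sqr_ge0.
exists (CA + CB); first exact: addr_ge0.
move=> x xR Ux j k.
have xR' : `|x - c| < R0 by have := R00; lra.
have rx : 0 < rho x by apply/(chart_dom ch).
pose d := ka * rho x; have d0 : 0 < d by rewrite mulr_gt0.
have dR : d <= R0 / 4.
  apply: (@le_trans _ _ (R0 / (4 * a) * a)).
    apply: ler_pM; rewrite ?(ltW ka0) ?(ltW rx) ?rho_bound//.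
    by rewrite ge_min lexx orbT.
  by rewrite le_eqVlt; apply/orP; left; apply/eqP; field; rewrite gt_eqF.
have dL : L * d <= rho x / 2.
  have : (L + 1) * d <= (L + 1) * ((2 * (L + 1))^-1 * rho x).
    by rewrite ler_wpM2l ?addr_ge0// ler_wpM2r ?(ltW rx)// ge_min lexx.
  have -> : (L + 1) * ((2 * (L + 1))^-1 * rho x) = rho x / 2.
    by field; rewrite gt_eqF// ltr_wpDl.
  by have := d0; lra.
have cubeU y : `|y - x| <= d -> U y.
  move=> yd; have yR : `|y - c| < R0.
    rewrite (_ : y - c = (y - x) + (x - c)); last by rewrite addrA subrK.
    by apply: le_lt_trans (ler_normD _ _) _; have := R00; lra.
  apply/(chart_dom ch) => //.
  have := chart_lip ch yR xR'; rewrite ler_norml => /andP[h _].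
  by have := ler_wpM2l L0 yd; lra.
have osc y z : `|y - x| <= d -> `|z - x| <= d -> `|u y - u z| <= H * (2 * d) `^ alpha.
  move=> yd zd; apply: le_trans (hol (cubeU y yd) (cubeU z zd)) _.
  have d20 : 0 <= 2 * d by apply: mulr_ge0 => //; exact: ltW.
  rewrite ler_wpM2l//; apply: ge0_ler_powR; rewrite ?nnegrE ?(ltW al0)//.
  rewrite (_ : y - z = (y - x) - (z - x)); last by rewrite opprB addrA subrK.
  by apply: le_trans (ler_normB _ _) _; lra.
have WE : H * (2 * d) `^ alpha = H * (2 * ka) `^ alpha * rho x `^ alpha.
  by rewrite /d mulrA powRM ?mulr_ge0 ?(ltW ka0) ?(ltW rx)// mulrA.
have pE m : rho x `^ (alpha - m%:R) = rho x `^ alpha / rho x ^+ m.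
  rewrite powRD; last by apply/implyP => _; rewrite gt_eqF.
  by rewrite powRN powR_mulrn// ltW.
have p1 := powR_ge0 (rho x) (alpha - 1); have p2 := powR_ge0 (rho x) (alpha - 2).
have := partial_bound j oU hu d0 cubeU osc.
have := partial2_bound j k oU hu d0 cubeU osc.
have -> : n.+1%:R * (H * (2 * d) `^ alpha) / d = CA * rho x `^ (alpha - 1).
  rewrite WE (pE 1%N) /CA /d expr1; field; by rewrite !gt_eqF.
have -> : 16 * n.+1%:R ^+ 2 * (H * (2 * d) `^ alpha) / d ^+ 2 = CB * rho x `^ (alpha - 2).
  rewrite WE (pE 2%N) /CB /d; field; by rewrite !gt_eqF.
move=> b2 b1; split.
  by apply: le_trans b1 _; rewrite ler_wpM2r// lerDl.
by apply: le_trans b2 _; rewrite ler_wpM2r// lerDr.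
Qed.

End chart_estimates.

(** * Weak derivatives *)

Section weak.
Variables (R : realType) (n : nat).
Local Notation V := 'rV[R]_n.
Local Notation mu := (lebesgue_rV R n).
Local Notation e j := (delta_mx 0 j : 'rV[R]_n).

Lemma integral_rV_shift_real (h : V) (F : V -> R) : measurable_fun setT F ->
  (\int[mu]_x (F (x + h))%:E = \int[mu]_x (F x)%:E)%E.
Proof.
move=> mF; have mE : measurable_fun setT (fun x => (F x)%:E) by exact/measurable_EFinP.
rewrite integralE [RHS]integralE; congr (_ - _)%E.
  rewrite -[RHS](integral_rV_shift h); last 2 first.
  - exact: measurable_funepos.
  - by move=> x; exact: funepos_ge0.
  by apply: eq_integral => x _; rewrite !funeposE.
rewrite -[RHS](integral_rV_shift h); last 2 first.
- exact: measurable_funeneg.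
- by move=> x; exact: funeneg_ge0.
by apply: eq_integral => x _; rewrite !funenegE.
Qed.

Lemma continuous_compact_bounded (K : set V) (F : V -> R) : compact K ->
  (forall x, K x -> {for x, continuous F}) ->
  exists2 B, 0 <= B & forall x, K x -> `|F x| <= B.
Proof.
move=> cK cF.
have /choice[r Hr] : forall c, exists r, K c -> 0 < r /\
    forall y, `|y - c| < r -> `|F y - F c| < 1.
  move=> c; have [Kc|nK] := pselect (K c); last by exists 0.
  by have [r r0 H] := continuous_cubeP (cF c Kc) ltr01; exists r.
have [s [sK cov]] := finite_cover cK (fun c Kc => (Hr c Kc).1).
exists (\sum_(c <- s) (`|F c| + 1)); first by apply: sumr_ge0 => c _; rewrite addr_ge0.
move=> x Kx; have [c cs xc] := cov x Kx.
rewrite (big_rem c cs)/=; apply: (@le_trans _ _ (`|F c| + 1)); last first.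
  by rewrite lerDl; apply: sumr_ge0 => c' _; rewrite addr_ge0.
have := (Hr c (sK c cs)).2 x xc; have := ler_normD (F x - F c) (F c); rewrite subrK; lra.
Qed.

Lemma compact_margin (K U : set V) : compact K -> open U -> K `<=` U ->
  exists2 d, 0 < d & forall x, K x -> forall y, `|y - x| <= d -> U y.
Proof.
move=> cK oU KU.
have /choice[r Hr] : forall c, exists r, K c -> 0 < r / 2 /\ forall y, `|y - c| < r -> U y.
  move=> c; have [Kc|nK] := pselect (K c); last by exists 0.
  by have [r r0 H] := open_cubeP oU (KU c Kc); exists r; split => //; rewrite divr_gt0.
have [s [sK cov]] := finite_cover cK (fun c Kc => (Hr c Kc).1).
have [d d0 ds] := positive_lower_bound (fun c cs => (Hr c (sK c cs)).1).
exists d => // x Kx y yx; have [c cs xc] := cov x Kx.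
apply: (Hr c (sK c cs)).2.
rewrite (_ : y - c = (y - x) + (x - c)); last by rewrite addrA subrK.
by apply: le_lt_trans (ler_normD _ _) _; have := ds c cs; lra.
Qed.

Variables (U : set V) (u : V -> R) (M : R).
Hypotheses (oU : open U) (cU : compact (closure U)) (hu : harmonic_in U u) (M0 : 0 < M).
Hypothesis uM : forall x, U x -> `|u x| <= M.
Let C1 : classC 1 U u := classCW (isT : (1 <= 2)%N) hu.1.
Let mU : measurable U. Proof. exact: open_measurable_rV. Qed.
Local Notation u0 := (u \_ U).
Local Notation g j := ((partial j u) \_ U).

Let integrable_dom (B : R) : 0 <= B -> mu.-integrable setT (fun x => (B * \1_U x)%:E).
Proof.
move=> B0; apply/integrableP; split.
  by apply/measurable_EFinP; apply: measurable_funM => //; exact: measurable_indic.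
under eq_integral do rewrite gee0_abs ?lee_fin ?mulr_ge0//.
rewrite integralRZl//.
rewrite integralR_indic// lte_mul_pinfty//; exact: bounded_measure_lty.
Qed.

Let integrable_bounded (F : V -> R) (B : R) : 0 <= B -> measurable_fun setT F ->
  (forall x, `|F x| <= B * \1_U x) -> mu.-integrable setT (fun x => (F x)%:E).
Proof.
move=> B0 mF FB; apply: le_integrable (integrable_dom B0) => //.
  exact/measurable_EFinP.
by move=> x _; rewrite !abse_EFin lee_fin (le_trans (FB x))// ler_norm.
Qed.

Let dct (F : nat -> V -> R) (G : V -> R) (B : R) : 0 <= B ->
  (forall k, measurable_fun setT (F k)) -> measurable_fun setT G ->
  (forall k x, `|F k x| <= B * \1_U x) -> (forall x, F k x @[k --> \oo] --> G x) ->
  (\int[mu]_x (F k x)%:E @[k --> \oo] --> \int[mu]_x (G x)%:E)%E.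
Proof.
move=> B0 mF mG FB FG.
have mF' k : measurable_fun setT (fun x => (F k x)%:E) by exact/measurable_EFinP.
have mG' : measurable_fun setT (fun x => (G x)%:E) by exact/measurable_EFinP.
have FG' : {ae mu, forall x, setT x -> (F k x)%:E @[k --> \oo] --> (G x)%:E}.
  by apply/aeW => x _; apply: cvg_EFin; [exact: nearW|exact: FG].
have FB' : {ae mu, forall x k, setT x -> (`|(F k x)%:E| <= (B * \1_U x)%:E)%E}.
  by apply/aeW => x k _; rewrite abse_EFin lee_fin.
by have [] := @dominated_convergence _ _ _ mu setT measurableT
  (fun k x => (F k x)%:E) _ _ mF' mG' FG' (integrable_dom B0) FB'.
Qed.

(** Translation moves the difference quotient from [phi] to the zero extension of [u]; dominated
    convergence on both sides gives the identity. *)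
Lemma weak_partial i phi : test_function U phi ->
  (\int[mu]_(x in U) (u x * partial i phi x)%:E =
   (-1)%:E * \int[mu]_(x in U) (partial i u x * phi x)%:E)%E.
Proof.
move=> [sphi]; set K := closure _ => cK KU.
have Cp : classC 1 setT phi := sphi 1%N.
have phiK x : ~ K x -> phi x = 0.
  by move=> nK; apply/eqP/negPn/negP => px; apply: nK; exact: subset_closure.
have dphiK x : ~ K x -> partial i phi x = 0.
  move=> nK; rewrite /partial (near_eq_derive (g := cst 0)) ?derive_cst//.
  have oK : open (~` K) by apply: closed_openC; exact: closed_closure.
  by apply: filterS (open_nbhs_nbhs (conj oK nK)) => y; exact: phiK.
have [B0 B00 HB0] := continuous_compact_bounded cK (fun x _ => classC_continuous Cp I).
have [B1 B10 HB1] := continuous_compact_bounded cK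
  (fun x _ => classC_continuous (classC_partial i Cp) I).
have phiB x : `|phi x| <= B0.
  by have [/HB0//|/phiK ->] := pselect (K x); rewrite normr0.
have dphiB x : `|partial i phi x| <= B1.
  by have [/HB1//|/dphiK ->] := pselect (K x); rewrite normr0.
have [d d0 Hd] := compact_margin cK oU KU.
(* The gradient may blow up at the boundary, so it is bounded only within d/2 of the support of
   [phi], by the interior estimate with oscillation 2 M. *)
pose B2 : R := n.+1%:R * (2 * M) / (d / 2).
have B20 : 0 <= B2 by rewrite divr_ge0 ?mulr_ge0// ltW// divr_gt0.
have duB x : (exists2 y, K y & `|x - y| <= d / 2) -> `|partial i u x| <= B2.
  move=> [y Ky xy].
  have cube z : `|z - x| <= d / 2 -> U z.
    move=> zx; apply: (Hd y Ky); rewrite (_ : z - y = (z - x) + (x - y)); last by rewrite addrA subrK.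
    by apply: le_trans (ler_normD _ _) _; lra.
  have osc z z' : `|z - x| <= d / 2 -> `|z' - x| <= d / 2 -> `|u z - u z'| <= 2 * M.
    move=> zx z'x; apply: le_trans (ler_normB _ _) _.
    by have := uM (cube _ zx); have := uM (cube _ z'x); lra.
  have d20 : 0 < d / 2 by rewrite divr_gt0.
  exact: (partial_bound i oU hu d20 cube osc).
pose tau k : R := d / 2 * 2^-1 ^+ k.
have tau0 k : 0 < tau k by rewrite mulr_gt0// ?divr_gt0// exprn_gt0.
have tau_le k : tau k <= d / 2.
  by rewrite ler_piMr ?divr_ge0 ?(ltW d0)// exprn_ile1// invf_le1// ler1n.
have tau_cvg : tau k @[k --> \oo] --> 0.
  by apply: cvg_geometric; rewrite ger0_norm// invf_lt1// ltr1n.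
have mu0 : measurable_fun setT u0 by exact: measurable_f0.
have mphi : measurable_fun setT phi.
  by apply: measurable_continuous_rV; [exact: openT|move=> x _; exact: (classC_continuous Cp)].
have mdphi : measurable_fun setT (partial i phi).
  apply: measurable_continuous_rV; first exact: openT.
  by move=> x _; exact: (classC_continuous (classC_partial i Cp)).
have u0B x : `|u0 x| <= M * \1_U x.
  rewrite patchE; case: ifPn => [|xU]; first by rewrite inE => Ux; rewrite (indic_in _ Ux) mulr1 uM.
  by rewrite normr0 mulr_ge0// ltW.
have phiU x : `|phi x| <= B0 * \1_U x.
  have [Kx|/phiK ->] := pselect (K x); last by rewrite normr0 mulr_ge0.
  by rewrite (indic_in _ (KU x Kx)) mulr1.
have u0M x : `|u0 x| <= M.
  by apply: le_trans (u0B x) _; rewrite ler_piMr ?(ltW M0)//; exact: indic_le1.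
have u0E x k : K x -> u0 (x - tau k *: e i) = u (x - tau k *: e i).
  move=> Kx; rewrite patchE mem_set//; apply: (Hd x Kx); rewrite addrC addKr -scaleNr.
  apply: le_trans (rV_delta_norm _ _) _; rewrite normrN gtr0_norm//.
  by have := tau_le k; have := d0; lra.
(* [A] carries the quotient on [phi], [B] carries it backwards on [u0]. The integrals agree by a
   shift of the product; the steps [tau k] are at most d/2, so [B] samples [u] inside [U] wherever
   [phi] is nonzero. *)
pose A k (x : V) := (tau k)^-1 * (u0 x * phi (x + tau k *: e i) - u0 x * phi x).
pose B k (x : V) := (tau k)^-1 * (u0 (x - tau k *: e i) * phi x - u0 x * phi x).
have mphis k : measurable_fun setT (fun x : V => phi (x + tau k *: e i)).
  by apply: (measurableT_comp mphi); exact: rV_shift.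
have mu0s k : measurable_fun setT (fun x : V => u0 (x - tau k *: e i)).
  by apply: (measurableT_comp mu0); exact: rV_shift.
have mP k : measurable_fun setT (fun x : V => u0 x * phi (x + tau k *: e i)) by exact: measurable_funM.
have mP' k : measurable_fun setT (fun x : V => u0 (x - tau k *: e i) * phi x) by exact: measurable_funM.
have mQ : measurable_fun setT (fun x => u0 x * phi x) by exact: measurable_funM.
have AB k : (\int[mu]_x (A k x)%:E = \int[mu]_x (B k x)%:E)%E.
  have MB0 : 0 <= M * B0 by rewrite mulr_ge0// ltW.
  have iP : mu.-integrable setT (fun x => (u0 x * phi (x + tau k *: e i))%:E).
    apply: (integrable_bounded MB0) => // x; rewrite normrM mulrAC.
    by apply: ler_pM.
  have iP' : mu.-integrable setT (fun x => (u0 (x - tau k *: e i) * phi x)%:E).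
    apply: (integrable_bounded MB0) => // x; rewrite normrM -mulrA.
    by apply: ler_pM.
  have iQ : mu.-integrable setT (fun x => (u0 x * phi x)%:E).
    apply: (integrable_bounded MB0) => // x; rewrite normrM -mulrA.
    by apply: ler_pM.
  have PP : (\int[mu]_x (u0 x * phi (x + tau k *: e i))%:E =
      \int[mu]_x (u0 (x - tau k *: e i) * phi x)%:E)%E.
    rewrite -[RHS](integral_rV_shift_real (tau k *: e i)) //.
    by apply: eq_integral => x _; rewrite addrK.
  rewrite /A /B; under eq_integral do rewrite EFinM.
  rewrite integralZl//; last exact: (integrableB measurableT iP iQ).
  under [RHS]eq_integral do rewrite EFinM.
  rewrite integralZl//; last exact: (integrableB measurableT iP' iQ).
  congr (_ * _)%E; under eq_integral do rewrite EFinB.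
  by rewrite integralB_EFin// PP -integralB_EFin//; apply: eq_integral => x _; rewrite EFinB.
have limA : (\int[mu]_x (A k x)%:E @[k --> \oo] --> \int[mu]_x (u0 x * partial i phi x)%:E)%E.
  apply: (@dct _ _ (M * B1)).
  - by rewrite mulr_ge0// ltW.
  - by move=> k; apply: measurable_funM => //; exact: measurable_funB.
  - exact: measurable_funM.
  - move=> k x; rewrite /A -mulrBr mulrCA normrM mulrAC; apply: ler_pM => //.
    rewrite normrM gtr0_norm ?invr_gt0// mulrC ler_pdivrMr//.
    by apply: (partial_increment_le Cp (ltW (tau0 k))) => t _; split.
  - move=> x; under eq_fun do rewrite /A -mulrBr mulrCA.
    apply: cvgM; first exact: cvg_cst.
    have := cvgn_difference_quotient (classC_is_derive0 i Cp (I : setT x)) (fun k => lt0r_neq0 (tau0 k)) tau_cvg.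
    by under eq_fun do rewrite scale0r addr0 mulrC.
have limB : (\int[mu]_x (B k x)%:E @[k --> \oo] --> \int[mu]_x (- (g i x * phi x))%:E)%E.
  apply: (@dct _ _ (B2 * B0)).
  - exact: mulr_ge0.
  - by move=> k; apply: measurable_funM => //; exact: measurable_funB.
  - by apply: measurableT_comp => //; apply: measurable_funM => //; exact: measurable_g.
  - move=> k x; rewrite /B -mulrBl mulrA normrM -[leRHS]mulrA.
    have [Kx|/phiK ->] := pselect (K x); last by rewrite normr0 mulr0 mulr_ge0// mulr_ge0.
    apply: ler_pM => //.
    rewrite normrM gtr0_norm ?invr_gt0// mulrC ler_pdivrMr// u0E//.
    rewrite [u0 x]patchE mem_set; last exact: KU.
    rewrite distrC -{1}(subrK (tau k *: e i) x).
    apply: (partial_increment_le C1 (ltW (tau0 k))) => t /andP[t0 tk].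
    have xt : `|x - tau k *: e i + t *: e i - x| <= d / 2.
      rewrite addrAC (addrAC x) subrr sub0r addrC -scalerBl.
      apply: le_trans (rV_delta_norm _ _) _; rewrite ler0_norm; have := tau_le k; lra.
    split; first by apply: (Hd x Kx); have := d0; lra.
    by apply: duB; exists x.
  - move=> x; have [Kx|/phiK px] := pselect (K x); last first.
      by under eq_fun do rewrite /B px !mulr0 subr0 mulr0; rewrite px mulr0 oppr0; exact: cvg_cst.
    have E0 : u0 x = u x by rewrite patchE mem_set//; exact: KU.
    under eq_fun do rewrite /B -mulrBl mulrA u0E// E0.
    rewrite -mulNr; apply: cvgM; last exact: cvg_cst.
    have := cvgn_difference_quotient (classC_is_derive0N i C1 (KU x Kx)) (fun k => lt0r_neq0 (tau0 k)) tau_cvg.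
    rewrite [g i x]patchE mem_set; last exact: KU.
    by under eq_fun do rewrite scale0r subr0 mulrC.
have lim2 : (\int[mu]_x (A k x)%:E @[k --> \oo] --> \int[mu]_x (- (g i x * phi x))%:E)%E.
  by under eq_fun do rewrite AB; exact: limB.
have E := cvg_unique (@ereal_hausdorff R) limA lim2.
have Ug : (\int[mu]_(x in U) (partial i u x * phi x)%:E = \int[mu]_x (g i x * phi x)%:E)%E.
  rewrite integral_mkcond; apply: eq_integral => x _; rewrite !patchE.
  by case: ifP => // _; rewrite mul0r.
have Uu : (\int[mu]_(x in U) (u x * partial i phi x)%:E = \int[mu]_x (u0 x * partial i phi x)%:E)%E.
  rewrite integral_mkcond; apply: eq_integral => x _; rewrite !patchE.
  by case: ifP => // _; rewrite mul0r.
rewrite Uu Ug E; under eq_integral do rewrite -mulN1r EFinM.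
rewrite integralZl//.
apply: (integrable_bounded (mulr_ge0 B20 B00)).
  by apply: measurable_funM => //; exact: measurable_g.
move=> x; rewrite normrM -mulrA; have [Kx|/phiK ->] := pselect (K x); last first.
  by rewrite normr0 mulr0 mulr_ge0// mulr_ge0.
apply: ler_pM => //; rewrite patchE mem_set; last exact: KU.
by apply: duB; exists x => //; rewrite subrr normr0 divr_ge0// ltW.
Qed.

End weak.

Section multi_index.
Variables (R : realType) (n : nat).

(** The Sobolev orders that occur are below 2, so only these multi-indices matter. *)
Lemma multi_order_le1 (a : {ffun 'I_n -> nat}) : (multi_order a <= 1)%N ->
  (forall phi : 'rV[R]_n -> R, multi_partial a phi = phi) /\ multi_order a = 0%N \/
  exists i, (forall phi : 'rV[R]_n -> R, multi_partial a phi = partial i phi) /\ multi_order a = 1%N.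
Proof.
rewrite leq_eqVlt ltnS leqn0 => /orP[/eqP a1|/eqP a0]; last first.
  left; split => // phi; rewrite /multi_partial.
  have z j : a j = 0%N by apply/eqP; move/eqP: a0; rewrite sum_nat_eq0 => /forallP/(_ j).
  by elim: (enum _) => //= j s ->; rewrite z.
right.
have [i ai] : exists i, (0 < a i)%N.
  apply/existsP; apply: contra_eqT a1 => /existsPn H.
  by rewrite /multi_order big1// => j _; apply/eqP; rewrite -leqn0 leqNgt H.
exists i; split => // phi; rewrite /multi_partial.
have := a1; rewrite /multi_order (bigD1 i)//= => /eqP.
have ai1 : a i = 1%N.
  by apply/eqP; rewrite eqn_leq ai andbT -a1 /multi_order (bigD1 i)//= leq_addr.
rewrite ai1 -[X in _ == X]addn0 eqn_add2l sum_nat_eq0 => /forallP z.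
have z' j : j != i -> a j = 0%N by move=> ji; apply/eqP; have := z j; rewrite ji.
have H s : uniq s -> foldr (fun i0 => iter (a i0) (partial i0)) phi s =
    if i \in s then partial i phi else phi.
  elim: s => //= j s IH /andP[js us]; rewrite IH// inE.
  case: (eqVneq j i) => [ji|ji]; last by rewrite z'// eq_sym (negbTE ji).
  by rewrite ji ai1 /= -ji (negbTE js).
by rewrite H ?enum_uniq// mem_enum.
Qed.

End multi_index.

(** * Sobolev regularity *)

Section assembly.
Variables (R : realType) (n : nat) (U : set 'rV[R]_n).
Local Notation V := 'rV[R]_n.
Local Notation mu := (lebesgue_rV R n).
Hypotheses (n0 : (0 < n)%N) (oU : open U) (bU : bounded_set U) (sU : smooth_boundary U).

Lemma bounded_setP : exists2 N : R, 0 < N & forall x, U x -> `|x| <= N.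
Proof.
have [N0 [_ HN]] := bU; exists (`|N0| + 1); first by rewrite ltr_wpDl.
by move=> x Ux; apply: HN => //; apply: le_lt_trans (ler_norm _) _; rewrite ltrDl.
Qed.

Lemma compact_closure_bounded : compact (closure U).
Proof.
have [N N_gt0 HN] := bounded_setP.
apply: bounded_closed_compact; last exact: closed_closure.
exists (N + 1); split; first exact: num_real.
move=> M NM x cx; have [y [Uy]] := cx _ (nbhsx_ballx x 1 ltr01).
rewrite -ball_normE /= => xy; apply: le_trans (ltW NM).
by have := ler_normD (x - y) y; have := HN y Uy; rewrite subrK; lra.
Qed.
Let cU := compact_closure_bounded.
Let mU : measurable U. Proof. exact: open_measurable_rV. Qed.

Lemma square_integrable_lty (f : V -> R) : measurable_fun setT (f \_ U) ->
  (\int[mu]_x ((f \_ U) x ^+ 2)%:E < +oo)%E -> square_integrable U f.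
Proof.
move=> mf fin; rewrite /square_integrable.
apply/andP; split; rewrite inE //=.
rewrite /finite_norm unlock /=; apply: poweR_lty.
apply: le_lt_trans fin; rewrite le_eqVlt; apply/orP; left; apply/eqP.
apply: eq_integral => x _; congr (_%:E).
by rewrite powR_mulrn// real_normK// num_real.
Qed.

Lemma bounded_sqr_lty (f : V -> R) M : classC 1 U f -> 0 < M ->
  (forall x, U x -> `|f x| <= M) -> (\int[mu]_x ((f \_ U) x ^+ 2)%:E < +oo)%E.
Proof.
move=> C1 M0 fM.
apply: (@le_lt_trans _ _ (\int[mu]_x (M ^+ 2 * \1_U x)%:E)%E); last first.
  rewrite integralRZl ?sqr_ge0//; rewrite integralR_indic// lte_mul_pinfty ?lee_fin ?sqr_ge0//.
  exact: bounded_measure_lty.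
apply: le_integralR.
- by apply: measurable_funX; exact: measurable_f0.
- by apply: measurable_funM => //; exact: measurable_indic.
move=> x; rewrite sqr_ge0 /= patchE; case: ifPn => [|_]; last first.
  by rewrite expr0n mulr_ge0// sqr_ge0.
rewrite inE => Ux; rewrite (indic_in _ Ux) mulr1 -[leLHS]real_normK ?num_real//.
by rewrite ler_pXn2r ?nnegrE ?(ltW M0)// fM.
Qed.

Lemma gagliardo_local (f : V -> R) theta : classC 1 U f ->
  (\int[mu]_x ((f \_ U) x ^+ 2)%:E < +oo)%E -> 0 < theta < 1 ->
  (forall c R0 L C2 i b rho, chart U c R0 L C2 i b rho -> exists2 r, 0 < r <= R0 & forall j,
    (\int[mu]_x (\1_([set x | (`|x - c| < r)%R] `&` U) x *
     (rho x `^ (2 - 2 * theta) * ((partial j f) \_ U) x ^+ 2))%:E < +oo)%E) ->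
  (gagliardo theta U f < +oo)%E.
Proof.
move=> C1 L2 th loc; apply: gagliardo_lty => //; first by case/andP: th.
move=> c cUc; have [R0 [L [C2 [i [b [rho ch]]]]]] := exists_chart n0 oU sU cUc.
have [r /andP[r0 rR] en] := loc _ _ _ _ _ _ _ ch.
exact: (embedding_at ch oU C1 r0 rR th en).
Qed.

Lemma weak_derivative_order0 (a : {ffun 'I_n -> nat}) (f : V -> R) :
  multi_order a = 0%N -> weak_derivative U a f f.
Proof.
move=> a0 phi _; have a1 : (multi_order a <= 1)%N by rewrite a0.
have [[H _]|[i [_ H]]] := @multi_order_le1 R n a a1; last by rewrite a0 in H.
by rewrite H a0 expr0 mul1e.
Qed.

Lemma sobolev_lt1 (f : V -> R) (s : R) : classC 1 U f -> 0 < s < 1 ->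
  (\int[mu]_x ((f \_ U) x ^+ 2)%:E < +oo)%E -> (gagliardo s U f < +oo)%E -> sobolev s U f.
Proof.
move=> C1 /andP[s0 s1] L2 gag; have si := square_integrable_lty (measurable_f0 oU C1) L2.
have k0 : Num.truncn s = 0%N by apply: truncn_def; rewrite (ltW s0).
rewrite /sobolev k0; split => // a; rewrite leqn0 => /eqP a0.
exists f; split; [exact: si|exact: weak_derivative_order0|by move=> _ _; rewrite subr0].
Qed.

(** The case s = 1 is included: there the definition asks for no seminorm, which is why the last
    premise is guarded by 1 < s. *)
Lemma sobolev_lt2 (u : V -> R) (M s : R) : harmonic_in U u -> 0 < M ->
  (forall x, U x -> `|u x| <= M) -> 1 <= s < 2 ->
  (forall i, \int[mu]_x (((partial i u) \_ U) x ^+ 2)%:E < +oo)%E ->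
  (1 < s -> forall i, (gagliardo (s - 1)%R U (partial i u) < +oo)%E) -> sobolev s U u.
Proof.
move=> hu M0 uM s12 L2 gag.
have C1 : classC 1 U u by exact: classCW hu.1.
have si : square_integrable U u.
  apply: square_integrable_lty; first exact: measurable_f0.
  exact: bounded_sqr_lty uM.
have k1 : Num.truncn s = 1%N by exact: truncn_def.
rewrite /sobolev k1; split => // a a1.
have [[_ a0]|[i [H ai]]] := @multi_order_le1 R n a a1.
  by exists u; split; [exact: si|exact: weak_derivative_order0|rewrite a0].
exists (partial i u); split.
- by apply: square_integrable_lty => //; exact: measurable_g.
- by move=> phi tphi; rewrite H ai expr1; exact: (weak_partial oU cU hu M0 uM).
- by move=> _ s1; exact: gag.
Qed.

Lemma continuous_closure_bounded (u : V -> R) : {within closure U, continuous u} ->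
  exists2 M, 0 < M & forall x, U x -> `|u x| <= M.
Proof.
move=> cu; have [M0 [_ HM]] := compact_bounded (continuous_compact cu cU).
exists (`|M0| + 1); first by rewrite ltr_wpDl.
move=> x Ux; apply: HM; last by exists x => //; exact: subset_closure.
by apply: le_lt_trans (ler_norm _) _; rewrite ltrDl.
Qed.

Lemma sobolev_continuous (u : V -> R) : harmonic_in U u ->
  {within closure U, continuous u} -> sobolev (1 / 2) U u.
Proof.
move=> hu cu; have [M M0 uM] := continuous_closure_bounded cu.
have C1 : classC 1 U u by exact: classCW hu.1.
have h0 : 0 < 1 / 2 :> R by rewrite divr_gt0.
have h1 : 1 / 2 < 1 :> R by lra.
have h01 : 0 < (1 / 2 : R) < 1 by rewrite h0 h1.
apply: sobolev_lt1 => //; first exact: bounded_sqr_lty uM.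
apply: gagliardo_local => //; first exact: bounded_sqr_lty uM.
move=> c R0 L C2 i b rho ch.
have [r rR en] := harmonic_energy oU hu M0 uM ch; exists r => // j.
have -> : 2 - 2 * (1 / 2) = 1 :> R by field.
apply: le_lt_trans (en j); rewrite le_eqVlt; apply/orP; left; apply/eqP.
apply: eq_integral => x _; congr (_%:E).
have [[/= xr Ux]|nx] := pselect (([set x | `|x - c| < r] `&` U) x); last first.
  by rewrite (indic_notin _ nx) !mul0r.
(* The power with exponent 1 is [rho] itself only where [rho] is nonnegative, which the indicator
   ensures. *)
congr (_ * (_ * _)); rewrite powRr1//; apply/ltW/(chart_dom ch) => //.
by case/andP: rR => _; exact: lt_le_trans.
Qed.

Lemma holder_supnorm (u : V -> R) (alpha : R) : 0 < alpha -> holder alpha (closure U) u ->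
  exists2 H, 0 <= H & forall y z, U y -> U z -> `|u y - u z| <= H * `|y - z| `^ alpha.
Proof.
move=> al0 [C HC]; exists (`|C| * n.+1%:R `^ alpha); first by rewrite mulr_ge0 ?powR_ge0.
move=> y z Uy Uz; apply: le_trans (HC y z (subset_closure Uy) (subset_closure Uz)) _.
have e0 : 0 <= euclidean_norm (y - z) by exact: sqrtr_ge0.
apply: (@le_trans _ _ (`|C| * euclidean_norm (y - z) `^ alpha)).
  by rewrite ler_wpM2r ?powR_ge0// ler_norm.
rewrite -mulrA -powRM// ler_wpM2l//.
apply: ge0_ler_powR; rewrite ?nnegrE ?(ltW al0) ?mulr_ge0//.
exact: euclidean_norm_le.
Qed.

Lemma holder_bounded (u : V -> R) (H alpha : R) : 0 < alpha -> 0 <= H ->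
  (forall y z, U y -> U z -> `|u y - u z| <= H * `|y - z| `^ alpha) ->
  exists2 M, 0 < M & forall x, U x -> `|u x| <= M.
Proof.
move=> al0 H0 hol; have [[x0 Ux0]|U0] := pselect (exists x, U x); last first.
  by exists 1 => // x Ux; case: U0; exists x.
have [N N0 HN] := bounded_setP.
have W0 : 0 <= H * (2 * N) `^ alpha by rewrite mulr_ge0 ?powR_ge0.
exists (`|u x0| + H * (2 * N) `^ alpha + 1); first by rewrite ltr_wpDl// addr_ge0.
move=> x Ux; have := ler_normD (u x - u x0) (u x0); rewrite subrK.
have : `|u x - u x0| <= H * (2 * N) `^ alpha.
  apply: le_trans (hol x x0 Ux Ux0) _; rewrite ler_wpM2l//.
  apply: ge0_ler_powR; rewrite ?nnegrE ?(ltW al0)//; first by rewrite mulr_ge0// ltW.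
  by apply: le_trans (ler_normB _ _) _; have := HN x Ux; have := HN x0 Ux0; lra.
lra.
Qed.

(** With s = sigma + 1/2, the exponents (2 - 2s) + 2(alpha - 1) for u and (4 - 2s) + 2(alpha - 2)
    for its derivatives both equal 2 alpha - 2 sigma - 1, above -1 because sigma < alpha. *)
Lemma sobolev_holder (u : V -> R) (alpha sigma : R) : harmonic_in U u -> alpha < 1 ->
  holder alpha (closure U) u -> 0 < sigma < alpha -> sobolev (sigma + 1 / 2) U u.
Proof.
move=> hu al1 hol /andP[s0 sa].
have al0 : 0 < alpha by exact: lt_trans sa.
have [H H0 hH] := holder_supnorm al0 hol.
have [M M0 uM] := holder_bounded al0 H0 hH.
have C1 : classC 1 U u by exact: classCW hu.1.
have L2 := bounded_sqr_lty C1 M0 uM.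
have mg j := measurable_g oU C1 j.
have r2 (R0 : R) : 0 < R0 -> 0 < R0 / 2 <= R0.
  by move=> R00; rewrite divr_gt0//=; lra.
case: (ltP sigma (1 / 2)) => [sl|sl].
  apply: sobolev_lt1 => //; first by apply/andP; split; lra.
  apply: gagliardo_local => //; first by apply/andP; split; lra.
  move=> c R0 L C2 i b rho ch; have [C C0 HC] := holder_partial_bound ch oU hu H0 al0 hH.
  have rr := r2 _ (chart_R0 ch); exists (R0 / 2) => // j; case/andP: rr => r0 rR.
  apply: (chart_weighted_lty (beta := alpha - 1) (C := C) ch oU r0 rR C0 (mg j)); first lra.
  by move=> x xr Ux; rewrite patchE mem_set//; exact: (HC x xr Ux j j).1.
(* From here on sigma >= 1/2, hence alpha > 1/2, and 2(alpha - 1) > -1 makes the gradient square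
   integrable. At sigma = 1/2 this already finishes the proof. *)
have L2i i : (\int[mu]_x (((partial i u) \_ U) x ^+ 2)%:E < +oo)%E.
  have := @local_integral_lty R n U oU cU (fun x => ((partial i u) \_ U) x ^+ 2).
  have -> : (\int[mu]_x (((partial i u) \_ U) x ^+ 2)%:E =
      \int[mu]_x (\1_U x * ((partial i u) \_ U) x ^+ 2)%:E)%E.
    apply: eq_integral => x _; congr (_%:E); have [Ux|Ux] := pselect (U x).
      by rewrite (indic_in _ Ux) mul1r.
    by rewrite (indic_notin _ Ux) mul0r patchE memNset// expr0n.
  apply; [exact: measurable_funX|by move=> x; exact: sqr_ge0|].
  move=> c cUc; have [R0 [L [C2 [i' [b [rho ch]]]]]] := exists_chart n0 oU sU cUc.
  have [C C0 HC] := holder_partial_bound ch oU hu H0 al0 hH.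
  have /andP[r0 rR] := r2 _ (chart_R0 ch); exists (R0 / 2) => //.
  have mb : -1 < 0 + 2 * (alpha - 1) by lra.
  have := chart_weighted_lty (beta := alpha - 1) (C := C) ch oU r0 rR C0 (mg i) mb.
  under eq_integral do rewrite powRr0 mul1r.
  by apply => x xr Ux; rewrite patchE mem_set//; exact: (HC x xr Ux i i).1.
apply: (sobolev_lt2 hu M0 uM) => //; first by apply/andP; split; lra.
move=> s1 i; have Ci : classC 1 U (partial i u) by exact: classC_partial hu.1.
apply: gagliardo_local => //; first by apply/andP; split; lra.
move=> c R0 L C2 i' b rho ch; have [C C0 HC] := holder_partial_bound ch oU hu H0 al0 hH.
have rr := r2 _ (chart_R0 ch); exists (R0 / 2) => // j; case/andP: rr => r0 rR.
apply: (chart_weighted_lty (beta := alpha - 2) (C := C) ch oU r0 rR C0 (measurable_g oU Ci j)); first lra.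
by move=> x xr Ux; rewrite patchE mem_set//; exact: (HC x xr Ux i j).2.
Qed.

End assembly.

Theorem proposition8 (R : realType) (n : nat) (Omega : set 'rV[R]_n)
    (u : 'rV[R]_n -> R) :
  (2 <= n)%N -> open Omega -> bounded_set Omega -> smooth_boundary Omega ->
  harmonic_in Omega u ->
  ({within closure Omega, continuous u} -> sobolev (1 / 2) Omega u) /\
  (forall alpha : R, 0 < alpha < 1 -> holder alpha (closure Omega) u ->
     forall sigma : R, 0 < sigma < alpha -> sobolev (sigma + 1 / 2) Omega u).
Proof.
move=> n2 oO bO sO hu; have n0 : (0 < n)%N by exact: ltnW.
split=> [cu|alpha /andP[_ al1] hol sigma sa]; first exact: sobolev_continuous.
exact: (sobolev_holder n0 oO bO sO hu al1 hol sa).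
Qed.
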